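(* Let $n=1$, $\Omega_0=(0,1)$, and consider the case without heat conductivity, i.e. $\kappa=0$, with $\bar\mu>0$ and $2\bar\mu+\bar\lambda>0$. Assume $0\le\alpha\le\frac{1}{\gamma-1}$. Let $\delta>0$ and let $C_1,C_2\in(0,\infty)$ be such that, for $y\in\Omega_0$ in a neighborhood of $\Gamma_0=\{0,1\}$, $$C_1^{-1}d^{\delta}(y)<\rho_0(y)<C_1d^{\delta}(y),\qquad C_2^{-1}d^{\delta-1}(y)<|\nabla_{\mathbf n}\rho_0(y)|<C_2d^{\delta-1}(y),$$ and assume that $$0<\frac{1}{\delta(\gamma-1)}<\min\Big\{\frac12\Big(\frac{\gamma-2}{\gamma-1}+\alpha\Big),\,1\Big\},\qquad \frac{u_0}{d^{1/2}}\in L^2(0,1).$$ There is a small constant $d_0\in(0,1)$, depending only on $C_1$ and $C_2$, such that the following holds. Assume that either there exists $Y_0\in(0,d_0)$ such that $u_0(Y_0)<0$ and $u_0(y)\le0$ for all $0<y<Y_0$, or there exists $Y_0\in(1-d_0,1)$ such that $u_0(Y_0)>0$ and $u_0(y)\ge0$ for all $Y_0<y<1$. Then, for any positive time $T$, the vacuum free boundary problem (FBP) described in the context has no solution $(\rho,u,\theta)$ on $[0,T]$ satisfying $$\rho,\theta\in C^{1,1}(\Omega(t)\times[0,T])\cap C(\overline{\Omega(t)}\times[0,T]),$$ $$u\in C^2_1(\Omega(t)\times[0,T])\cap C(\overline{\Omega(t)}\times[0,T])\cap L^\infty(0,T;W^{2,\infty}(\Omega(t))),\qquad u_t\in L^\infty(0,T;L^\infty(\Omega(t))),$$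 with entropy $s$ satisfying $$s\in L^\infty(0,T;L^\infty(\Omega(t))),\qquad s_t\in L^2(0,T;L^\infty(\Omega(t))).$$
   Context: Vacuum free boundary problem (FBP) in one dimension with $\kappa=0$. The unknowns are an evolving interval $\Omega(t)=(\omega_1(t),\omega_2(t))$ with $\Omega(0)=\Omega_0=(0,1)$ and $\Gamma(t)=\{\omega_1(t),\omega_2(t)\}$, the density $\rho$, velocity $u$ and absolute temperature $\theta$, satisfying $$\rho_t+(\rho u)_y=0,\qquad \rho u_t+\rho uu_y+p_y=(\nu u_y)_y,\qquad c_v(\rho\theta_t+\rho u\theta_y)+pu_y=\nu(u_y)^2\quad\text{in }\Omega(t),$$ $$\rho>0,\ \theta>0\ \text{ in }\Omega(t),\qquad \rho=\theta=0,\ \nu u_y=0\ \text{ on }\Gamma(t),$$ $$\omega_1'(t)=u(\omega_1(t),t),\qquad \omega_2'(t)=u(\omega_2(t),t),\qquad (\rho,u,\theta)|_{t=0}=(\rho_0,u_0,\theta_0)\ \text{ on }\Omega_0.$$ Here $\nu=\bar\nu\theta^\alpha$ with $\bar\nu=2\bar\mu+\bar\lambda$ (coming from the viscosities $\mu=\bar\mu\theta^\alpha$, $\lambda=\bar\lambda\theta^\alpha$, $\alpha\ge0$), and $\rho_0,\theta_0>0$ in $\Omega_0$, $\rho_0=\theta_0=0$ on $\Gamma_0=\partial\Omega_0$. State equations: $p=R\rho\theta=\bar A e^{s(\gamma-1)/R}\rho^\gamma$, which defines the entropy $s$; here $\gamma>1$, $R>0$, $\bar A>0$ are constants and $c_v=R/(\gamma-1)$.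 Notation: $d(y)=\min\{y,1-y\}$ is the distance to $\Gamma_0$; $\nabla_{\mathbf n}$ is the outward normal derivative (so $|\nabla_{\mathbf n}\rho_0|=|\rho_0'|$). ''$\Omega(t)\times[0,T]$'' means $\{(y,t):t\in[0,T],\,y\in\Omega(t)\}$, and similarly with $\overline{\Omega(t)}$. $C^{m_1}_{m_2}(\Omega(t)\times[0,T])$ is the set of functions that are $C^{m_1}$ in space and $C^{m_2}$ in time on this set, and $C^{1,1}$ means $C^1$ in space and $C^1$ in time. *)

(* Defs.v *)
From HB Require Import structures.
From mathcomp Require Import all_boot all_order all_algebra.
From mathcomp Require Import all_classical all_reals all_analysis.
Set Implicit Arguments.
Unset Strict Implicit.
Unset Printing Implicit Defensive.
Import Order.TTheory GRing.Theory Num.Theory.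
Import numFieldNormedType.Exports.
Local Open Scope classical_set_scope.
Local Open Scope ring_scope.

(* Functions of space and time are curried with space first: [f y t]. *)

Section calculus.
Context {R : realType}.
Implicit Types (T : R) (D : set (R * R)) (f : R -> R -> R).

Definition diff_quot (g : R -> R) (t : R) : R -> R :=
  fun r => (g r - g t) / (r - t).

(* Derivatives relative to [0, T]: one-sided at the end points. *)
Definition time_derivable T (g : R -> R) (t : R) : Prop :=
  cvg (diff_quot g t @ within `[0, T] t^').

Definition time_derive T (g : R -> R) (t : R) : R :=
  lim (diff_quot g t @ within `[0, T] t^').

Definition dt T f (y t : R) : R := time_derive T (f y) t.
Definition dy (k : nat) f (y t : R) : R := (f ^~ t)^`(k)%classic y.

Definition continuous_onD D f : Prop :=
  {within D, continuous (fun z : R * R => f z.1 z.2)}.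

(* C^m in space and C^1 in time on D, with the pure derivatives jointly
   continuous on D.  D is meant to be a set over [0, T] whose space sections
   are open and which is relatively open in R x [0, T], so that [dy] and [dt]
   only involve the values of f on D. *)
Definition space_time_C (m : nat) T D f : Prop :=
  [/\ forall k y t, (k < m)%N -> D (y, t) -> derivable (dy k f ^~ t) y 1,
      forall k, (k <= m)%N -> continuous_onD D (dy k f),
      forall y t, D (y, t) -> time_derivable T (f y) t &
      continuous_onD D (dt T f)].

End calculus.

Section moving_domain.
Context {R : realType}.
Variables (T : R) (w1 w2 : R -> R).
Implicit Type f : R -> R -> R.

Definition Omega (t : R) : set R := `]w1 t, w2 t[.

Definition tube : set (R * R) :=
  [set z | 0 <= z.2 <= T /\ w1 z.2 < z.1 < w2 z.2].

Definition closed_tube : set (R * R) :=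
  [set z | 0 <= z.2 <= T /\ w1 z.2 <= z.1 <= w2 z.2].

Definition Linfty_norm f (t : R) : \bar R :=
  'N[lebesgue_measure]_(+oo%E) [EFin \o ((f ^~ t) \_ (Omega t))].

(* f in L^p(0, T; L^oo(Omega(t))) *)
Definition in_Lp_Linfty (p : \bar R) f : Prop :=
  measurable_fun tube (fun z : R * R => f z.1 z.2) /\
  ('N[lebesgue_measure]_p [(Linfty_norm f) \_ `]0%R, T[] < +oo)%E.

(* f in L^oo(0, T; W^{k,oo}(Omega(t))) for f of class C^k in space, whose weak
   space derivatives are the classical ones. *)
Definition in_Linfty_Wkinfty (k : nat) f : Prop :=
  forall j, (j <= k)%N -> in_Lp_Linfty +oo%E (dy j f).

End moving_domain.

Section free_boundary_problem.
Context {R : realType}.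
(* Rg is the gas constant and Abar the constant of the state equation. *)
Variables (mubar lambdabar alpha gamma Rg Abar : R).

Definition nubar : R := 2 * mubar + lambdabar.
Definition c_v : R := Rg / (gamma - 1).

Definition viscosity (theta : R -> R -> R) : R -> R -> R :=
  fun y t => nubar * theta y t `^ alpha.

Definition pressure (rho theta : R -> R -> R) : R -> R -> R :=
  fun y t => Rg * rho y t * theta y t.

Variables (T : R) (rho0 u0 theta0 : R -> R).
Variables (w1 w2 : R -> R) (rho u theta : R -> R -> R).

Let nu := viscosity theta.
Let p := pressure rho theta.
Let viscous_flux y t := nu y t * dy 1 u y t.

Record FBP : Prop := {
  FBP_domain : forall t, 0 <= t <= T -> w1 t < w2 t ;
  FBP_domain0 : w1 0 = 0 /\ w2 0 = 1 ;
  FBP_mass : forall y t, tube T w1 w2 (y, t) ->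
    dt T rho y t + dy 1 (fun x r => rho x r * u x r) y t = 0 ;
  FBP_momentum : forall y t, tube T w1 w2 (y, t) ->
    rho y t * dt T u y t + rho y t * u y t * dy 1 u y t + dy 1 p y t =
    dy 1 viscous_flux y t ;
  FBP_energy : forall y t, tube T w1 w2 (y, t) ->
    c_v * (rho y t * dt T theta y t + rho y t * u y t * dy 1 theta y t) +
      p y t * dy 1 u y t =
    nu y t * dy 1 u y t ^+ 2 ;
  FBP_positive : forall y t, tube T w1 w2 (y, t) ->
    0 < rho y t /\ 0 < theta y t ;
  FBP_vacuum : forall t, 0 <= t <= T ->
    [/\ rho (w1 t) t = 0, rho (w2 t) t = 0,
        theta (w1 t) t = 0 & theta (w2 t) t = 0] ;
  (* the boundary value of nu u_y is its trace from inside Omega(t) *)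
  FBP_stress_free : forall t, 0 <= t <= T ->
    viscous_flux y t @[y --> (w1 t)^'+] --> (0 : R) /\
    viscous_flux y t @[y --> (w2 t)^'-] --> (0 : R) ;
  FBP_kinematic : forall t, 0 <= t <= T ->
    diff_quot w1 t @ within `[0, T] t^' --> u (w1 t) t /\
    diff_quot w2 t @ within `[0, T] t^' --> u (w2 t) t ;
  FBP_initial : forall y, 0 < y < 1 ->
    [/\ rho y 0 = rho0 y, u y 0 = u0 y & theta y 0 = theta0 y]
}.

Definition is_entropy (s : R -> R -> R) : Prop :=
  forall y t, tube T w1 w2 (y, t) ->
    p y t = Abar * expR (s y t * (gamma - 1) / Rg) * rho y t `^ gamma.

Record regular_class (s : R -> R -> R) : Prop := {
  rho_C11 : space_time_C 1 T (tube T w1 w2) rho ;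
  rho_closure : continuous_onD (closed_tube T w1 w2) rho ;
  theta_C11 : space_time_C 1 T (tube T w1 w2) theta ;
  theta_closure : continuous_onD (closed_tube T w1 w2) theta ;
  u_C21 : space_time_C 2 T (tube T w1 w2) u ;
  u_closure : continuous_onD (closed_tube T w1 w2) u ;
  u_W2infty : in_Linfty_Wkinfty T w1 w2 2 u ;
  ut_Linfty : in_Lp_Linfty T w1 w2 +oo%E (dt T u) ;
  s_Linfty : in_Lp_Linfty T w1 w2 +oo%E s ;
  st_L2Linfty : in_Lp_Linfty T w1 w2 2%:E (dt T s)
}.

End free_boundary_problem.

Section initial_data.
Context {R : realType}.
Implicit Type y : R.

Definition bdist y : R := Num.min y (1 - y).

Definition vacuum_data (rho0 theta0 : R -> R) : Prop :=
  (forall y, 0 < y < 1 -> 0 < rho0 y /\ 0 < theta0 y) /\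
  [/\ rho0 0 = 0, rho0 1 = 0, theta0 0 = 0 & theta0 1 = 0].

(* The normal derivative of rho0 near {0, 1} is, up to sign, rho0'. *)
Definition density_profile (C1 C2 delta : R) (rho0 : R -> R) : Prop :=
  exists2 e : R, 0 < e & forall y, 0 < y < 1 -> bdist y < e ->
    [/\ C1^-1 * bdist y `^ delta < rho0 y < C1 * bdist y `^ delta,
        derivable rho0 y 1 &
        C2^-1 * bdist y `^ (delta - 1) < `|rho0^`()%classic y|
          < C2 * bdist y `^ (delta - 1)].

Definition weighted_L2 (u0 : R -> R) : Prop :=
  ((fun y => u0 y / Num.sqrt (bdist y)) \_ `]0, 1[) \in
    Lfun lebesgue_measure 2%:E.

End initial_data.

(* Main.v *)
Require Import Defs.
From HB Require Import structures.
From mathcomp Require Import all_boot all_order all_algebra.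
From mathcomp Require Import all_classical all_reals all_analysis.
From mathcomp Require Import measurable_realfun ess_sup_inf ring lra.
Set Implicit Arguments.
Unset Strict Implicit.
Unset Printing Implicit Defensive.
Import Order.TTheory GRing.Theory Num.Theory.
Import numFieldNormedType.Exports.
Local Open Scope classical_set_scope.
Local Open Scope ring_scope.

(* Work with x = (y - w1) / (w2 - w1) and D = d_t + c d_x, c being the fluid
   velocity relative to the moving frame, and let N, q be the mass and the
   momentum of (0, x).  Then D N = 0 and D q = nu u_y - p: passing from u to the
   primitive q turns the pressure gradient, whose sign is unknown, into the
   signed term - p.

   Since u_y is bounded, a comparison argument keeps the density of size
   (x (1 - x))^delta, so that N is of size x^(delta + 1) near x = 0.

   The entropy sg = ln theta - (gamma - 1) ln rho is bounded and satisfies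
   D sg = (gamma - 1) nu u_y^2 / p.  By AM-GM this production absorbs nu u_y in
   the equation of q at the cost of a term of order
   (nu p)^(1/2) ~ x^(delta (gamma + alpha (gamma - 1)) / 2).  The hypothesis on
   delta makes this exponent larger than delta + 1, and u0 vanishes at the end
   points because u0 / d^(1/2) is square integrable; hence the negative part of q
   is o(N) at the boundary at all times.

   If u0 <= 0 on (0, Y0) and u0(Y0) < 0, the maximum principle for the degenerate
   parabolic inequality D q <= nu (q_x / (rho L))_x / L, with a barrier that is a
   function of (N, t), gives on the contrary q <= - e N at some small time.  The
   barrier exists for every Y0 in (0, 1), so any d0 will do.  The other case
   follows by the reflection x -> 1 - x. *)

(** * One-sided derivatives and the maximum principle *)

(** The regularity class controls no space derivative of [rho] or [theta] up to the free boundary,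
    and gives the entropy no trace there. Comparisons therefore rest on quantities that vanish at
    both ends: [c], the powers of [x (1 - x)], and the total stress nu u_y - p. The first vanishes
    because the frame moves with the end points. The last vanishes linearly because its space
    derivative is [rho] times the acceleration, which is bounded. As a result mass and momentum are
    exact potentials with constant values at x = 0 and x = 1.

    The contradiction is one of rates. The bound alpha <= 1 / (gamma - 1) gives nu >= k rho, so in
    the mass variable the diffusion coefficient nu rho is at least of order N^(2 - 2 n), n = 1 /
    (delta + 1). A power below 2 lets the sign of the momentum at Y0 be felt down to mass 0 after an
    arbitrarily short time, and q / N becomes negative up to the boundary. The entropy estimate says
    instead that the lower limit of q / N at the boundary is nonnegative. *)

Section calculus.
Context {R : realType}.
Implicit Types (f g : R -> R) (a b d x y t : R).

Lemma is_derive_slope_gt0 f x d : is_derive x 1 f d -> 0 < d ->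
  exists2 e, 0 < e & forall y, y != x -> `|y - x| < e -> 0 < (f y - f x) / (y - x).
Proof.
move=> [df <-] d0.
have /cvgr_gt /(_ _ d0) := df.
rewrite /prop_near1 => -[e /= e0 He]; exists e => // y yx yxe.
have := He (y - x); rewrite /= sub0r normrN subr_eq0 /GRing.scale /= mulr1 subrK.
by rewrite mulrC; apply.
Qed.

Lemma is_derive_slope_lt0 f x d : is_derive x 1 f d -> d < 0 ->
  exists2 e, 0 < e & forall y, y != x -> `|y - x| < e -> (f y - f x) / (y - x) < 0.
Proof.
move=> df d0; have df' := is_deriveN df.
have [|e e0 He] := is_derive_slope_gt0 df'; first by rewrite oppr_gt0.
exists e => // y yx ye; rewrite -oppr_gt0.
by have := He _ yx ye; rewrite /= -opprD mulNr.
Qed.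

Lemma left_max_derive_ge0 f a x d : is_derive x 1 f d -> a < x ->
  (forall y, a <= y <= x -> f y <= f x) -> 0 <= d.
Proof.
move=> df ax fx; rewrite leNgt; apply/negP => d0.
have [e e0 He] := is_derive_slope_lt0 df d0.
pose h := Num.min (e / 2) (x - a).
have h0 : 0 < h by rewrite lt_min subr_gt0 ax divr_gt0.
have he : h < e by rewrite gt_min ltr_pdivrMr// ltr_pMr// ltr1n.
have hx : h <= x - a by rewrite ge_min lexx orbT.
have xh : x - h != x by rewrite -subr_eq0 addrC addKr oppr_eq0 gt_eqF.
have := He _ xh; rewrite addrC addKr normrN gtr0_norm// => /(_ he).
rewrite invrN mulrN oppr_lt0 pmulr_lgt0 ?invr_gt0// subr_gt0 ltNge fx//.
by apply/andP; split; lra.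
Qed.

Lemma right_max_derive_le0 f b x d : is_derive x 1 f d -> x < b ->
  (forall y, x <= y <= b -> f y <= f x) -> d <= 0.
Proof.
move=> df ax fx; rewrite leNgt; apply/negP => d0.
have [e e0 He] := is_derive_slope_gt0 df d0.
pose h := Num.min (e / 2) (b - x).
have h0 : 0 < h by rewrite lt_min subr_gt0 ax divr_gt0.
have he : h < e by rewrite gt_min ltr_pdivrMr// ltr_pMr// ltr1n.
have hx : h <= b - x by rewrite ge_min lexx orbT.
have xh : x + h != x by rewrite -subr_eq0 addrAC subrr add0r gt_eqF.
have := He _ xh; rewrite addrAC subrr add0r gtr0_norm// => /(_ he).
rewrite pmulr_lgt0 ?invr_gt0// subr_gt0 ltNge fx//.
by apply/andP; split; lra.
Qed.

Lemma interior_max_derive_eq0 f a b x d : is_derive x 1 f d -> a < x < b ->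
  (forall y, a <= y <= b -> f y <= f x) -> d = 0.
Proof.
move=> df /andP[ax xb] fx; apply/eqP; rewrite eq_le.
rewrite (right_max_derive_le0 df xb) ?(left_max_derive_ge0 df ax)// => y /andP[h1 h2].
  by apply: fx; rewrite h1 (le_trans h2)// ltW.
by apply: fx; rewrite h2 (le_trans _ h1)// ltW.
Qed.

(** A second-derivative test that does not differentiate the weight [r]. Were [d] positive, [w]
    would be positive just to the right of [x], and the mean value theorem would make [f] exceed its
    maximum there. *)
Lemma interior_max_factor_le0 f (r w : R -> R) a b x d : a < x < b ->
  (forall y, a < y < b -> is_derive y 1 f (r y * w y)) ->
  (forall y, a < y < b -> 0 < r y) ->
  is_derive x 1 w d ->
  (forall y, a <= y <= b -> f y <= f x) -> w x = 0 /\ d <= 0.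
Proof.
move=> xab df r0 dw fx.
have wx : w x = 0.
  have /eqP := interior_max_derive_eq0 (df _ xab) xab fx.
  by rewrite mulf_eq0 gt_eqF ?r0//= => /eqP.
split=> //; rewrite leNgt; apply/negP => d0.
have [e e0 He] := is_derive_slope_gt0 dw d0.
have /andP[ax xb] := xab.
pose h := Num.min (e / 2) ((b - x) / 2).
have h0 : 0 < h by rewrite lt_min !divr_gt0 ?subr_gt0.
have he : h < e by rewrite gt_min ltr_pdivrMr// ltr_pMr// ltr1n.
have hx : h <= (b - x) / 2 by rewrite ge_min lexx orbT.
have df' y : y \in `]x, (x + h)[ -> is_derive y 1 f (r y * w y).
  by rewrite in_itv/= => /andP[h1 h2]; apply: df; apply/andP; split; lra.
have cf : {within `[x, (x + h)], continuous f}.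
  apply: derivable_within_continuous => y; rewrite in_itv/= => /andP[h1 h2].
  by apply: (@ex_derive _ _ _ _ _ _ _ (df y _)); apply/andP; split; lra.
have [|c] := MVT _ df' cf; first by rewrite ltrDl.
rewrite in_itv/= addrAC subrr add0r => /andP[xc ch] fE.
have wc : 0 < w c.
  have := He c; rewrite gt_eqF// wx subr0 gtr0_norm ?subr_gt0//.
  rewrite pmulr_lgt0 ?invr_gt0 ?subr_gt0//; apply => //.
  lra.
have : 0 < f (x + h) - f x.
  by rewrite fE !mulr_gt0// r0//; apply/andP; split; lra.
rewrite subr_gt0 ltNge fx//; apply/andP; split; lra.
Qed.

End calculus.

Definition rect {R : realType} (a b T : R) : set (R * R) :=
  [set z | a <= z.1 <= b /\ 0 <= z.2 <= T].

Section maximum_principle.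
Context {R : realType}.
Implicit Types (f : R -> R -> R) (a b T x t : R).

Lemma rectE a b T : rect a b T = `[a, b] `*` `[0, T] :> set (R * R).
Proof. by apply/seteqP; split => -[x t] /=; rewrite !in_itv. Qed.

Lemma compact_rect a b T : compact (rect a b T).
Proof. by rewrite rectE; apply: compact_setX; exact: segment_compact. Qed.

(** A positive maximum over the compact rectangle cannot lie on the parabolic boundary. What
    excludes it elsewhere is left as a hypothesis, so that the lemma serves both first-order
    transport and the degenerate second-order inequality of [momentum_barrier]. In time the maximum
    is only over the past, since [t] may be the final time. *)
Lemma parabolic_max_principle f a b T :
  continuous_onD (rect a b T) f ->
  (forall x, a <= x <= b -> f x 0 <= 0) ->
  (forall t, 0 <= t <= T -> f a t <= 0 /\ f b t <= 0) ->
  (forall x t, a < x < b -> 0 < t <= T -> 0 < f x t ->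
    (forall y, a <= y <= b -> f y t <= f x t) ->
    (forall r, 0 <= r <= t -> f x r <= f x t) -> False) ->
  forall x t, a <= x <= b -> 0 <= t <= T -> f x t <= 0.
Proof.
move=> cf f0 fl fi x t xab tT.
have [|[y r]] := compact_EVT_max _ (@compact_rect a b T) cf; first by exists (x, t).
rewrite inE => -[/= yab rT] fmax.
rewrite leNgt; apply/negP => fxt.
have fyr : 0 < f y r by apply: (lt_le_trans fxt); apply: (fmax (x, t)); rewrite inE.
have ya : a != y by apply: contraTneq fyr => <-; rewrite -leNgt; case: (fl r rT).
have yb : y != b by apply: contraTneq fyr => ->; rewrite -leNgt; case: (fl r rT).
have r0 : 0 != r by apply: contraTneq fyr => <-; rewrite -leNgt f0.
have [[/andP[ay yb'] /andP[r0' rT']]] := (yab, rT).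
apply: (fi y r) => //.
- by rewrite !lt_neqAle ya yb ay.
- by rewrite lt_neqAle r0 r0'.
- by move=> y' y'ab; apply: (fmax (y', r)); rewrite inE.
- move=> r' /andP[h1 h2]; apply: (fmax (y, r')); rewrite inE; split => //=.
  by rewrite h1 (le_trans h2).
Qed.

(* [d] is the derivative of f at (x, t) along the direction (c, 1). *)
Definition transport_derive (c : R) f x t (d : R) :=
  exists fx ft, [/\ is_derive x 1 (f ^~ t) fx, is_derive t 1 (f x) ft &
    ft + c * fx = d].

(** At an interior maximum the space derivative vanishes and the time derivative is nonnegative, so
    the derivative along (c, 1) is nonnegative whatever [c] is. No regularity of [c] enters. *)
Lemma transport_max_principle (c : R -> R -> R) f a b T :
  continuous_onD (rect a b T) f ->
  (forall x, a <= x <= b -> f x 0 <= 0) ->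
  (forall t, 0 <= t <= T -> f a t <= 0 /\ f b t <= 0) ->
  (forall x t, a < x < b -> 0 < t <= T ->
    exists2 d, transport_derive (c x t) f x t d & 0 < f x t -> d < 0) ->
  forall x t, a <= x <= b -> 0 <= t <= T -> f x t <= 0.
Proof.
move=> cf f0 fl fd; apply: parabolic_max_principle => // x t xab tT fxt fx ft.
have [_ [gx [gt [dx dt <-]]]] := fd _ _ xab tT.
move=> /(_ fxt); rewrite ltNge => /negP; apply.
rewrite (interior_max_derive_eq0 dx xab fx) mulr0 addr0.
by apply: (left_max_derive_ge0 dt _ ft); case/andP: tT.
Qed.

End maximum_principle.

(** * Calculus along characteristics and continuity on space-time sets *)

Section transport_rules.
Context {R : realType}.
Implicit Types (f g : R -> R -> R) (c x t d e : R).

Lemma transport_deriveD c f g x t d e :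
  transport_derive c f x t d -> transport_derive c g x t e ->
  transport_derive c (fun x t => f x t + g x t) x t (d + e).
Proof.
move=> [fx [ft [fX fT <-]]] [gx [gt [gX gT <-]]].
exists (fx + gx), (ft + gt); split; [exact: is_deriveD|exact: is_deriveD|ring].
Qed.

Lemma transport_deriveN c f x t d :
  transport_derive c f x t d -> transport_derive c (fun x t => - f x t) x t (- d).
Proof.
move=> [fx [ft [fX fT <-]]].
exists (- fx), (- ft); split; [exact: is_deriveN|exact: is_deriveN|ring].
Qed.

Lemma transport_deriveM c f g x t d e :
  transport_derive c f x t d -> transport_derive c g x t e ->
  transport_derive c (fun x t => f x t * g x t) x t (d * g x t + f x t * e).
Proof.
move=> [fx [ft [fX fT <-]]] [gx [gt [gX gT <-]]].
exists (f x t *: gx + g x t *: fx), (f x t *: gt + g x t *: ft); split.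
- exact: is_deriveM.
- exact: is_deriveM.
- rewrite /GRing.scale /=; ring.
Qed.

Lemma transport_derive_space c (g : R -> R) x t d : is_derive x 1 g d ->
  transport_derive c (fun x _ => g x) x t (c * d).
Proof.
by move=> dg; exists d, 0; split => //; rewrite ?add0r//; exact: is_derive_cst.
Qed.

Lemma transport_derive_time c (g : R -> R) x t d : is_derive t 1 g d ->
  transport_derive c (fun _ => g) x t d.
Proof.
by move=> dg; exists 0, d; split => //; rewrite ?mulr0 ?addr0//; exact: is_derive_cst.
Qed.

Lemma transport_derive_eq c f x t d e :
  transport_derive c f x t d -> d = e -> transport_derive c f x t e.
Proof. by move=> ? <-. Qed.

Lemma is_derive_expRZ (a t : R) : is_derive t 1 (fun t => expR (a * t)) (a * expR (a * t)).
Proof.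
have h : is_derive t 1 (fun t => a * t) a.
  by rewrite -[X in is_derive _ _ _ X]mulr1; apply: is_deriveZ.
by rewrite mulrC; exact: (is_derive1_comp (is_derive_expR _) h).
Qed.

End transport_rules.

Section continuity_rules.
Context {R : realType}.
Implicit Types (f g : R -> R -> R) (D : set (R * R)).

Lemma cvg_to_pair (T : Type) (F : set_system T) (h g : T -> R) (a b : R) :
  Filter F -> h x @[x --> F] --> a -> g x @[x --> F] --> b ->
  (h x, g x) @[x --> F] --> (a, b).
Proof.
move=> FF ha gb A [[P Q] [/= aP bQ] PQA].
have haP : F (h @^-1` P) := ha _ aP.
have gbQ : F (g @^-1` Q) := gb _ bQ.
apply: (@filterS T F _ _ _ _ (filterI haP gbQ)) => x [Px Qx].
exact: (PQA (h x, g x) (conj Px Qx)).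
Qed.

Lemma continuous_onDP D f : continuous_onD D f <->
  (forall z, D z -> f z.1 z.2 @[z --> within D (nbhs z)] --> f z.1 z.2).
Proof. exact: subspace_continuousP. Qed.

Lemma continuous_onD_sub D E f : D `<=` E -> continuous_onD E f -> continuous_onD D f.
Proof. by move=> DE; apply: continuous_subspaceW. Qed.

Lemma continuous_onDD D f g : continuous_onD D f -> continuous_onD D g ->
  continuous_onD D (fun x t => f x t + g x t).
Proof. by move=> /continuous_onDP cf /continuous_onDP cg; apply/continuous_onDP => z Dz; apply:
  cvgD; [exact: cf|exact: cg]. Qed.

Lemma continuous_onDN D f : continuous_onD D f -> continuous_onD D (fun x t => - f x t).
Proof. by move=> /continuous_onDP cf; apply/continuous_onDP => z Dz; apply: cvgN; exact: cf. Qed.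

Lemma continuous_onDM D f g : continuous_onD D f -> continuous_onD D g ->
  continuous_onD D (fun x t => f x t * g x t).
Proof. by move=> /continuous_onDP cf /continuous_onDP cg; apply/continuous_onDP => z Dz; apply:
  cvgM; [exact: cf|exact: cg]. Qed.

Lemma continuous_onD_comp D f (h : R -> R) (I : set R) :
  (forall x t, D (x, t) -> I (f x t)) -> {within I, continuous h} ->
  continuous_onD D f -> continuous_onD D (fun x t => h (f x t)).
Proof.
move=> DI /subspace_continuousP ch /continuous_onDP cf.
apply/continuous_onDP => -[x t] Dz /=.
apply: (@cvg_comp _ _ _ (fun z : R * R => f z.1 z.2) h _ (within I (nbhs (f x t)))).
  move=> A; rewrite /within/= => /(cf (x, t) Dz).
  rewrite /= /nbhs/= => H.
  move: H; rewrite /within /=; apply: filterS => -[y r] /= H Dyr; apply: H => //.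
  exact: DI.
exact: ch (DI _ _ Dz).
Qed.

Lemma continuous_onD_space a b T (g : R -> R) : {within `[a, b], continuous g} ->
  continuous_onD (rect a b T) (fun x _ => g x).
Proof.
move=> cg; apply: (@continuous_onD_comp _ (fun x _ => x) _ `[a, b]%classic) => //.
  by move=> x t [/= ? _]; rewrite in_itv.
apply: continuous_subspaceT => z; exact: cvg_fst.
Qed.

Lemma continuous_onD_time D (g : R -> R) : continuous g ->
  continuous_onD D (fun _ => g).
Proof.
move=> cg; apply: (@continuous_onD_comp _ (fun _ t => t) _ setT) => //.
  by apply: continuous_subspaceT.
apply: continuous_subspaceT => z; exact: cvg_snd.
Qed.

Lemma continuous_onD_cst D (k : R) : continuous_onD D (fun _ _ => k).
Proof. by apply: continuous_subspaceT => z; exact: cvg_cst. Qed.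

(* A bounded factor need not extend continuously to the zeros of g. *)
Lemma continuous_onD_Mbounded D f g (K : R) : continuous_onD D g ->
  (forall x t, D (x, t) -> g x t != 0 -> `|f x t| <= K) ->
  (forall x t, D (x, t) -> g x t != 0 ->
     f z.1 z.2 @[z --> within D (nbhs (x, t))] --> f x t) ->
  continuous_onD D (fun x t => g x t * f x t).
Proof.
move=> cg fK cf; apply/continuous_onDP => -[x t] Dxt /=.
have [g0|g0] := eqVneq (g x t) 0; last first.
  apply: cvgM; last exact: cf.
  by move/continuous_onDP : cg => /(_ _ Dxt).
rewrite g0 mul0r; apply/cvgr0Pnorm_lt => e e0.
have K0 : 0 < `|K| + 1 by rewrite ltr_wpDl.
move/continuous_onDP : cg => /(_ _ Dxt); rewrite /= g0 => /cvgr0Pnorm_lt.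
move=> /(_ (e / (`|K| + 1)) (divr_gt0 e0 K0)).
rewrite !near_withinE; apply: filterS => -[y r] /= H Dyr.
have [->|gn] := eqVneq (g y r) 0; first by rewrite mul0r normr0.
rewrite normrM; have := H Dyr; rewrite ltr_pdivlMr// => /le_lt_trans; apply.
rewrite ler_wpM2l//; apply: (le_trans (fK _ _ Dyr gn)).
by rewrite (le_trans (ler_norm K))// lerDl.
Qed.

Lemma continuous_powR (p : R) : 0 < p -> {within `[0, +oo[%classic, continuous (fun x :
  R => x `^ p)}.
Proof.
move=> p0; apply/continuous_within_itvcyP; split.
  move=> x; rewrite in_itv/= andbT => x0.
  apply: differentiable_continuous; apply/derivable1_diffP.
  exact: (@ex_derive _ _ _ _ _ _ _ (is_derive1_powR _ x0)).
by rewrite powR0 ?gt_eqF//; exact: powR_cvg0.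
Qed.

Lemma within_continuous_bump (p : R) : 0 < p ->
  {within `[0, 1], continuous (fun x : R => (x * (1 - x)) `^ p)}.
Proof.
move=> p0.
have cc : continuous (fun x : R => x * (1 - x)).
  move=> x; apply: cvgM; first exact: cvg_id.
  by apply: cvgB; [exact: cvg_cst|exact: cvg_id].
move/subspace_continuousP : (continuous_powR p0) => cp.
apply/subspace_continuousP => x; rewrite /= in_itv/= => /andP[x0 x1].
have xx y : 0 <= y -> y <= 1 -> 0 <= y * (1 - y) by move=> ? ?; rewrite mulr_ge0// subr_ge0.
apply: (@cvg_comp _ _ _ (fun x : R => x * (1 - x)) (fun x :
  R => x `^ p) _ (within `[0, +oo[%classic (nbhs (x * (1 - x))))).
  move=> A /= HA; apply: (@filterS _ (nbhs x) _ _ _ _ (cc x _ HA)).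
  move=> y /= H; rewrite in_itv/= => /andP[y0 y1].
  by apply: H; rewrite in_itv/= andbT xx.
by apply: cp; rewrite /= in_itv/= andbT xx.
Qed.

Lemma is_derive_bump (p x : R) : 0 < x < 1 ->
  is_derive x 1 (fun x : R => (x * (1 - x)) `^ p)
    (p * (x * (1 - x)) `^ (p - 1) * (1 - 2 * x)).
Proof.
move=> /andP[x0 x1].
have h : is_derive x 1 (fun x : R => x * (1 - x)) (1 - 2 * x).
  have h1 : is_derive x 1 (fun x : R => 1 - x) (0 - 1) by exact: is_deriveB.
  apply: is_derive_eq (is_deriveM (is_derive_id x 1) h1) _.
  by rewrite /GRing.scale/=; ring.
by apply: (is_derive1_comp (is_derive1_powR _ _) h); rewrite mulr_gt0// subr_gt0.
Qed.

(** Differentiating a power of [x * (1 - x)] costs one power, and [c], which vanishes at both ends,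
    gives it back. Powers of the bump thus have a bounded logarithmic derivative along the flow and
    can serve as comparison functions. *)
Lemma bump_transport_bound (p x c K : R) : 0 < x < 1 -> 0 <= p -> `|c| <= K * (x * (1 - x)) ->
  `|c * (p * (x * (1 - x)) `^ (p - 1) * (1 - 2 * x))| <= K * p * (x * (1 - x)) `^ p.
Proof.
move=> /andP[x0 x1] p0 cK.
have xx : 0 < x * (1 - x) by rewrite mulr_gt0// subr_gt0.
have -> : (x * (1 - x)) `^ p = (x * (1 - x)) * (x * (1 - x)) `^ (p - 1).
  rewrite powRB; last by rewrite (gt_eqF xx) implybT.
  by rewrite powRr1 ?ltW// [RHS]mulrC divfK// gt_eqF.
rewrite !normrM (ger0_norm p0) (ger0_norm (powR_ge0 _ _)).
have -> : K * p * (x * (1 - x) * (x * (1 - x)) `^ (p - 1)) =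
  K * (x * (1 - x)) * (p * (x * (1 - x)) `^ (p - 1) * 1) by ring.
apply: ler_pM => //; first by rewrite !mulr_ge0// powR_ge0.
apply: ler_wpM2l; first by rewrite mulr_ge0// powR_ge0.
by rewrite ler_norml; apply/andP; split; lra.
Qed.

End continuity_rules.

Section slices.
Context {R : realType}.
Implicit Types (f : R -> R -> R) (a b x t T : R).

Lemma continuous_onD_slice_x f a b T t : continuous_onD (rect a b T) f ->
  0 <= t <= T -> {within `[a, b], continuous (f ^~ t)}.
Proof.
move=> /continuous_onDP cf tT; apply/subspace_continuousP => x /= xab.
have h : rect a b T (x, t) by split => //=; move: xab; rewrite in_itv.
apply: (@cvg_comp _ _ _ (fun x => (x, t)) (fun z => f z.1 z.2) _ _ _ _ (cf _ h)).
move=> A; rewrite /within/= => HA.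
have ct : (y, t) @[y --> x] --> (x, t) by apply: cvg_to_pair; [exact: cvg_id|exact: cvg_cst].
apply: (@filterS _ (nbhs x) _ _ _ _ (ct _ HA)) => y /= h' yab; apply: h'.
by split => //=; move: yab; rewrite in_itv.
Qed.

Lemma continuous_onD_slice_t f a b T x : continuous_onD (rect a b T) f ->
  a <= x <= b -> {within `[0, T], continuous (f x)}.
Proof.
move=> /continuous_onDP cf tT; apply/subspace_continuousP => t /= xab.
have h : rect a b T (x, t) by split => //=; move: xab; rewrite in_itv.
apply: (@cvg_comp _ _ _ (fun t => (x, t)) (fun z => f z.1 z.2) _ _ _ _ (cf _ h)).
move=> A; rewrite /within/= => HA.
have ct : (x, y) @[y --> t] --> (x, t) by apply: cvg_to_pair; [exact: cvg_cst|exact: cvg_id].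
apply: (@filterS _ (nbhs t) _ _ _ _ (ct _ HA)) => y /= h' yab; apply: h'.
by split => //=; move: yab; rewrite in_itv.
Qed.

Lemma MVT_oo (f df : R -> R) a b : a < b ->
  {within `[a, b], continuous f} ->
  (forall x, a < x < b -> is_derive x 1 f (df x)) ->
  exists2 x, a < x < b & f b - f a = df x * (b - a).
Proof.
move=> ab cf fd; have fd' x : x \in `]a, b[ -> is_derive x 1 f (df x).
  by rewrite in_itv; exact: fd.
by have [x] := MVT ab fd' cf; rewrite in_itv/=; exists x.
Qed.

End slices.

(** * The flow in normalized coordinates *)

Section barrier.
Context {R : realType} (lam n kap M : R).
Implicit Types (z t : R).

(* With z the mass, [barrier] satisfies psi_t <= nu rho psi_zz as soon as
   nu rho >= kap / (lam n)^2 * z^(2 - 2 n); here n = 1 / (delta + 1). *)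
Definition barrier_exp z t := expR (lam * z `^ n + kap * t).

Definition barrier z t := z * (barrier_exp z t - M).

Definition barrier_z z t :=
  barrier_exp z t - M + lam * n * z `^ n * barrier_exp z t.

Definition barrier_zz z t :=
  lam * n * (1 + n + lam * n * z `^ n) * z `^ (n - 1) * barrier_exp z t.

Lemma is_derive_barrier_exp z t : 0 < z ->
  is_derive z 1 (barrier_exp ^~ t) (lam * n * z `^ (n - 1) * barrier_exp z t).
Proof.
move=> z0.
have h : is_derive z 1 (fun z => lam * z `^ n + kap * t) (lam * (n * z `^ (n - 1)) + 0).
  exact: is_deriveD (is_deriveZ lam (is_derive1_powR n z0)) (is_derive_cst _ _ _).
apply: is_derive_eq (is_derive1_comp (is_derive_expR _) h) _.
by rewrite /barrier_exp; ring.
Qed.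

Lemma is_derive_barrier z t : 0 < z -> is_derive z 1 (barrier ^~ t) (barrier_z z t).
Proof.
move=> z0.
have h := is_deriveB (is_derive_barrier_exp t z0) (is_derive_cst M z 1).
apply: is_derive_eq (is_deriveM (is_derive_id z 1) h) _.
rewrite /GRing.scale/= /barrier_z /cst subr0 mulr1.
have -> : z * (lam * n * z `^ (n - 1) * barrier_exp z t) =
  lam * n * (z * z `^ (n - 1)) * barrier_exp z t by ring.
rewrite addrC; congr (_ + lam * n * _ * _).
rewrite powRB; last by rewrite (gt_eqF z0) implybT.
by rewrite powRr1 ?ltW// mulrC divfK// gt_eqF.
Qed.

Lemma is_derive_barrier_z z t : 0 < z ->
  is_derive z 1 (barrier_z ^~ t) (barrier_zz z t).
Proof.
move=> z0; have de := is_derive_barrier_exp t z0.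
have dp := is_deriveZ (lam * n) (is_derive1_powR n z0).
have h := is_deriveD (is_deriveB de (is_derive_cst M z 1)) (is_deriveM dp de).
apply: is_derive_eq h _.
by rewrite /= /GRing.scale/= /barrier_zz; ring.
Qed.

Lemma is_derive_barrier_t (g : R -> R) t d : 0 < g t -> is_derive t 1 g d ->
  is_derive t 1 (fun t => barrier (g t) t)
    (barrier_z (g t) t * d + kap * g t * barrier_exp (g t) t).
Proof.
move=> g0 dg.
have dp := is_deriveZ lam (is_derive1_comp (is_derive1_powR n g0) dg).
have de : is_derive t 1 (fun t => barrier_exp (g t) t)
    (barrier_exp (g t) t * (lam * (n * g t `^ (n - 1) * d) + kap * 1)).
  exact: is_derive1_comp (is_derive_expR _) (is_deriveD dp (is_deriveZ kap (is_derive_id t 1))).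
have := is_deriveM dg (is_deriveB de (is_derive_cst M t 1)).
move=> h'; apply: is_derive_eq h' _.
have e : g t * g t `^ (n - 1) = g t `^ n.
  rewrite powRB; last by rewrite (gt_eqF g0) implybT.
  by rewrite powRr1 ?ltW// mulrC divfK// gt_eqF.
rewrite /barrier_z -e -[LHS]/(_ * (_ - 0) + (barrier_exp (g t) t - M) * d).
by ring.
Qed.

End barrier.

(* The free boundary flow in the normalized variable x = (y - w1) / L in
   (0, 1), L = w2 - w1: [c] is the velocity relative to the moving frame, [uy]
   the Eulerian velocity gradient, [sg] the entropy ln theta - (gamma - 1) ln rho,
   and [N], [q] the mass and the momentum of (0, x). *)
Record normalized_flow {R : realType} (T dl m k K mu : R) (L : R -> R)
    (rho u uy c sg nu p N q : R -> R -> R) : Prop := {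
  nf_T : 0 < T ;
  nf_dl : 0 < dl ;
  nf_m : dl + 1 < dl * m ;
  nf_k : 0 < k ;
  nf_K : 0 < K ;
  nf_mu : 0 < mu ;
  nf_L : forall t : R, 0 <= t <= T -> k <= L t <= K ;
  nf_rho_cont : continuous_onD (rect 0 1 T) rho ;
  nf_N_cont : continuous_onD (rect 0 1 T) N ;
  nf_q_cont : continuous_onD (rect 0 1 T) q ;
  nf_sg_cont : forall x t : R, 0 < x < 1 -> 0 <= t <= T ->
    sg z.1 z.2 @[z --> within (rect 0 1 T) (nbhs (x, t))] --> sg x t ;
  nf_u_cont : forall x : R, 0 < x < 1 -> {for x, continuous (u ^~ 0)} ;
  nf_rho0 : forall x : R, 0 < x < 1 ->
    k * (x * (1 - x)) `^ dl <= rho x 0 <= K * (x * (1 - x)) `^ dl ;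
  nf_rho_bd : forall t : R, 0 <= t <= T -> rho 0 t = 0 /\ rho 1 t = 0 ;
  nf_N_bd : forall t : R, 0 <= t <= T -> N 0 t = 0 /\ N 1 t = N 1 0 ;
  nf_q_bd : forall t : R, 0 <= t <= T -> q 0 t = 0 /\ q 1 t = q 1 0 ;
  nf_pos : forall x t : R, 0 < x < 1 -> 0 <= t <= T -> 0 < rho x t /\ 0 < p x t ;
  nf_nu : forall x t : R, 0 < x < 1 -> 0 <= t <= T ->
    [/\ k * rho x t <= nu x t, nu x t * p x t <= K * (rho x t `^ m) ^+ 2 &
        p x t <= K * rho x t `^ m] ;
  nf_uy : forall x t : R, 0 < x < 1 -> 0 <= t <= T -> `|uy x t| <= K ;
  nf_c : forall x t : R, 0 < x < 1 -> 0 <= t <= T -> `|c x t| <= K * (x * (1 - x)) ;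
  nf_sg : forall x t : R, 0 < x < 1 -> 0 <= t <= T -> `|sg x t| <= K ;
  nf_drho : forall x t : R, 0 < x < 1 -> 0 < t < T ->
    transport_derive (c x t) rho x t (- (rho x t * uy x t)) ;
  nf_dsg : forall x t : R, 0 < x < 1 -> 0 < t < T ->
    transport_derive (c x t) sg x t (mu * (nu x t * uy x t ^+ 2 / p x t)) ;
  nf_u_x : forall x t : R, 0 < x < 1 -> 0 < t < T ->
    is_derive x 1 (u ^~ t) (L t * uy x t) ;
  nf_N_x : forall x t : R, 0 < x < 1 -> 0 <= t < T ->
    is_derive x 1 (N ^~ t) (L t * rho x t) ;
  nf_N_t : forall x t : R, 0 < x < 1 -> 0 < t < T ->
    is_derive t 1 (N x) (- (c x t * (L t * rho x t))) ;
  nf_q_x : forall x t : R, 0 < x < 1 -> 0 <= t < T ->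
    is_derive x 1 (q ^~ t) (L t * rho x t * u x t) ;
  nf_q_t : forall x t : R, 0 < x < 1 -> 0 < t < T ->
    is_derive t 1 (q x)
      (nu x t * uy x t - p x t - c x t * (L t * rho x t * u x t))
}.

(** * Estimates for a normalized flow and the contradiction at the left end *)

Section comparison.
Context {R : realType}.

(** Where [E * f > g], the relative rates of [f] and [g] contribute at most [2 * A * (E * f)] to the
    derivative of [E * f - g]. The weight [E] removes [(2 * A + 1) * (E * f)], and the extra 1 makes
    the sign strict because [E * f > g >= 0]. *)
Lemma transport_comparison (c f g : R -> R -> R) (T A : R) : 0 <= A ->
  continuous_onD (rect 0 1 T) f -> continuous_onD (rect 0 1 T) g ->
  (forall x t, 0 <= x <= 1 -> 0 <= t <= T -> 0 <= g x t) ->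
  (forall x, 0 <= x <= 1 -> f x 0 <= g x 0) ->
  (forall t, 0 <= t <= T -> f 0 t <= 0 /\ f 1 t <= 0) ->
  (forall x t, 0 < x < 1 -> 0 < t <= T -> 
     exists2 d, transport_derive (c x t) f x t d & `|d| <= A * f x t) ->
  (forall x t, 0 < x < 1 -> 0 < t <= T -> 
     exists2 e, transport_derive (c x t) g x t e & `|e| <= A * g x t) ->
  forall x t, 0 <= x <= 1 -> 0 <= t <= T -> f x t <= expR ((2 * A + 1) * t) * g x t.
Proof.
move=> A0 cf cg g0 fg0 fb df dg x t xI tI.
pose E (t : R) := expR (- (2 * A + 1) * t).
suff : E t * f x t + - g x t <= 0.
  rewrite /E mulNr expRN subr_le0 mulrC ler_pdivrMr ?expR_gt0// mulrC.
  by [].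
apply: (@transport_max_principle _ c (fun x t => E t * f x t + - g x t) 0 1 T) => // {x t xI tI}.
- apply: continuous_onDD; last exact: continuous_onDN.
  apply: continuous_onDM => //; apply: continuous_onD_time.
  move=> t; apply: differentiable_continuous; apply/derivable1_diffP.
  exact: (@ex_derive _ _ _ _ _ _ _ (is_derive_expRZ _ t)).
- by move=> x xI; rewrite /E mulr0 expR0 mul1r subr_le0 fg0.
- move=> t tI; have [h1 h2] := fb _ tI.
  have E0 : 0 <= E t by exact: expR_ge0.
  split; rewrite subr_le0; apply: (@le_trans _ _ 0).
  + by rewrite mulr_ge0_le0.
  + by apply: g0 => //; rewrite lexx ler01.
  + by rewrite mulr_ge0_le0.
  + by apply: g0 => //; rewrite lexx ler01.
move=> x t xI tI; have [d dd dA] := df _ _ xI tI; have [e de eA] := dg _ _ xI tI.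
exists ((- (2 * A + 1) * E t) * f x t + E t * d + - e).
  apply: transport_deriveD; last exact: transport_deriveN.
  apply: (@transport_deriveM _ _ (fun _ => E)) => //.
  apply: transport_derive_time; exact: is_derive_expRZ.
rewrite subr_gt0 => gf.
have g0' : 0 <= g x t.
  by apply: g0; [case/andP: xI => /ltW -> /ltW ->|case/andP: tI => /ltW -> ->].
have E0 : 0 < E t by exact: expR_gt0.
have h3 : E t * d <= E t * (A * f x t) by rewrite ler_pM2l// (le_trans (ler_norm _)).
have h4 : A * g x t <= A * (E t * f x t) by rewrite ler_wpM2l// ltW.
have h5 : - e <= A * g x t by rewrite (le_trans (ler_norm _))// normrN.
nra.
Qed.

End comparison.

Section normalized_flow_theory.
Context {R : realType} (T dl m k K mu : R) (L : R -> R)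
  (rho u uy c sg nu p N q : R -> R -> R).
Hypothesis H : normalized_flow T dl m k K mu L rho u uy c sg nu p N q.
Implicit Types x t : R.

Let bump (x : R) := x * (1 - x).

Let bump_gt0 x : 0 < x < 1 -> 0 < bump x.
Proof. by move=> /andP[x0 x1]; rewrite mulr_gt0// subr_gt0. Qed.

Let bump_le x : 0 <= x <= 1 -> bump x <= x.
Proof. by move=> _; rewrite /bump mulrBr mulr1 gerBl -expr2 sqr_ge0. Qed.

Let rect_sub (a b S S' : R) : S <= S' -> rect a b S `<=` rect a b S'.
Proof.
by move=> SS [x t] [/= h /andP[t0 tS]]; split => //=; rewrite t0 (le_trans tS).
Qed.

(** Two-sided time derivatives are available only for [0 < t < T], whereas the maximum principle
    needs them up to the final time. The estimates therefore run on [[0, T / 2]]. *)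
Let half_T t : 0 < t <= T / 2 -> 0 < t < T.
Proof. by have := nf_T H; move=> ? /andP[? ?]; apply/andP; split; lra. Qed.

Let half_T' t : 0 <= t <= T / 2 -> 0 <= t < T.
Proof. by have := nf_T H; move=> ? /andP[? ?]; apply/andP; split; lra. Qed.

Let half_T'' t : 0 <= t <= T / 2 -> 0 <= t <= T.
Proof. by have := nf_T H; move=> ? /andP[? ?]; apply/andP; split; lra. Qed.

Let zeroT : (0:R) <= 0 <= T.
Proof. by rewrite lexx ltW// (nf_T H). Qed.

Lemma density_bounds : exists2 k1, 0 < k1 & exists2 K1, 0 < K1 &
  forall x t, 0 <= x <= 1 -> 0 <= t <= T / 2 ->
    k1 * bump x `^ dl <= rho x t <= K1 * bump x `^ dl.
Proof.
have [[[k0 K0] dl0] T0] := (nf_k H, nf_K H, nf_dl H, nf_T H).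
pose A := K + K * dl.
have A0 : 0 <= A by rewrite addr_ge0 ?mulr_ge0 ?ltW.
have cb : continuous_onD (rect 0 1 (T / 2)) (fun x _ : R => bump x `^ dl).
  by apply: continuous_onD_space; exact: within_continuous_bump.
have cr : continuous_onD (rect 0 1 (T / 2)) rho.
  by apply: (continuous_onD_sub _ (nf_rho_cont H)); apply: rect_sub; lra.
have db (C x t : R) : 0 <= C -> 0 < x < 1 -> 0 < t <= T / 2 -> exists2 e,
    transport_derive (c x t) (fun x _ => C * bump x `^ dl) x t e &
    `|e| <= A * (C * bump x `^ dl).
  move=> C0 x01 tT.
  exists (C * (c x t * (dl * bump x `^ (dl - 1) * (1 - 2 * x)))).
    have h := transport_deriveM (transport_derive_time (c x t) x (is_derive_cst C t 1))
      (transport_derive_space (c x t) t (is_derive_bump dl x01)).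
    by apply: transport_derive_eq h _; rewrite mul0r add0r.
  rewrite normrM (ger0_norm C0) [leRHS]mulrCA; apply: ler_wpM2l => //.
  have := @bump_transport_bound _ dl x (c x t) K x01 (ltW dl0)
    (nf_c H x01 (half_T'' _)).
  case/andP: tT => /ltW -> -> /(_ isT) /le_trans; apply.
  by rewrite /A ler_wpM2r ?powR_ge0// lerDr ltW.
have dr x t : 0 < x < 1 -> 0 < t <= T / 2 -> exists2 e,
    transport_derive (c x t) rho x t e & `|e| <= A * rho x t.
  move=> x01 tT; have tT' : 0 <= t <= T.
    by apply: half_T''; case/andP: tT => /ltW -> ->.
  exists (- (rho x t * uy x t)); first exact: (nf_drho H x01 (half_T tT)).
  have [r0 _] := nf_pos H x01 tT'.
  rewrite normrN normrM (gtr0_norm r0) mulrC ler_pM2r//.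
  by rewrite (le_trans (nf_uy H x01 tT'))// lerDl mulr_ge0// ltW.
have rho_ge0 x t : 0 <= x <= 1 -> 0 <= t <= T / 2 -> 0 <= rho x t.
  move=> /andP[x0 x1] /half_T'' tT; have [r0 r1] := nf_rho_bd H tT.
  have [->|xn0] := eqVneq x 0; first by rewrite r0.
  have [->|xn1] := eqVneq x 1; first by rewrite r1.
  have xo : 0 < x < 1 by rewrite !lt_neqAle x0 x1 xn1 eq_sym xn0.
  by have [/ltW] := nf_pos H xo tT.
have b0 : bump 0 `^ dl = 0 by rewrite /bump mul0r powR0// gt_eqF.
have b1 : bump 1 `^ dl = 0 by rewrite /bump subrr mulr0 powR0// gt_eqF.
have init x : 0 <= x <= 1 -> k * bump x `^ dl <= rho x 0 <= K * bump x `^ dl.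
  move=> /andP[x0 x1]; have tT : (0:R) <= 0 <= T by rewrite lexx ltW.
  have [r0 r1] := nf_rho_bd H tT.
  have [->|xn0] := eqVneq x 0; first by rewrite r0 b0 !mulr0 lexx.
  have [->|xn1] := eqVneq x 1; first by rewrite r1 b1 !mulr0 lexx.
  by apply: (nf_rho0 H); rewrite !lt_neqAle x0 x1 xn1 eq_sym xn0.
exists (k / expR ((2 * A + 1) * T)); first by rewrite divr_gt0 ?expR_gt0.
exists (K * expR ((2 * A + 1) * T)); first by rewrite mulr_gt0 ?expR_gt0.
have Emono t : 0 <= t <= T / 2 -> expR ((2 * A + 1) * t) <= expR ((2 * A + 1) * T).
  by move=> /half_T''/andP[_ tT]; rewrite ler_expR ler_wpM2l//; lra.
move=> x t x01 tT.
have bge0 : 0 <= bump x `^ dl by exact: powR_ge0.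
apply/andP; split.
- rewrite mulrAC ler_pdivrMr ?expR_gt0//.
  apply: (@le_trans _ _ (expR ((2 * A + 1) * t) * rho x t)); last first.
    by rewrite mulrC ler_wpM2l ?rho_ge0// Emono.
  apply: (@transport_comparison _ c (fun x _ => k * bump x `^ dl) rho (T / 2) A) => //.
  + by apply: continuous_onDM => //; exact: continuous_onD_cst.
  + by move=> y y01; case/andP: (init _ y01).
  + by move=> r _; rewrite b0 b1 mulr0.
  + by move=> y r; exact: db (ltW k0).
- apply: (@le_trans _ _ (expR ((2 * A + 1) * t) * (K * bump x `^ dl))); last first.
    rewrite mulrA (mulrC K) -!mulrA; apply: ler_wpM2r; last exact: Emono.
    by rewrite mulr_ge0// ltW.
  apply: (@transport_comparison _ c rho (fun x _ => K * bump x `^ dl) (T / 2) A) => //.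
  + by apply: continuous_onDM => //; exact: continuous_onD_cst.
  + by move=> y r *; rewrite mulr_ge0 ?powR_ge0// ltW.
  + by move=> y y01; case/andP: (init _ y01).
  + by move=> r /half_T'' rT; case: (nf_rho_bd H rT) => -> ->.
  + by move=> y r; exact: db (ltW K0).
Qed.

(** In the exponent, [dl] comes from the density, one unit from the vanishing of [u] at 0 and one
    from the length of the interval. It exceeds the exponent [dl + 1] of the mass. *)
Lemma initial_momentum_bound (Ku : R) : 0 <= Ku ->
  (forall x, 0 < x < 1 -> `|u x 0| <= Ku * x) ->
  exists2 C, 0 <= C & forall x, 0 <= x <= 1 -> `|q x 0| <= C * x `^ (dl + 2).
Proof.
move=> Ku0 uK; have [[[k0 K0] dl0] T0] := (nf_k H, nf_K H, nf_dl H, nf_T H).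
exists (K * K * Ku); first by rewrite !mulr_ge0// ltW.
move=> x /andP[x0 x1]; have [q0 _] := nf_q_bd H zeroT.
have [->|xn0] := eqVneq x 0; first by rewrite q0 normr0 !mulr_ge0 ?powR_ge0// ltW.
have xgt0 : 0 < x by rewrite lt_neqAle eq_sym xn0.
have cq : {within `[0, x], continuous (q ^~ 0)}.
  apply: continuous_subspaceW (continuous_onD_slice_x (nf_q_cont H) zeroT).
  by apply: subset_itvl; rewrite bnd_simp.
have [|y /andP[y0 yx]] := MVT_oo xgt0 cq (df := fun y => L 0 * rho y 0 * u y 0).
  move=> y /andP[y0 yx]; apply: (nf_q_x H); rewrite ?lexx// y0.
  by rewrite (lt_le_trans yx).
rewrite q0 !subr0 => ->.
have y01 : 0 < y < 1 by rewrite y0 (lt_le_trans yx).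
have -> : K * K * Ku * x `^ (dl + 2) = K * (K * x `^ dl) * (Ku * x) * x.
  rewrite powRD ?(gt_eqF xgt0) ?implybT//.
  by rewrite (_ : x `^ 2 = x * x); [ring|rewrite powR_mulrn// expr2].
have [rho0 _] := nf_pos H y01 zeroT.
have /andP[L0 L1] := nf_L H zeroT.
rewrite !normrM (gtr0_norm xgt0) (gtr0_norm rho0) (ger0_norm (le_trans (ltW k0) L0)).
rewrite ler_pM2r//; apply: ler_pM => //.
- by rewrite mulr_ge0 ?ltW// (lt_le_trans k0).
- apply: ler_pM => //; [exact: le_trans (ltW k0) L0|exact: ltW|].
  have /andP[_ /le_trans] := nf_rho0 H y01; apply.
  rewrite ler_pM2l//; apply: ge0_ler_powR; rewrite ?nnegrE ?ltW//.
    by apply: bump_gt0.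
  by apply: le_lt_trans yx; apply: bump_le; case/andP: y01 => /ltW -> /ltW ->.
- by apply: le_trans (uK _ y01) _; rewrite ler_wpM2l// ltW.
Qed.

(** The maximum principle is applied to minus [F], where [F] is [q] plus a growing weight times
    [b * (sg + S) + C0 * G]. The factor [b] is of the order of (nu p)^(1/2), which balances the two
    sides of AM-GM, and it vanishes at the ends, where [sg] has no limit. The term [G] carries the
    initial momentum. *)
Lemma momentum_lower_bound (C0 : R) : 0 <= C0 ->
  (forall x, 0 <= x <= 1 -> `|q x 0| <= C0 * x `^ (dl + 2)) ->
  exists2 C, 0 <= C & forall x t, 0 <= x <= 1 -> 0 <= t <= T / 2 ->
    - (C * (bump x `^ (dl * m) + x `^ (dl + 2))) <= q x t.
Proof.
move=> C00 qC0; have [[[k0 K0] dl0] T0] := (nf_k H, nf_K H, nf_dl H, nf_T H).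
have [mu0 m1] := (nf_mu H, nf_m H).
have [k1 k10 [K1 K10 rhoK]] := density_bounds.
pose be := dl * m; have be0 : 0 < be by rewrite /be; lra.
have d20 : 0 < dl + 2 by rewrite addr_gt0.
pose P := K * (K1 `^ m) ^+ 2; pose P' := K * K1 `^ m.
have P0 : 0 <= P by rewrite mulr_ge0 ?exprn_ge0 ?powR_ge0// ltW.
have P'0 : 0 <= P' by rewrite mulr_ge0 ?powR_ge0// ltW.
(* The summands pay, in order, for the relative rate of [b], the relative rate of [G], the AM-GM
   remainder (with nu p <= P b^2), the pressure (with p <= P' b), and the strict inequality. *)
pose A := K * be + K * (dl + 2) + P / (4 * mu) + P' + 1.
have Kbe : 0 <= K * be by rewrite mulr_ge0// ltW.
have Kd : 0 <= K * (dl + 2) by rewrite mulr_ge0// ltW.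
have Pm : 0 <= P / (4 * mu) by apply: divr_ge0 => //; apply: mulr_ge0 => //; exact: ltW.
have A0 : 0 < A by rewrite /A; lra.
pose E (t : R) := expR (A * t).
have E1 t : 0 <= t -> 1 <= E t.
  by move=> t0; rewrite -expR0 ler_expR mulr_ge0// ltW.
(* Since [|sg| <= K], this shift gives [sg + S >= 1], so the growth of the weight acts on at least
   the full size of [b]. *)
pose S := K + 1.
pose b x := bump x `^ be.
pose G x : R := x `^ (dl + 2).
pose F x t := q x t + E t * (b x * (sg x t + S) + C0 * G x).
have sgS x t : 0 < x < 1 -> 0 <= t <= T -> 1 <= sg x t + S <= 2 * K + 1.
  move=> x01 tT; have := nf_sg H x01 tT; rewrite ler_norml /S => /andP[? ?].
  by apply/andP; split; lra.
have b0 : b 0 = 0 by rewrite /b /bump mul0r powR0// gt_eqF.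
have b1 : b 1 = 0 by rewrite /b /bump subrr mulr0 powR0// gt_eqF.
have b_ge0 x : 0 <= b x by exact: powR_ge0.
have G_ge0 x : 0 <= G x by exact: powR_ge0.
suff F0 : forall x t, 0 <= x <= 1 -> 0 <= t <= T / 2 -> - F x t <= 0.
  exists (E T * (2 * K + 1 + C0)).
    by rewrite mulr_ge0 ?expR_ge0// !addr_ge0// mulr_ge0// ltW.
  move=> x t x01 tT; have := F0 _ _ x01 tT; rewrite oppr_le0 /F => F0'.
  have [tT' Et] : E t <= E T /\ 0 <= E t.
    split; last exact: expR_ge0.
    by rewrite ler_expR ler_wpM2l ?ltW//; case/andP: tT => ? ?; lra.
  suff h : b x * (sg x t + S) <= b x * (2 * K + 1).
    have h1 : b x * (sg x t + S) + C0 * G x <= (2 * K + 1 + C0) * (b x + G x).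
      by have := b_ge0 x; have := G_ge0 x; nra.
    have h2 : E t * (b x * (sg x t + S) + C0 * G x) <= E T * ((2 * K + 1 + C0) * (b x + G x)).
      apply: (@le_trans _ _ (E t * ((2 * K + 1 + C0) * (b x + G x)))).
        by rewrite ler_wpM2l.
      rewrite ler_wpM2r// mulr_ge0 ?addr_ge0//; first by rewrite mulr_ge0// ltW.
    rewrite -/(b x) -/(G x); lra.
  have [x0|xn0] := eqVneq x 0; first by rewrite x0 b0 !mul0r.
  have [x1|xn1] := eqVneq x 1; first by rewrite x1 b1 !mul0r.
  have xo : 0 < x < 1 by case/andP: x01 => ? ?; rewrite !lt_neqAle xn1 eq_sym xn0; apply/and3P.
  by rewrite ler_wpM2l//; case/andP: (sgS _ _ xo (half_T'' tT)).
have cF : continuous_onD (rect 0 1 (T / 2)) F.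
  apply: (@continuous_onD_sub _ _ (rect 0 1 T)); first by apply: rect_sub; lra.
  apply: continuous_onDD; first exact: nf_q_cont H.
  apply: (@continuous_onDM _ _ (fun _ => E)).
    apply: continuous_onD_time => r.
    apply: differentiable_continuous; apply/derivable1_diffP.
    exact: (@ex_derive _ _ _ _ _ _ _ (is_derive_expRZ _ r)).
  have bn x t : rect 0 1 T (x, t) -> b x != 0 -> 0 < x < 1 /\ 0 <= t <= T.
    move=> [/= /andP[x0 x1] tT] bx; split=> //; rewrite !lt_neqAle x0 x1 !andbT.
    by apply/andP; split; apply: contra_neq bx => xe; [rewrite -xe|rewrite xe].
  apply: continuous_onDD.
    apply: (@continuous_onD_Mbounded _ _ _ (fun x _ => b x) (2 * K + 1)).
    - by apply: continuous_onD_space; exact: within_continuous_bump.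
    - move=> x t D bx; have [x01 tT] := bn _ _ D bx.
      have /andP[? ?] := sgS _ _ x01 tT.
      by rewrite ger0_norm//; lra.
    - move=> x t D bx; have [x01 tT] := bn _ _ D bx.
      by apply: cvgD; [exact: nf_sg_cont H _ _ x01 tT|exact: cvg_cst].
  apply: continuous_onDM; first exact: continuous_onD_cst.
  apply: (@continuous_onD_space _ _ _ _ G).
  apply: continuous_subspaceW (continuous_powR d20) => y /=.
  by rewrite !in_itv/= andbT => /andP[].
apply: (@transport_max_principle _ c (fun x t => - F x t)).
- exact: continuous_onDN.
- move=> x x01; rewrite oppr_le0 /F /E mulr0 expR0 mul1r.
  have := qC0 _ x01; rewrite ler_norml => /andP[h _].
  suff : 0 <= b x * (sg x 0 + S) by rewrite -/(G x) in h; lra.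
  have [x0|xn0] := eqVneq x 0; first by rewrite x0 b0 !mul0r.
  have [x1|xn1] := eqVneq x 1; first by rewrite x1 b1 !mul0r.
  have xo : 0 < x < 1 by case/andP: x01 => ? ?; rewrite !lt_neqAle xn1 eq_sym xn0; apply/and3P.
  by rewrite mulr_ge0//; case/andP: (sgS _ _ xo zeroT) => ? _; lra.
- move=> r /[dup] /half_T'' rT /andP[r0 _]; have [q0 q1] := nf_q_bd H rT.
  rewrite !oppr_le0 /F q0 q1 b0 b1 !mul0r !add0r; split.
    by rewrite mulr_ge0 ?expR_ge0// mulr_ge0.
  (* At x = 1 the momentum is the conserved total [q 1 0], which need not vanish. For this reason
     [G] is a power of [x] alone and not of the bump. *)
  have := qC0 1; rewrite ler01 lexx => /(_ isT); rewrite ler_norml -/(G 1) => /andP[h _].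
  have : 0 <= (E r - 1) * (C0 * G 1) by rewrite !mulr_ge0// subr_ge0 E1.
  by lra.
move=> x t x01 tT.
have tT' : 0 <= t <= T by case/andP: (half_T tT) => /ltW -> /ltW ->.
have tT2 : 0 <= t <= T / 2 by case/andP: tT => /ltW -> ->.
have [x0 x1] := andP x01.
have x01' : 0 <= x <= 1 by rewrite !ltW.
pose b' := be * bump x `^ (be - 1) * (1 - 2 * x).
pose G' := (dl + 2) * x `^ (dl + 2 - 1).
pose Q := nu x t * uy x t ^+ 2 / p x t.
have dq : transport_derive (c x t) q x t (nu x t * uy x t - p x t).
  exists (L t * rho x t * u x t), (nu x t * uy x t - p x t - c x t * (L t * rho x t * u x t)).
  by split; [apply: (nf_q_x H x01); rewrite (andP (half_T tT)).2; case/andP: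
    tT => /ltW ->|apply: (nf_q_t H x01); exact: half_T|ring].
have dE : transport_derive (c x t) (fun _ => E) x t (A * E t).
  by apply: transport_derive_time; exact: is_derive_expRZ.
have db : transport_derive (c x t) (fun x _ => b x) x t (c x t * b').
  by apply: transport_derive_space; exact: is_derive_bump.
have dG : transport_derive (c x t) (fun x _ => G x) x t (c x t * G').
  by apply: transport_derive_space; exact: is_derive1_powR.
have dC (C : R) : transport_derive (c x t) (fun _ _ => C) x t 0.
  by apply: transport_derive_time; exact: is_derive_cst.
have ds : transport_derive (c x t) sg x t (mu * Q) by apply: nf_dsg H _ _ _ _ => //; exact: half_T.
have := transport_deriveN (transport_deriveD dq (transport_deriveM dE
  (transport_deriveD (transport_deriveM db (transport_deriveD ds (dC S)))
    (transport_deriveM (dC C0) dG)))).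
move=> dF; eexists; first exact: dF.
move=> _; rewrite oppr_lt0.
have cb' : `|c x t * b'| <= K * be * b x.
  exact: bump_transport_bound x01 (ltW be0) (nf_c H x01 tT').
have cG' : `|c x t * G'| <= K * (dl + 2) * G x.
  rewrite /G' normrM (ger0_norm (mulr_ge0 (ltW d20) (powR_ge0 _ _))).
  have -> : G x = x * x `^ (dl + 2 - 1) by rewrite mulr_powRB1// ltW.
  have -> : K * (dl + 2) * (x * x `^ (dl + 2 - 1)) = K * x * ((dl + 2) * x `^ (dl + 2 - 1)) by ring.
  rewrite ler_wpM2r ?mulr_ge0 ?powR_ge0 ?(ltW d20)//.
  apply: le_trans (nf_c H x01 tT') _; rewrite ler_pM2l//; exact: bump_le.
have /andP[s1 s2] := sgS _ _ x01 tT'.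
have [rho0 p0] := nf_pos H x01 tT'.
have [nu0 nup pK] := nf_nu H x01 tT'.
have nugt0 : 0 < nu x t by apply: lt_le_trans nu0; rewrite mulr_gt0.
have rhom : rho x t `^ m <= K1 `^ m * b x.
  have m0 : 0 <= m by rewrite -(pmulr_rge0 _ dl0) ltW.
  have /andP[_ h] := rhoK _ _ x01' tT2.
  rewrite /b powRrM -powRM ?powR_ge0 ?(ltW K10)//.
  by apply: ge0_ler_powR => //; rewrite nnegrE ?mulr_ge0 ?powR_ge0// ltW.
have bgt0 : 0 < b x by rewrite powR_gt0// bump_gt0.
have pP : p x t <= P' * b x.
  by apply: (le_trans pK); rewrite /P' -mulrA ler_pM2l.
have nupP : nu x t * p x t <= P * b x ^+ 2.
  apply: (le_trans nup); rewrite /P -mulrA ler_pM2l// -exprMn.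
  by rewrite ler_sqr ?nnegrE ?mulr_ge0 ?powR_ge0.
have Q0 : 0 <= Q by apply: divr_ge0; [apply: mulr_ge0; [exact: ltW|exact: sqr_ge0]|exact: ltW].
(* AM-GM: [|nu uy| <= b mu Q + nu p / (4 mu b)] *)
have amgm : - (b x * (mu * Q)) - P / (4 * mu) * b x <= nu x t * uy x t.
  have h : - (b x * (mu * Q)) - nu x t * p x t / (4 * mu * b x) <= nu x t * uy x t.
    rewrite -subr_ge0.
    have -> : nu x t * uy x t - (- (b x * (mu * Q)) - nu x t * p x t / (4 * mu * b x))
      = nu x t * (2 * mu * b x * uy x t + p x t) ^+ 2 / (4 * mu * b x * p x t).
      by rewrite /Q; field; rewrite !gt_eqF.
    apply: divr_ge0; first by apply: mulr_ge0; [exact: ltW|exact: sqr_ge0].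
    by rewrite ltW// !mulr_gt0.
  apply: le_trans h; rewrite lerD2l lerN2 ler_pdivrMr; last by rewrite !mulr_gt0.
  apply: (le_trans nupP).
  suff -> : P / (4 * mu) * b x * (4 * mu * b x) = P * b x ^+ 2 by [].
  by field; rewrite gt_eqF.
have t0 : 0 <= t by case/andP: tT'.
have := E1 _ t0.
move: (E t) => e e1; move: cb' cG'; rewrite !ler_norml => /andP[cb1 _] /andP[cG1 _].
rewrite mul0r !add0r addr0.
move: (c x t * b') (c x t * G') cb1 cG1 => cb cg cb1 cG1.
have bge0 : 0 <= b x by exact: ltW.
have Gge0 : 0 <= G x := G_ge0 x.
clear dF dC ds dG db dE dq cF qC0 rhoK sgS tT tT' tT2 x01 x01' nup nu0 pK rhom nupP.
(* Once the motion of [b] and [G] along the flow is paid for, the growth of the weight still covers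
   the AM-GM remainder and the pressure, with [b] to spare. The factor [e >= 1] can then be dropped,
   as this bracket and the entropy production are both nonnegative. *)
have X1 : b x * (P / (4 * mu) + P' + 1) <=
   A * (b x * (sg x t + S) + C0 * G x) + cb * (sg x t + S) + C0 * cg.
  have Y1 : (A - K * be) * b x * (sg x t + S) <= A * (b x * (sg x t + S)) + cb * (sg x t + S).
    by nra.
  have Y2 : 0 <= A * (C0 * G x) + C0 * cg.
    have -> : A * (C0 * G x) + C0 * cg = C0 * (A * G x + cg) by ring.
    by rewrite mulr_ge0//; rewrite /A; nra.
  have Y3 : b x * (P / (4 * mu) + P' + 1) <= (A - K * be) * b x * (sg x t + S).
    have Z1 : b x * (P / (4 * mu) + P' + 1) <= (A - K * be) * b x.
      by rewrite mulrC; apply: ler_wpM2r => //; rewrite /A; lra.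
    apply: (le_trans Z1); rewrite ler_peMr// mulr_ge0//; rewrite /A; lra.
  by lra.
have X0 : 0 <= A * (b x * (sg x t + S) + C0 * G x) + cb * (sg x t + S) + C0 * cg.
  by apply: le_trans X1; rewrite mulr_ge0//; lra.
have bQ : 0 <= b x * (mu * Q) by apply: mulr_ge0 => //; apply: mulr_ge0 => //; exact: ltW.
have -> : A * e * (b x * (sg x t + S) + C0 * G x) +
  e * (cb * (sg x t + S) + b x * (mu * Q) + C0 * cg) =
  e * (A * (b x * (sg x t + S) + C0 * G x) + cb * (sg x t + S) + C0 * cg) + e * (b x *
    (mu * Q)) by ring.
have Z1 := ler_peMl X0 e1; have Z2 := ler_peMl bQ e1.
by nra.
Qed.

Lemma slice_MVT (f df : R -> R -> R) a b t : continuous_onD (rect 0 1 T) f ->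
  0 <= t <= T -> (forall x, 0 < x < 1 -> is_derive x 1 (f ^~ t) (df x t)) ->
  0 <= a -> a < b -> b <= 1 ->
  exists2 x, a < x < b & f b t - f a t = df x t * (b - a).
Proof.
move=> cf tT dfx a0 ab b1.
apply: (@MVT_oo _ (f ^~ t) (df ^~ t)) => //.
  apply: continuous_subspaceW (continuous_onD_slice_x cf tT).
  by move=> x /=; rewrite !in_itv/= => /andP[? ?]; apply/andP; split; lra.
by move=> x /andP[? ?]; apply: dfx; apply/andP; split; lra.
Qed.

(** Both bounds on [N] come from the mean value theorem. For the lower one it is applied on
    [[x / 2, x]]: on [[0, x]] the intermediate point could lie too close to 0 for a lower bound on
    [rho]. Staying left of [Y < 1] keeps [1 - x] away from 0, so that [bump x] is comparable to
    [x]. *)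
Lemma mass_bounds (Y : R) : 0 < Y < 1 -> exists2 k2, 0 < k2 & exists2 K2, 0 < K2 &
  forall x t, 0 < x <= Y -> 0 <= t <= T / 2 ->
   [/\ k2 * x `^ (dl + 1) <= N x t, N x t <= K2 * x `^ (dl + 1) &
       k2 * x `^ dl <= rho x t].
Proof.
move=> /andP[Y0 Y1]; have [[[k0 K0] dl0] T0] := (nf_k H, nf_K H, nf_dl H, nf_T H).
have [k1 k10 [K1 K10 rhoK]] := density_bounds.
pose k3 := k1 * (1 - Y) `^ dl.
have k30 : 0 < k3 by rewrite mulr_gt0// powR_gt0// subr_gt0.
have rlow x t : 0 < x <= Y -> 0 <= t <= T / 2 -> k3 * x `^ dl <= rho x t.
  move=> /andP[x0 xY] tT.
  have /andP[h _] : k1 * bump x `^ dl <= rho x t <= K1 * bump x `^ dl.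
    by apply: rhoK => //; rewrite ltW//= (le_trans xY)// ltW.
  apply: le_trans h; rewrite /k3 -mulrA ler_pM2l// mulrC.
  rewrite -powRM ?(ltW x0) ?subr_ge0 ?(ltW Y1)//.
  apply: ge0_ler_powR; rewrite ?nnegrE ?(ltW dl0)//.
  - by rewrite mulr_ge0// ?subr_ge0 ltW.
  - by rewrite mulr_ge0// ?subr_ge0 ?(ltW x0)// (le_trans xY)// ltW.
  - by rewrite ler_pM2l// lerD2l lerN2.
have pw x : 0 < x -> x `^ (dl + 1) = x * x `^ dl.
  by move=> x0; rewrite powRD ?(gt_eqF x0) ?implybT// powRr1 ?ltW// mulrC.
pose k4 := k * (k3 * 2^-1 `^ dl) / 2.
have k40 : 0 < k4 by rewrite divr_gt0// mulr_gt0// mulr_gt0// powR_gt0// invr_gt0.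
exists (Num.min k3 k4); first by rewrite lt_min k30.
exists (K * K1); first by rewrite mulr_gt0.
move=> x t xY tT; have tT' := half_T'' tT; have /andP[x0 xY'] := xY.
have x1 : x <= 1 by rewrite (le_trans xY')// ltW.
have /andP[L0 L1] := nf_L H tT'.
have dN (y : R) : 0 < y < 1 -> is_derive y 1 (N ^~ t) (L t * rho y t).
  by move=> y01; apply: (nf_N_x H y01); exact: half_T'.
have MN (a b : R) := @slice_MVT N (fun y t => L t * rho y t) a b t (nf_N_cont H) tT' dN.
have [N0 _] := nf_N_bd H tT'.
split.
- have [] := MN (x / 2) x; [lra|lra|lra|] => y /andP[y1 y2] Ne.
  apply: (@le_trans _ _ (N x t - N (x / 2) t)); last first.
    rewrite gerBl; have [] := MN 0 (x / 2); [lra|lra|lra|] => z /andP[z1 z2].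
    rewrite N0 subr0 => ->; rewrite subr0 mulr_ge0 ?divr_ge0 ?ltW//.
    apply: mulr_gt0; first exact: lt_le_trans L0.
    have zo : 0 < z < 1 by apply/andP; split; lra.
    by case: (nf_pos H zo tT').
  rewrite Ne; have -> : x - x / 2 = x / 2 by lra.
  apply: (@le_trans _ _ (k4 * x `^ (dl + 1))).
    by rewrite ler_wpM2r ?powR_ge0// ge_min lexx orbT.
  have -> : k4 * x `^ (dl + 1) = k * (k3 * (x / 2) `^ dl) * (x / 2).
    by rewrite pw// [(x / 2) `^ dl]powRM ?(ltW x0) ?invr_ge0// /k4; lra.
  rewrite ler_pM2r ?divr_gt0//; apply: ler_pM => //; rewrite ?(ltW k0)//.
    by rewrite mulr_ge0 ?powR_ge0// ltW.
  apply: le_trans (rlow _ _ _ tT); last by apply/andP; split; lra.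
  rewrite ler_pM2l//; apply: ge0_ler_powR; rewrite ?nnegrE ?(ltW dl0)//; lra.
- have [] := MN 0 x; [lra|lra|lra|] => y /andP[y1 y2].
  rewrite N0 subr0 => ->; rewrite pw// subr0 (mulrC x) mulrA ler_pM2r// -mulrA.
  have yo : 0 < y < 1 by apply/andP; split; lra.
  have [r0 _] := nf_pos H yo tT'.
  apply: ler_pM => //; [exact: le_trans (ltW k0) L0|exact: ltW|].
  have /andP[_ h] : k1 * bump y `^ dl <= rho y t <= K1 * bump y `^ dl.
    by apply: rhoK => //; apply/andP; split; lra.
  apply: (le_trans h); rewrite ler_pM2l//.
  apply: ge0_ler_powR; rewrite ?nnegrE ?(ltW dl0)//; rewrite /bump; nra.
- apply: le_trans (rlow _ _ xY tT); rewrite ler_wpM2r ?powR_ge0//.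
  by rewrite ge_min lexx.
Qed.

(** The sign of [u] alone gives [q <= 0]. Strictness at [Y] comes from continuity: [u] stays
    negative on a short interval to the left of [Y], over which [q] strictly decreases. *)
Lemma initial_momentum_lt0 (Y : R) : 0 < Y < 1 -> u Y 0 < 0 ->
  (forall x, 0 < x < Y -> u x 0 <= 0) ->
  q Y 0 < 0 /\ forall x, 0 <= x <= Y -> q x 0 <= 0.
Proof.
move=> /andP[Y0 Y1] uY u0.
have T0 := nf_T H; have [q0 _] := nf_q_bd H zeroT.
have /andP[L0 _] := nf_L H zeroT.
have Lgt0 : 0 < L 0 by exact: lt_le_trans (nf_k H) L0.
have dq (y : R) : 0 < y < 1 -> is_derive y 1 (q ^~ 0) (L 0 * rho y 0 * u y 0).
  by move=> y01; apply: (nf_q_x H y01); rewrite lexx.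
have Mq (a b : R) := @slice_MVT q (fun y t => L t * rho y t * u y t) a b 0 (nf_q_cont H) zeroT dq.
have le0 x : 0 <= x < Y -> q x 0 <= 0.
  move=> /andP[x0 xY].
  have [->|xn0] := eqVneq x 0; first by rewrite q0.
  have [] := Mq 0 x => //; [by rewrite lt_neqAle eq_sym xn0|lra|] => y /andP[y0 yx].
  rewrite q0 !subr0 => ->; rewrite mulr_le0_ge0// mulr_ge0_le0//.
    have yo : 0 < y < 1 by apply/andP; split; lra.
    by have [/ltW ? _] := nf_pos H yo zeroT; rewrite mulr_ge0// ltW.
  by apply: u0; apply/andP; split; lra.
have Y01 : 0 < Y < 1 by rewrite Y0.
suff qY : q Y 0 < 0.
  split=> // x /andP[x0 xY]; have [->|xn] := eqVneq x Y; first exact: ltW.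
  by apply: le0; rewrite x0 lt_neqAle xn.
have /cvgr_lt /(_ _ uY) := nf_u_cont H Y01.
rewrite near_simpl => -[e /= e0 He].
pose h := Num.min (e / 2) (Y / 2).
have h0 : 0 < h by rewrite lt_min !divr_gt0.
have he : h < e by rewrite gt_min ltr_pdivrMr// ltr_pMr// ltr1n.
have hx : h <= Y / 2 by rewrite ge_min lexx orbT.
have [] := Mq (Y - h) Y; [lra|lra|lra|] => y /andP[y0 yx] qE.
have h1 : q (Y - h) 0 <= 0 by apply: le0; apply/andP; split; lra.
have uy0 : u y 0 < 0.
  apply: He; rewrite /ball_/= gtr0_norm; lra.
suff : L 0 * rho y 0 * u y 0 * (Y - (Y - h)) < 0 by rewrite -qE; lra.
rewrite pmulr_llt0; last by lra.
rewrite pmulr_rlt0//; apply: mulr_gt0 => //.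
have yo : 0 < y < 1 by apply/andP; split; lra.
by case: (nf_pos H yo zeroT).
Qed.

Lemma powR_exp_small (a b C e : R) : 0 < e -> 0 <= C -> 0 < a -> 0 < b ->
  exists2 x0 : R, 0 < x0 & forall x, 0 < x <= x0 -> C * (x `^ a + x `^ b) < e.
Proof.
move=> e0 C0 a0 b0.
have : C * (x `^ a + x `^ b) @[x --> 0^'+] --> C * (0 + 0).
  by apply: cvgM; [exact: cvg_cst|apply: cvgD; exact: powR_cvg0].
rewrite addr0 mulr0 => /cvgr_lt /(_ _ e0).
move=> -[d /= d0 Hd]; exists (d / 2); first by rewrite divr_gt0.
move=> x /andP[x0 xd]; apply: Hd => //=.
by rewrite /ball_/= sub0r normrN gtr0_norm//; lra.
Qed.

(** With psi the barrier, [f = q + eps * psi (N, t)] has f_x = L rho (u + eps psi_z), a positive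
    weight times a differentiable factor. At an interior maximum this factor vanishes, so u = - eps
    psi_z, and its slope is nonpositive, so u_y <= - eps rho psi_zz. Then f_t <= - p + eps (psi_t -
    nu rho psi_zz) < 0, which a maximum over the past forbids. *)
Lemma momentum_barrier (Y : R) : 0 < Y < 1 -> u Y 0 < 0 ->
  (forall x, 0 < x < Y -> u x 0 <= 0) ->
  exists2 s, 0 < s <= T / 2 & exists2 e, 0 < e &
    forall x, 0 <= x <= Y -> q x s <= - (e * N x s).
Proof.
move=> Y01 uY u0; have /andP[Y0 Y1] := Y01.
have [[[k0 K0] dl0] T0] := (nf_k H, nf_K H, nf_dl H, nf_T H).
have [qY q0] := initial_momentum_lt0 Y01 uY u0.
have [k2 k20 [K2 K20 NB]] := mass_bounds Y01.
pose n := (dl + 1)^-1.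
have dl1 : 0 < dl + 1 by lra.
have n0 : 0 < n by rewrite invr_gt0.
have [s /andP[s0 sT] qs] : exists2 s, 0 < s <= T / 2 &
    forall t, 0 <= t <= s -> q Y t < q Y 0 / 2.
  have Y01' : 0 <= Y <= 1 by rewrite !ltW.
  have /subspace_continuousP := continuous_onD_slice_t (nf_q_cont H) Y01'.
  have z0 : `[0, T]%classic (0:R) by rewrite /= in_itv/= lexx ltW.
  move=> /(_ _ z0) /cvgr_lt /(_ (q Y 0 / 2)).
  have qh : q Y 0 < q Y 0 / 2 by lra.
  move=> /(_ qh); rewrite near_withinE => -[d /= d0 Hd].
  exists (Num.min (d / 2) (T / 2)); first by rewrite lt_min !divr_gt0//= ge_min lexx orbT.
  move=> t /andP[t0]; rewrite le_min => /andP[td tT]; apply: Hd.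
    by rewrite /ball_/= sub0r normrN ger0_norm//; lra.
  by rewrite /= in_itv/= t0; lra.
have sT' t : 0 <= t <= s -> 0 <= t <= T / 2 by move=> /andP[-> ?]; lra.
have NbY t : 0 <= t <= s -> N Y t <= K2 * Y `^ (dl + 1).
  by move=> /sT' tT; have [] := NB Y t _ tT => //; rewrite Y0 lexx.
have N_gt0 x t : 0 < x <= Y -> 0 <= t <= s -> 0 < N x t.
  move=> xY /sT' tT; have [h _ _] := NB _ _ xY tT; apply: lt_le_trans h.
  by rewrite mulr_gt0// powR_gt0//; case/andP: xY.
have N0 t : 0 <= t <= s -> N 0 t = 0.
  by move=> /sT'/half_T'' tT; case: (nf_N_bd H tT).
have N_ge0 x t : 0 <= x <= Y -> 0 <= t <= s -> 0 <= N x t.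
  move=> /andP[x0 xY] tT.
  have [->|xn0] := eqVneq x 0; first by rewrite N0.
  by apply: ltW; apply: N_gt0 => //; rewrite xY lt_neqAle eq_sym xn0 x0.
have zs : (0:R) <= 0 <= s by rewrite lexx ltW.
pose Z0 := N Y 0.
have Z00 : 0 < Z0 by apply: N_gt0 => //; rewrite Y0 lexx.
have NZ0 x : 0 <= x <= Y -> 0 <= N x 0 <= Z0.
  move=> xY; rewrite N_ge0//=; have /andP[x0 xY'] := xY.
  have [->|xnY] := eqVneq x Y; first exact: lexx.
  have dN (y : R) : 0 < y < 1 -> is_derive y 1 (N ^~ 0) (L 0 * rho y 0).
    by move=> y01; apply: (nf_N_x H y01); rewrite lexx.
  have [] := slice_MVT (df := fun y t => L t * rho y t) (b := Y) (nf_N_cont H) zeroT dN x0.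
  - by rewrite lt_neqAle xnY.
  - exact: ltW.
  move=> y /andP[xy yY] Ne; rewrite -subr_ge0 Ne mulr_ge0 ?subr_ge0//.
  have y01 : 0 < y < 1 by apply/andP; split; lra.
  have [r0 _] := nf_pos H y01 zeroT; rewrite mulr_ge0 ?(ltW r0)//.
  by have /andP[L0 _] := nf_L H zeroT; rewrite (le_trans _ L0)// ltW.
pose k3 := k2 * K2^-1 `^ (dl * n).
have k30 : 0 < k3 by rewrite mulr_gt0// powR_gt0// invr_gt0.
have rhoN x t : 0 < x <= Y -> 0 <= t <= s -> k3 * N x t `^ (dl * n) <= rho x t.
  move=> xY tT; have [h1 h2 h3] := NB _ _ xY (sT' _ tT).
  have x0 : 0 < x by case/andP: xY.
  have N0' := N_gt0 _ _ xY tT.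
  apply: le_trans h3; rewrite /k3 -mulrA ler_pM2l// -powRM ?invr_ge0 ?(ltW K20) ?(ltW N0')//.
  have -> : x `^ dl = (x `^ (dl + 1)) `^ (dl * n).
    by rewrite -powRrM /n mulrCA mulfV ?gt_eqF// mulr1.
  apply: ge0_ler_powR; rewrite ?nnegrE ?powR_ge0//.
  - by rewrite mulr_ge0// ltW.
  - by rewrite mulr_ge0 ?invr_ge0// ltW.
  - by rewrite mulrC ler_pdivrMr// mulrC.
pose kk := n ^+ 2 * (k * k3 ^+ 2).
have kk0 : 0 < kk.
  by apply: mulr_gt0; [exact: exprn_gt0|apply: mulr_gt0 => //; exact: exprn_gt0].
(* The inequality psi_t <= nu rho psi_zz allows the growth rate [kap = lam ^+ 2 * kk]. The gain
   [kap * s] is quadratic in [lam], while the loss [ln M = lam * Z0]^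
   n[is linear, so a large]lam[wins however short]s[is. This value gives]kap * s = lam * (Z0
   [^ n + 1)]. *)
pose lam := (Z0 `^ n + 1) / (kk * s).
have lam0 : 0 < lam.
  by apply: divr_gt0; [rewrite ltr_wpDl ?powR_ge0|exact: mulr_gt0].
pose kap := lam ^+ 2 * kk.
have kap0 : 0 < kap by apply: mulr_gt0 => //; exact: exprn_gt0.
have kaps : kap * s = lam * (Z0 `^ n + 1).
  by rewrite /kap /lam; field; rewrite !gt_eqF.
(* The least shift that makes the barrier nonpositive at time 0 for all masses up to [Z0]; by time
   [s] its bracket is positive for every mass. *)
pose M := expR (lam * Z0 `^ n).
have Ms : M < expR (kap * s) by rewrite ltr_expR kaps ltr_pM2l// ltrDl.
pose B := K2 * Y `^ (dl + 1) * expR (lam * (K2 * Y `^ (dl + 1)) `^ n + kap * T).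
have B0 : 0 <= B by rewrite !mulr_ge0 ?powR_ge0 ?expR_ge0// ltW.
(* [B] bounds the barrier on the side [x = Y], where [q <= q Y 0 / 2] up to time [s]. With this
   [eps] the sum stays nonpositive there. *)
pose eps := - (q Y 0 / 2) / (B + 1).
have eps0 : 0 < eps.
  apply: divr_gt0; last exact: ltr_wpDl.
  by rewrite oppr_gt0 ltr_pdivrMr// mul0r.
pose f x t := q x t + eps * barrier lam n kap M (N x t) t.
exists s; first by rewrite s0.
exists (eps * (expR (kap * s) - M)); first by rewrite mulr_gt0// subr_gt0.
suff f0 : forall x t, 0 <= x <= Y -> 0 <= t <= s -> f x t <= 0.
  move=> x xY; have ss : 0 <= s <= s by rewrite lexx ltW.
  have := f0 _ _ xY ss; rewrite /f /barrier => h.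
  suff : N x s * (expR (kap * s) - M) <= N x s * (barrier_exp lam n kap (N x s) s - M) by nra.
  rewrite ler_wpM2l ?N_ge0// lerD2r ler_expR lerDr mulr_ge0 ?powR_ge0//; exact: ltW.
have rs : rect 0 Y s `<=` rect 0 1 T.
  move=> [x t] [/= /andP[? ?] /andP[? ?]]; split; apply/andP; split => //=; lra.
apply: parabolic_max_principle.
- apply: continuous_onDD; first exact: continuous_onD_sub (nf_q_cont H).
  have cN : continuous_onD (rect 0 Y s) N by exact: continuous_onD_sub (nf_N_cont H).
  apply: continuous_onDM; first exact: continuous_onD_cst.
  apply: continuous_onDM => //.
  apply: continuous_onDD; last exact: continuous_onD_cst.
  apply: (@continuous_onD_comp _ _ (fun x t => lam * N x t `^ n + kap * t) expR setT) => //.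
    by apply: continuous_subspaceT; exact: continuous_expR.
  apply: continuous_onDD.
    apply: continuous_onDM; first exact: continuous_onD_cst.
    apply: (@continuous_onD_comp _ _ N (fun x => x `^ n) `[0, +oo[%classic) => //.
      by move=> x t [/= xY ts]; rewrite in_itv/= N_ge0.
    exact: continuous_powR.
  apply: (@continuous_onD_time _ _ (fun t => kap * t)).
  by move=> t; apply: cvgM; [exact: cvg_cst|exact: cvg_id].
- move=> x xY; rewrite /f.
  have h1 := q0 _ xY; have /andP[h2 h3] := NZ0 _ xY.
  suff : eps * barrier lam n kap M (N x 0) 0 <= 0 by lra.
  rewrite mulr_ge0_le0 ?(ltW eps0)// /barrier mulr_ge0_le0// subr_le0 ler_expR.
  rewrite mulr0 addr0 ler_pM2l//; apply: ge0_ler_powR; rewrite ?nnegrE ?(ltW n0)//.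
  exact: ltW.
- move=> t ts; have [q0t _] := nf_q_bd H (half_T'' (sT' _ ts)).
  rewrite /f q0t N0// /barrier mul0r mulr0 addr0; split => //.
  have h1 := qs _ ts; have YY : 0 < Y <= Y by rewrite Y0 lexx.
  have h2 := N_gt0 _ _ YY ts; have h3 := NbY _ ts.
  suff : eps * (N Y t * (barrier_exp lam n kap (N Y t) t - M)) <= - (q Y 0 / 2) by lra.
  apply: (@le_trans _ _ (eps * B)).
    rewrite ler_pM2l//; apply: (@le_trans _ _ (N Y t * barrier_exp lam n kap (N Y t) t)).
      by rewrite ler_pM2l// gerBl expR_ge0.
    apply: ler_pM; rewrite ?(ltW h2) ?expR_ge0// ler_expR; apply: lerD.
      rewrite ler_pM2l//; apply: ge0_ler_powR; rewrite ?nnegrE ?(ltW n0) ?(ltW h2)//.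
      by apply: le_trans h3; exact: ltW.
    by rewrite ler_pM2l//; have /andP[_] := half_T'' (sT' _ ts).
  by rewrite /eps mulrAC ler_pdivrMr; [nra|lra].
move=> x t xY ts _ fx ft.
have /andP[x0 xY'] := xY; have /andP[t0 ts'] := ts.
have ts0 : 0 <= t <= s by rewrite ltW.
have tT : 0 < t < T by apply: half_T; rewrite t0; lra.
have tT' : 0 <= t <= T by case/andP: tT => /ltW -> /ltW ->.
have tT'' : 0 <= t < T by case/andP: tT => /ltW -> ->.
have /andP[L0 _] := nf_L H tT'.
have Lgt0 : 0 < L t by exact: lt_le_trans L0.
have yo (y : R) : 0 < y < Y -> 0 < y < 1 by move=> /andP[-> ?]; lra.
have yY (y : R) : 0 < y < Y -> 0 < y <= Y by move=> /andP[-> /ltW].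
have df (y : R) : 0 < y < Y -> is_derive y 1 (f ^~ t)
    (L t * rho y t * (u y t + eps * barrier_z lam n kap M (N y t) t)).
  move=> yI; have db := is_derive1_comp (is_derive_barrier lam n kap M t (N_gt0 _ _
    (yY _ yI) ts0)) (nf_N_x H (yo _ yI) tT'').
  apply: is_derive_eq (is_deriveD (nf_q_x H (yo _ yI) tT'') (is_deriveZ eps db)) _.
  by rewrite /GRing.scale/=; ring.
have Lr0 (y : R) : 0 < y < Y -> 0 < L t * rho y t.
  by move=> yI; have [r0 _] := nf_pos H (yo _ yI) tT'; rewrite mulr_gt0.
have dw : is_derive x 1 (fun y => u y t + eps * barrier_z lam n kap M (N y t) t)
    (L t * uy x t + eps * (barrier_zz lam n kap (N x t) t * (L t * rho x t))).
  have db := is_derive1_comp (is_derive_barrier_z lam n kap M t (N_gt0 _ _ (yY _ xY) ts0))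
    (nf_N_x H (yo _ xY) tT'').
  exact: is_deriveD (nf_u_x H (yo _ xY) tT) (is_deriveZ eps db).
have [w0 dw0] := interior_max_factor_le0 xY df Lr0 dw fx.
have dft := is_deriveD (nf_q_t H (yo _ xY) tT) (is_deriveZ eps
  (is_derive_barrier_t lam n kap M (N_gt0 _ _ (yY _ xY) ts0) (nf_N_t H (yo _ xY) tT))).
have ft0 := left_max_derive_ge0 dft t0 ft.
have [r0 p0] := nf_pos H (yo _ xY) tT'.
have [nu0 _ _] := nf_nu H (yo _ xY) tT'.
have nugt0 : 0 < nu x t by apply: lt_le_trans nu0; rewrite mulr_gt0.
have rN := rhoN _ _ (yY _ xY) ts0.
have N0' := N_gt0 _ _ (yY _ xY) ts0.
move: ft0 w0 dw0; rewrite /GRing.scale/=.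
set E := barrier_exp _ _ _ _ _; set bz := barrier_z _ _ _ _ _ _; set bzz := barrier_zz _ _ _ _ _.
move=> ft0 w0 dw0.
have E0 : 0 < E by exact: expR_gt0.
have key : kap * N x t * E <= nu x t * rho x t * bzz.
  have h1 : k * (k3 * N x t `^ (dl * n)) ^+ 2 <= nu x t * rho x t.
    apply: (@le_trans _ _ (k * rho x t ^+ 2)).
      rewrite ler_pM2l// ler_sqr ?nnegrE ?(ltW r0)//.
      by apply: mulr_ge0; [exact: ltW|exact: powR_ge0].
    by rewrite expr2 mulrA ler_pM2r.
  have h2 : lam ^+ 2 * n ^+ 2 * (N x t `^ n * N x t `^ (n - 1)) * E <= bzz.
    rewrite -subr_ge0 /bzz /barrier_zz -/E.
    have -> : lam * n * (1 + n + lam * n * N x t `^ n) * N x t `^ (n - 1) * E -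
      lam ^+ 2 * n ^+ 2 * (N x t `^ n * N x t `^ (n - 1)) * E =
      lam * n * (1 + n) * N x t `^ (n - 1) * E by ring.
    apply: mulr_ge0; last exact: ltW.
    apply: mulr_ge0; last exact: powR_ge0.
    by apply: mulr_ge0; [apply: mulr_ge0; exact: ltW|apply: addr_ge0 => //; exact: ltW].
  have -> : kap * N x t * E = k * (k3 * N x t `^ (dl * n)) ^+ 2 *
     (lam ^+ 2 * n ^+ 2 * (N x t `^ n * N x t `^ (n - 1)) * E).
    (* The exponents [2 * dl * n + 2 * n - 1] add up to 1 precisely because [n * (dl + 1) = 1]; this
       dictates the power of [z] inside the barrier. *)
    have eN : N x t `^ (dl * n) ^+ 2 * (N x t `^ n * N x t `^ (n - 1)) = N x t.
      rewrite expr2 -!powRD ?(gt_eqF N0') ?implybT//.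
      have -> : dl * n + dl * n + (n + (n - 1)) = 1.
        by rewrite /n; field; rewrite gt_eqF.
      by rewrite powRr1// ltW.
    rewrite -{1}eN.
    move: (N x t `^ (dl * n)) (N x t `^ n) (N x t `^ (n - 1)) => a b d.
    by rewrite /kap /kk; ring.
  apply: ler_pM => //.
  - by apply: mulr_ge0; [exact: ltW|exact: sqr_ge0].
  - apply: mulr_ge0; last exact: ltW.
    apply: mulr_ge0; first by apply: mulr_ge0; exact: sqr_ge0.
    by apply: mulr_ge0; exact: powR_ge0.
clear fx ft df dw dft Lr0 yo yY rhoN NZ0 N_ge0 N0 N_gt0 NbY qs NB q0 u0 rs sT' nu0 rN.
have h3 : nu x t * uy x t <= - (eps * (nu x t * rho x t * bzz)).
  have h4 : L t * (uy x t + eps * (bzz * rho x t)) <= 0.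
    by have -> : L t * (uy x t + eps * (bzz * rho x t)) = L t * uy x t + eps * (bzz *
      (L t * rho x t)) by ring.
  move: h4; rewrite pmulr_rle0// => h4.
  have := mulr_ge0_le0 (ltW nugt0) h4; lra.
have h5 : eps * (kap * N x t * E) <= eps * (nu x t * rho x t * bzz) by rewrite ler_pM2l.
(* Substituting this value of [u] cancels the convective terms of [q] and of the barrier, so [c]
   disappears from the time derivative. *)
have h6 : u x t = - (eps * bz) by lra.
move: ft0; rewrite h6.
have -> : nu x t * uy x t - p x t - c x t * (L t * rho x t * - (eps * bz)) +
   eps * (bz * - (c x t * (L t * rho x t)) + kap * N x t * E) =
  nu x t * uy x t - p x t + eps * (kap * N x t * E) by ring.
lra.
Qed.

(** At time [s] the two estimates read - C (x^(dl m) + x^(dl + 2)) <= q <= - e k2 x^(dl + 1). Both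
    exponents on the left exceed [dl + 1], so division by x^(dl + 1) is contradictory for small
    [x]. *)
Lemma no_left_inflow (Ku Y : R) : 0 <= Ku ->
  (forall x, 0 < x < 1 -> `|u x 0| <= Ku * x) ->
  0 < Y < 1 -> u Y 0 < 0 -> (forall x, 0 < x < Y -> u x 0 <= 0) -> False.
Proof.
move=> Ku0 uK Y01 uY u0; have /andP[Y0 Y1] := Y01.
have [[[k0 K0] dl0] T0] := (nf_k H, nf_K H, nf_dl H, nf_T H).
have m1 := nf_m H.
have [C0 C00 qC0] := initial_momentum_bound Ku0 uK.
have [C C_ge0 qC] := momentum_lower_bound C00 qC0.
have [s sT [e e0 qs]] := momentum_barrier Y01 uY u0.
have [k2 k20 [K2 K20 NB]] := mass_bounds Y01.
have sT' : 0 <= s <= T / 2 by case/andP: sT => /ltW -> ->.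
have [||||x0 x00 small] := @powR_exp_small (dl * m - (dl + 1)) 1 C (e * k2) => //.
- by rewrite mulr_gt0.
- by rewrite subr_gt0.
pose x := Num.min x0 Y.
have xgt0 : 0 < x by rewrite lt_min x00.
have xY : x <= Y by rewrite ge_min lexx orbT.
have := small x; rewrite xgt0 ge_min lexx => /(_ isT).
rewrite ltNge => /negP; apply.
have xI : 0 <= x <= Y by rewrite ltW.
have x1 : 0 <= x <= 1 by rewrite ltW//= (le_trans xY)// ltW.
have h1 := qs _ xI; have h2 := qC _ _ x1 sT'.
have xI' : 0 < x <= Y by rewrite xgt0.
have [h3 _ _] := NB _ _ xI' sT'.
have X0 : 0 < x `^ (dl + 1) by rewrite powR_gt0.
rewrite -(ler_pM2r X0) -mulrA.
have -> : C * (x `^ (dl * m - (dl + 1)) + x `^ 1) * x `^ (dl + 1) =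
  C * (x `^ (dl * m) + x `^ (dl + 2)).
  rewrite -mulrA; congr (C * _); rewrite mulrDl -!powRD ?(gt_eqF xgt0) ?implybT//.
  by congr (x `^ _ + x `^ _); ring.
clear small qs NB uK u0 uY qC qC0 sT sT'.
have h4 : (x * (1 - x)) `^ (dl * m) <= x `^ (dl * m).
  have /andP[? ?] := x1; apply: ge0_ler_powR; rewrite ?nnegrE; nra.
have h5 := ler_wpM2l (ltW e0) h3.
have h6 := ler_wpM2l C_ge0 h4.
lra.
Qed.

End normalized_flow_theory.

(** * The mirror image x -> 1 - x *)

Section reflection.
Context {R : realType}.
Implicit Types (f : R -> R -> R) (c d x t T : R).

Lemma is_derive_onem (f : R -> R) x d : is_derive (1 - x) 1 f d ->
  is_derive x 1 (fun x => f (1 - x)) (- d).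
Proof.
move=> df.
have h : is_derive x 1 (fun x : R => 1 - x) (0 - 1) by exact: is_deriveB.
have := @is_derive1_comp R f (fun x => 1 - x) x d (0 - 1) df h.
by rewrite sub0r mulrN1.
Qed.

Lemma transport_derive_onem c f x t d : transport_derive c f (1 - x) t d ->
  transport_derive (- c) (fun x => f (1 - x)) x t d.
Proof.
move=> [fx [ft [dx dt <-]]]; exists (- fx), ft; split => //; last by rewrite mulrNN.
exact: (@is_derive_onem (f ^~ t)).
Qed.

Lemma cvg_within_rect_onem T x t :
  (1 - z.1, z.2) @[z --> within (rect 0 1 T) (nbhs (x, t))] -->
  within (rect 0 1 T) (nbhs (1 - x, t)).
Proof.
move=> A; rewrite /within/= => HA.
have ct : (1 - z.1, z.2) @[z --> nbhs (x, t)] --> (1 - x, t).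
  apply: cvg_to_pair; last exact: cvg_snd.
  by apply: cvgB; [exact: cvg_cst|exact: cvg_fst].
apply: (@filterS _ (nbhs (x, t)) _ _ _ _ (ct _ HA)) => -[y r] /= h [/= /andP[h1 h2] h3].
by apply: h; split => //=; apply/andP; split; lra.
Qed.

Lemma continuous_onD_onem f T : continuous_onD (rect 0 1 T) f ->
  continuous_onD (rect 0 1 T) (fun x => f (1 - x)).
Proof.
move=> /continuous_onDP cf; apply/continuous_onDP => -[x t] [/= /andP[x0 x1] tT].
have h : rect 0 1 T (1 - x, t) by split => //=; apply/andP; split; lra.
apply: (@cvg_comp _ _ _ (fun z : R * R => (1 - z.1, z.2)) (fun z => f z.1 z.2) _
  (within (rect 0 1 T) (nbhs (1 - x, t)))); last exact: (cf _ h).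
exact: cvg_within_rect_onem.
Qed.

(** Velocities change sign; [uy], being a derivative of a velocity, does not. The mass and momentum
    of (0, x) become those of (1 - x, 1), the latter with the opposite sign. Conservation of the
    totals makes the subtracted values [N 1 0] and [q 1 0] valid at all times. *)
Lemma normalized_flow_onem (T dl m k K mu : R) (L : R -> R)
    (rho u uy c sg nu p N q : R -> R -> R) :
  normalized_flow T dl m k K mu L rho u uy c sg nu p N q ->
  normalized_flow T dl m k K mu L (fun x => rho (1 - x)) (fun x t => - u (1 - x) t)
    (fun x => uy (1 - x)) (fun x t => - c (1 - x) t) (fun x => sg (1 - x))
    (fun x => nu (1 - x)) (fun x => p (1 - x)) (fun x t => N 1 0 - N (1 - x) t)
    (fun x t => q (1 - x) t - q 1 0).
Proof.
move=> H; have T0 := nf_T H.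
have o01 x : 0 < x < 1 -> 0 < 1 - x < 1 by move=> /andP[? ?]; apply/andP; split; lra.
have bump x : (1 - x) * (1 - (1 - x)) = x * (1 - x) by rewrite subKr mulrC.
have zT : (0:R) <= 0 <= T by rewrite lexx ltW.
split.
- exact: nf_T H.
- exact: nf_dl H.
- exact: nf_m H.
- exact: nf_k H.
- exact: nf_K H.
- exact: nf_mu H.
- exact: nf_L H.
- exact: continuous_onD_onem (nf_rho_cont H).
- apply: continuous_onDD; first exact: continuous_onD_cst.
  by apply: continuous_onDN; exact: continuous_onD_onem (nf_N_cont H).
- apply: continuous_onDD; last exact: continuous_onD_cst.
  exact: continuous_onD_onem (nf_q_cont H).
- move=> x t /o01 x01 tT.
  apply: (@cvg_comp _ _ _ (fun z : R * R => (1 - z.1, z.2)) (fun z => sg z.1 z.2) _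
    (within (rect 0 1 T) (nbhs (1 - x, t)))); last exact: (nf_sg_cont H x01 tT).
  exact: cvg_within_rect_onem.
- move=> x /o01 x01; apply: cvgN.
  apply: (@cvg_comp _ _ _ (fun x => 1 - x) (u ^~ 0) _ _ _ _ (nf_u_cont H x01)).
  by apply: cvgB; [exact: cvg_cst|exact: cvg_id].
- by move=> x /o01 /(nf_rho0 H); rewrite bump.
- by move=> t tT; rewrite subr0 subrr; case: (nf_rho_bd H tT).
- move=> t tT; rewrite subr0 subrr; have [-> ->] := nf_N_bd H tT.
  by have [-> _] := nf_N_bd H zT; rewrite subrr.
- move=> t tT; rewrite subr0 subrr; have [-> ->] := nf_q_bd H tT.
  by have [-> _] := nf_q_bd H zT; rewrite subrr.
- by move=> x t /o01; exact: nf_pos H _ _.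
- by move=> x t /o01; exact: nf_nu H _ _.
- by move=> x t /o01; exact: nf_uy H _ _.
- by move=> x t /o01 x01 /(nf_c H x01); rewrite bump normrN.
- by move=> x t /o01; exact: nf_sg H _ _.
- by move=> x t /o01 x01 /(nf_drho H x01) /transport_derive_onem.
- by move=> x t /o01 x01 /(nf_dsg H x01) /transport_derive_onem.
- move=> x t /o01 x01 /(nf_u_x H x01) h.
  by apply: is_derive_eq (is_deriveN (is_derive_onem h)) _; rewrite opprK.
- move=> x t /o01 x01 /(nf_N_x H x01) h.
  by apply: is_derive_eq (is_deriveB (is_derive_cst (N 1 0) _ _) (is_derive_onem h)) _;
    rewrite sub0r opprK.
- move=> x t /o01 x01 /(nf_N_t H x01) h.
  by apply: is_derive_eq (is_deriveB (is_derive_cst (N 1 0) _ _) h) _; rewrite sub0r mulNr.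
- move=> x t /o01 x01 /(nf_q_x H x01) h.
  by apply: is_derive_eq (is_deriveB (is_derive_onem h) (is_derive_cst (q 1 0) _ _)) _;
    rewrite subr0 mulrN.
- move=> x t /o01 x01 /(nf_q_t H x01) h.
  by apply: is_derive_eq (is_deriveB h (is_derive_cst (q 1 0) _ _)) _; rewrite subr0; ring.
Qed.

Lemma no_right_outflow (T dl m k K mu : R) (L : R -> R)
    (rho u uy c sg nu p N q : R -> R -> R) (Ku Y : R) :
  normalized_flow T dl m k K mu L rho u uy c sg nu p N q -> 0 <= Ku ->
  (forall x, 0 < x < 1 -> `|u x 0| <= Ku * (1 - x)) ->
  0 < Y < 1 -> 0 < u Y 0 -> (forall x, Y < x < 1 -> 0 <= u x 0) -> False.
Proof.
move=> /normalized_flow_onem H Ku0 uK /andP[Y0 Y1] uY u0.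
apply: (no_left_inflow H Ku0 (Y := 1 - Y)).
- move=> x /andP[? ?]; rewrite normrN; have := uK (1 - x); rewrite subKr; apply.
  by apply/andP; split; lra.
- by apply/andP; split; lra.
- by rewrite subKr oppr_lt0.
- by move=> x /andP[? ?]; rewrite oppr_le0 u0//; apply/andP; split; lra.
Qed.

End reflection.

(** * Pointwise bounds from essential bounds *)

Section essential_bounds.
Context {R : realType}.
Notation mu := (@lebesgue_measure R).

Lemma near_within_box (D : set (R * R)) (y0 t0 : R) (P : set (R * R)) :
  (\forall z \near within D (nbhs (y0, t0)), P z) ->
  exists2 e, 0 < e & forall y t, `|y - y0| < e -> `|t - t0| < e -> D (y, t) -> P (y, t).
Proof.
move=> [[A B] [/= /nbhs_ballP[e1 /= e10 HA] /nbhs_ballP[e2 /= e20 HB]] HAB].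
exists (Num.min e1 e2); first by rewrite lt_min e10.
move=> y t; rewrite !lt_min => /andP[y1 y2] /andP[t1 t2] Dyt; apply: HAB => //.
by split => /=; [apply: HA|apply: HB]; rewrite /ball/= distrC.
Qed.

Lemma ae_in_itv (P : set R) (a b : R) : a < b -> {ae mu, forall x, P x} ->
  exists2 x, a < x < b & P x.
Proof.
move=> ab aeP; apply/not_exists2P => H.
have : mu.-negligible `]a, b[.
  apply: negligibleS aeP => x /=; rewrite in_itv/= => xab Px.
  by case: (H x).
move=> neg; have m0 : mu `]a, b[ = 0%E by apply: measure_negligible neg; exact: measurable_itv.
have := @lebesgue_measure_itv R `]a, b[; rewrite /= lte_fin ab m0 -EFinB => /esym/eqP.
by rewrite eqe subr_eq0 gt_eqF.
Qed.

Lemma Linfty_ae_bound (g : R -> \bar R) (K : \bar R) : ('N[mu]_+oo%E [g] <= K)%E ->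
  {ae mu, forall x, (`|g x| <= K)%E}.
Proof.
have muT : (0 < mu setT)%E.
  have := @lebesgue_measure_itv R `]-oo, +oo[; rewrite set_itvNyy /= => ->.
  by rewrite addey// lt0y.
by rewrite Lnorm.unlock muT => gK; apply/ess_supP.
Qed.

(** If [|f|] exceeded the essential bound at one point, continuity would make it do so on the part
    of the tube in a small box. Almost every time obeys the bound on the spatial norm, and at such a
    time almost every [y] obeys the pointwise bound. Choosing first the time and then the point
    inside the box is contradictory. *)
Lemma in_Linfty_bounded (T : R) (w1 w2 : R -> R) (f : R -> R -> R) : 0 < T ->
  (forall t, 0 <= t <= T -> w1 r @[r --> within `[0, T] (nbhs t)] --> w1 t) ->
  (forall t, 0 <= t <= T -> w2 r @[r --> within `[0, T] (nbhs t)] --> w2 t) ->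
  continuous_onD (tube T w1 w2) f -> in_Lp_Linfty T w1 w2 +oo%E f ->
  exists K, forall y t, tube T w1 w2 (y, t) -> `|f y t| <= K.
Proof.
move=> T0 cw1 cw2 /continuous_onDP cf [_ fin].
pose S := (Linfty_norm w1 w2 f) \_ `]0, T[.
have S0 : (0 <= 'N[mu]_+oo [S])%E by exact: Lnorm_ge0.
pose K := fine 'N[mu]_+oo [S]%E.
have KE : 'N[mu]_+oo [S]%E = K%:E by rewrite fineK// ge0_fin_numE.
have aeS : {ae mu, forall t, (`|S t| <= K%:E)%E} by apply: Linfty_ae_bound; rewrite KE.
exists K => y0 t0 yt0; rewrite leNgt; apply/negP => fK.
have /cvg_norm /cvgr_gt := cf _ yt0; rewrite /= => /(_ _ fK).
move=> /near_within_box [e e0 He].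
have [/= tT /andP[wy yw]] := yt0.
have near_t (P : set R) : (\forall r \near within `[0, T] (nbhs t0), P r) ->
    exists2 d, 0 < d & forall r, `|r - t0| < d -> 0 <= r <= T -> P r.
  move=> /nbhs_ballP[d /= d0 Hd]; exists d => // r rd rT.
  by apply: (Hd r); rewrite /ball/= 1?distrC// in_itv.
have [d1 d10 H1] := near_t _ (cvgr_lt _ (cw1 _ tT) _ wy).
have [d2 d20 H2] := near_t _ (cvgr_gt _ (cw2 _ tT) _ yw).
pose d := Num.min e (Num.min d1 d2).
have d0 : 0 < d by rewrite !lt_min e0 d10.
(* [t0] may be 0 or T, so the window of times is cut to []0, T[], where the norm is controlled; it
   keeps a nonempty interior. *)
pose a := Num.max 0 (t0 - d); pose b := Num.min T (t0 + d).
have ab : a < b.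
  have /andP[t00 t0T] := tT.
  rewrite gt_max !lt_min T0/=; clear - d0 t00 t0T T0.
  by apply/andP; split; [lra|apply/andP; split; lra].
have [t /andP[ta tb] St] := ae_in_itv ab aeS.
move: ta tb; rewrite gt_max lt_min => /andP[t00 tad] /andP[tT' tbd].
have td : `|t - t0| < d by rewrite ltr_distl tad.
have trT : 0 <= t <= T by rewrite !ltW.
move: td; rewrite !lt_min => /and3P[te td1 td2].
have wyt := H1 _ td1 trT; have ywt := H2 _ td2 trT.
have nK : (Linfty_norm w1 w2 f t <= K%:E)%E.
  have tI : t \in `]0, T[%classic by rewrite inE/= in_itv/= t00.
  by move: St; rewrite /S patchE tI gee0_abs// Lnorm_ge0.
have aeY := Linfty_ae_bound nK.
have [|y /andP[ya yb] fy] := @ae_in_itv _ (Num.max (w1 t) (y0 - e)) (Num.min (w2 t) (y0 + e)) _ aeY.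
  rewrite gt_max !lt_min {wy yw}; clear - e0 wyt ywt t0 H1 H2.
  by apply/andP; split; apply/andP; split; lra.
move: ya yb; rewrite gt_max lt_min => /andP[ya1 ya2] /andP[yb1 yb2].
have Dyt : tube T w1 w2 (y, t) by split => //=; rewrite ya1.
have ye : `|y - y0| < e by rewrite ltr_distl ya2.
have := He y t ye te Dyt; rewrite ltNge => /negP; apply.
by move: fy; rewrite /= patchE mem_set ?lee_fin// /Omega/= in_itv/= ya1.
Qed.

End essential_bounds.

(** * Boundary values of the initial velocity *)

Section weighted_data.
Context {R : realType}.
Notation mu := (@lebesgue_measure R).

Lemma bdist_gt0 (y : R) : 0 < y < 1 -> 0 < bdist y.
Proof. by move=> /andP[y0 y1]; rewrite /bdist lt_min y0 subr_gt0. Qed.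

Lemma continuous_bdist : continuous (@bdist R).
Proof.
move=> y; apply: (@continuous_min _ _ id (fun y => 1 - y)); first exact: cvg_id.
by apply: cvgB; [exact: cvg_cst|exact: cvg_id].
Qed.

Lemma is_derive_continuous (F : R -> R) (y d : R) : is_derive y 1 F d ->
  {for y, continuous F}.
Proof.
by move=> dF; apply: differentiable_continuous; apply/derivable1_diffP; exact: ex_derive.
Qed.

Lemma is_derive_FTC2 (F f : R -> R) (a b : R) : a < b ->
  {within `[a, b], continuous f} ->
  (forall y, a <= y <= b -> is_derive y 1 F (f y)) ->
  (\int[mu]_(x in `[a, b]) (f x)%:E = (F b - F a)%:E)%E.
Proof.
move=> ab cf dF; rewrite EFinB; apply: continuous_FTC2 => //.
  split.
  - move=> y; rewrite in_itv/= => /andP[ay yb].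
    by apply: (@ex_derive _ _ _ _ _ _ _ (dF y _)); rewrite !ltW.
  - apply: cvg_at_right_filter; apply: (@is_derive_continuous F a (f a)).
    by apply: dF; rewrite lexx ltW.
  - apply: cvg_at_left_filter; apply: (@is_derive_continuous F b (f b)).
    by apply: dF; rewrite lexx ltW.
move=> y; rewrite in_itv/= => /andP[ay yb].
have := dF y; rewrite !ltW// => /(_ isT) h.
by rewrite derive1E; exact: derive_val.
Qed.

(** The integral of 1 / d is kept as an increment of a primitive [F], a logarithm near either end.
    As [I] does not depend on the interval while [F] is unbounded at the ends, [u0 ^+ 2] cannot stay
    above a positive [h] there. *)
Lemma weighted_L2_primitive_bound (u0 : R -> R) : weighted_L2 u0 ->
  exists I : R, forall (a b h : R) (F : R -> R), 0 < a -> a < b -> b < 1 -> 0 <= h ->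
    (forall y, a <= y <= b -> h <= u0 y ^+ 2) ->
    (forall y, a <= y <= b -> is_derive y 1 F (bdist y)^-1) ->
    h * (F b - F a) <= I.
Proof.
move=> wu; have := Lfun2_integrable_sqr wu.
set g := (fun y => u0 y / Num.sqrt (bdist y)) \_ `]0, 1[ => ig.
exists (fine (\int[mu]_x (g x ^+ 2)%:E)%E) => a b h F a0 ab b1 h0 hu dF.
have yI y : a <= y <= b -> 0 < y < 1 by move=> /andP[? ?]; apply/andP; split; lra.
have cb : {within `[a, b], continuous (fun y => h * (bdist y)^-1)}.
  apply: continuous_in_subspaceT => y; rewrite inE/= in_itv/= => /yI y01.
  apply: cvgM; first exact: cvg_cst.
  by apply: cvgV; [rewrite gt_eqF// bdist_gt0|exact: continuous_bdist].
have dhF y : a <= y <= b -> is_derive y 1 (fun y => h * F y) (h * (bdist y)^-1).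
  by move=> yab; apply: is_deriveZ; exact: dF.
have := is_derive_FTC2 ab cb dhF; rewrite -mulrBr => FTC.
have fin : (\int[mu]_x (g x ^+ 2)%:E)%E \is a fin_num by exact: integrable_fin_num ig.
have mg := measurable_int _ ig.
rewrite -lee_fin fineK// -FTC.
apply: (@le_trans _ _ (\int[mu]_(x in `[a, b]) (g x ^+ 2)%:E)%E).
  apply: ge0_le_integral => //.
  - by move=> y /=; rewrite in_itv/= => /yI y01;
    rewrite lee_fin mulr_ge0// invr_ge0 ltW// bdist_gt0.
  - by apply/measurable_EFinP; apply: subspace_continuous_measurable_fun cb.
  - exact: measurable_funS mg.
  - move=> y /=; rewrite in_itv/= => yab; have y01 := yI _ yab.
    rewrite lee_fin /g patchE mem_set ?in_itv//=.
    have b0 := bdist_gt0 y01; rewrite exprMn exprVn (sqr_sqrtr (ltW b0)).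
    by rewrite ler_pM2r ?invr_gt0// hu.
apply: ge0_subset_integral => //.
by move=> y _; rewrite lee_fin sqr_ge0.
Qed.

Lemma weighted_L2_left_limit (u0 : R -> R) (l : R) : weighted_L2 u0 ->
  u0 y @[y --> 0^'+] --> l -> l = 0.
Proof.
move=> /weighted_L2_primitive_bound[I HI] ul; apply/eqP/negPn/negP => l0.
pose h := `|l| / 2.
have h0 : 0 < h by rewrite divr_gt0// normr_gt0.
have hl : h < `|l| by rewrite /h; have := normr_gt0 l; rewrite l0; lra.
have := cvgr_gt _ (cvg_norm ul) _ hl.
move=> [d /= d0 Hd].
pose b := Num.min (d / 2) (1 / 2).
have b0 : 0 < b by rewrite lt_min !divr_gt0.
have [bd b2] : b <= d / 2 /\ b <= 1 / 2 by rewrite !ge_min !lexx orbT.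
have h20 : 0 < h ^+ 2 by rewrite exprn_gt0.
(* Chosen so that [h ^+ 2 * (ln b - ln a)] equals [|I| + 1], just above the bound [I]. *)
pose a := b * expR (- ((`|I| + 1) / h ^+ 2)).
have a0 : 0 < a by rewrite mulr_gt0 ?expR_gt0.
have I0 : 0 < (`|I| + 1) / h ^+ 2 by rewrite divr_gt0// ltr_wpDl.
have ab : a < b by rewrite /a gtr_pMr// expR_lt1 oppr_lt0.
have E : h ^+ 2 * (ln b - ln a) = `|I| + 1.
  rewrite /a lnM ?posrE ?expR_gt0// expRK opprD addrA subrr sub0r opprK.
  by rewrite mulrC divfK// gt_eqF.
suff : h ^+ 2 * (ln b - ln a) <= I by rewrite E; have := ler_norm I; lra.
apply: (HI a b (h ^+ 2) (@ln R)) => //; [lra|exact: ltW| |].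
- move=> y /andP[ay yb]; rewrite -[u0 y ^+ 2]real_normK ?num_real// ler_sqr ?nnegrE ?(ltW h0)//.
  by apply: ltW; apply: Hd => /=; [rewrite sub0r normrN gtr0_norm; lra|lra].
- move=> y /andP[ay yb]; have y0 : 0 < y by lra.
  have -> : bdist y = y by rewrite /bdist; apply/min_idPl; lra.
  exact: is_derive1_ln.
Qed.

Lemma weighted_L2_right_limit (u0 : R -> R) (l : R) : weighted_L2 u0 ->
  u0 y @[y --> 1^'-] --> l -> l = 0.
Proof.
move=> /weighted_L2_primitive_bound[I HI] ul; apply/eqP/negPn/negP => l0.
pose h := `|l| / 2.
have h0 : 0 < h by rewrite divr_gt0// normr_gt0.
have hl : h < `|l| by rewrite /h; have := normr_gt0 l; rewrite l0; lra.
have := cvgr_gt _ (cvg_norm ul) _ hl.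
move=> [d /= d0 Hd].
pose b := Num.min (d / 2) (1 / 2).
have b0 : 0 < b by rewrite lt_min !divr_gt0.
have [bd b2] : b <= d / 2 /\ b <= 1 / 2 by rewrite !ge_min !lexx orbT.
have h20 : 0 < h ^+ 2 by rewrite exprn_gt0.
pose a := b * expR (- ((`|I| + 1) / h ^+ 2)).
have a0 : 0 < a by rewrite mulr_gt0 ?expR_gt0.
have I0 : 0 < (`|I| + 1) / h ^+ 2 by rewrite divr_gt0// ltr_wpDl.
have ab : a < b by rewrite /a gtr_pMr// expR_lt1 oppr_lt0.
have E : h ^+ 2 * (- ln (1 - (1 - a)) - - ln (1 - (1 - b))) = `|I| + 1.
  rewrite !subKr /a lnM ?posrE ?expR_gt0// expRK opprD opprK opprK addrAC addNr add0r.
  by rewrite mulrC divfK// gt_eqF.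
suff : h ^+ 2 * (- ln (1 - (1 - a)) - - ln (1 - (1 - b))) <= I.
  by rewrite E; have := ler_norm I; lra.
apply: (HI (1 - b) (1 - a) (h ^+ 2) (fun y => - ln (1 - y))); [lra|lra|lra|exact: ltW| |].
- move=> y /andP[ay yb]; rewrite -[u0 y ^+ 2]real_normK ?num_real// ler_sqr ?nnegrE ?(ltW h0)//.
  by apply: ltW; apply: Hd => /=; [rewrite gtr0_norm; lra|lra].
- move=> y /andP[ay yb]; have y0 : 0 < 1 - y by lra.
  have -> : bdist y = 1 - y by rewrite /bdist; apply/min_idPr; lra.
  have := is_deriveN (is_derive_onem (is_derive1_ln y0)).
  by rewrite opprK.
Qed.

End weighted_data.

(** * Potentials of closed forms *)

Section time_derivatives.
Context {R : realType}.
Implicit Types (f g : R -> R) (t T d x : R).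

Lemma is_derive_diff_quot f x d :
  is_derive x 1 f d <-> diff_quot f x y @[y --> x^'] --> d.
Proof.
split.
- move=> [df <-]; apply/cvgrPdist_lt => e e0.
  have /cvgrPdist_lt /(_ _ e0) := df.
  move=> [r /= r0 Hr]; exists r => // y yr yx.
  have := Hr (y - x); rewrite /= sub0r normrN subr_eq0 /GRing.scale/= mulr1 subrK.
  by rewrite -normrN opprB => /(_ yr yx); rewrite /diff_quot mulrC; apply.
- move=> df; have cf : h^-1 *: (f (h *: 1 + x) - f x) @[h --> 0^'] --> d.
    apply/cvgrPdist_lt => e e0; have /cvgrPdist_lt /(_ _ e0) := df.
    move=> [r /= r0 Hr]; exists r => // h hr h0.
    have := Hr (h + x); rewrite /= opprD addrCA subrr addr0 /diff_quot addrK.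
    rewrite /GRing.scale/= mulr1 mulrC; apply.
      by rewrite /= sub0r in hr.
    by rewrite -subr_eq0 addrK.
  by split; [apply/cvg_ex; exists d|apply: cvg_lim].
Qed.

Lemma within_itv_dnbhs T t : 0 < t < T -> within `[0, T] t^' = t^'.
Proof.
move=> /andP[t0 tT]; apply/seteqP; split => A.
- rewrite /within/= => HA.
  have nI : \forall r \near t^', `[0, T]%classic r.
    apply: cvg_within; apply: filterS (@near_in_itvoo _ 0 T t _) => [r|].
      by rewrite /= !in_itv/= => /andP[/ltW -> /ltW ->].
    by rewrite in_itv/= t0.
  by apply: filterS2 HA nI => r; apply.
- by move=> HA; apply: filterS HA.
Qed.

Lemma diff_quot_is_derive T g t d : 0 < t < T ->
  diff_quot g t @ within `[0, T] t^' --> d -> is_derive t 1 g d.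
Proof. by move=> tT; rewrite within_itv_dnbhs// => /is_derive_diff_quot. Qed.

Lemma time_derivable_is_derive T g t : 0 < t < T -> time_derivable T g t ->
  is_derive t 1 g (time_derive T g t).
Proof. by move=> tT; exact: diff_quot_is_derive. Qed.

Lemma diff_quot_continuous T g t d : diff_quot g t @ within `[0, T] t^' --> d ->
  g r @[r --> within `[0, T] (nbhs t)] --> g t.
Proof.
move=> dg.
have F0 : Filter (within `[0, T] t^') by exact: within_filter.
have h : g t + diff_quot g t r * (r - t) @[r --> within `[0, T] t^'] --> g t.
  rewrite -[X in _ --> X]addr0 -[X in _ --> _ + X](mulr0 d).
  apply: cvgD; first exact: cvg_cst.
  apply: cvgM => //; rewrite -(subrr t).
  apply: cvgB; last exact: cvg_cst.
  by move=> A HA; apply: cvg_within; apply: cvg_within.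
move=> A HA.
have h' : \forall r \near nbhs t, r != t -> `[0, T]%classic r ->
  A (g t + diff_quot g t r * (r - t)) := h A HA.
suff : \forall r \near nbhs t, `[0, T]%classic r -> A (g r) by [].
apply: filterS h' => r H rT.
have [->|rt] := eqVneq r t; first exact: nbhs_singleton.
by have := H rt rT; rewrite /diff_quot divfK ?subr_eq0// addrC subrK.
Qed.

(** A chain rule without joint differentiability: the increment is split into a move in space at
    time [r] and a move in time at the fixed point [g t]. The first is handled by the mean value
    theorem and continuity of [fy], the second by the partial derivative at that point alone. *)
Lemma is_derive_along (f fy : R -> R -> R) (g : R -> R) t gd ft :
  is_derive t 1 g gd -> is_derive t 1 (f (g t)) ft ->
  (\forall z \near nbhs ((g t, t) : R * R), is_derive (z.1 : R) 1 (f ^~ z.2) (fy z.1 z.2)) ->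
  fy z.1 z.2 @[z --> nbhs ((g t, t) : R * R)] --> fy (g t) t ->
  is_derive t 1 (fun r => f (g r) r) (ft + gd * fy (g t) t).
Proof.
move=> dg dft dfy cfy.
(* The spatial difference quotient; when [g r = g t] it takes its limit value, so that the product
   with the quotient of [g] stays correct. *)
pose h r := if g r == g t then fy (g t) t else (f (g r) r - f (g t) r) / (g r - g t).
have hc : h r @[r --> t^'] --> fy (g t) t.
  apply/cvgrPdist_lt => e e0.
  have /cvgrPdist_lt /(_ _ e0) := cfy => near_fy.
  have [[A B] [/= /nbhs_ballP[e1 /= e10 HA] /nbhs_ballP[e2 /= e20 HB]] HAB] := filterI dfy near_fy.
  have cg := is_derive_continuous dg.
  have /cvgrPdist_lt /(_ _ e10) gt := cg.
  apply: nbhs_dnbhs.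
  have gt2 : \forall r \near t, ball t e2 r by exact: nbhsx_ballx.
  apply: filterS2 gt gt2 => r gr tr.
  rewrite /h; case: eqVneq => [_|gne]; first by rewrite subrr normr0.
  have inb y : `|g t - y| < e1 -> is_derive y 1 (f ^~ r) (fy y r) /\ `|fy (g t) t - fy y r| < e.
    by move=> yb; have := HAB (y, r); apply; split => /=; [exact: HA|exact: HB].
  suff [y yb ->] : exists2 y, `|g t - y| < e1 & (f (g r) r - f (g t) r) / (g r - g t) = fy y r.
    by case: (inb _ yb).
  have mvt a b : a < b -> `|g t - a| < e1 -> `|g t - b| < e1 ->
      exists2 y, `|g t - y| < e1 & f b r - f a r = fy y r * (b - a).
    move=> ab ha hb.
    have hy y : a <= y <= b -> `|g t - y| < e1.
      move=> /andP[ay yb]; move: ha hb; rewrite !ltr_norml => /andP[? ?] /andP[? ?].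
      by apply/andP; split; lra.
    have [] := @MVT_oo R (f ^~ r) (fy ^~ r) a b ab.
    - apply: derivable_within_continuous => y; rewrite in_itv/= => /hy /inb[dy _].
      exact: ex_derive.
    - by move=> y /andP[ay yb]; case: (inb y _) => //; apply: hy; rewrite !ltW.
    - by move=> y /andP[ay yb] E; exists y => //; apply: hy; rewrite !ltW.
  have gtt : `|g t - g t| < e1 by rewrite subrr normr0.
  have [gl|gg|/eqP] := ltgtP (g r) (g t); last by rewrite (negbTE gne).
  - have [y yb E] := mvt _ _ gl gr gtt; exists y => //.
    rewrite -opprB E -(opprB (g t)) mulNr invrN mulrN opprK mulfK// subr_eq0.
    by rewrite eq_sym.
  - have [y yb E] := mvt _ _ gg gtt gr; exists y => //.
    by rewrite E mulfK// subr_eq0.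
apply/is_derive_diff_quot.
have dq1 := (is_derive_diff_quot _ _ _).1 dg.
have dq2 := (is_derive_diff_quot _ _ _).1 dft.
suff -> : diff_quot (fun r => f (g r) r) t =
    (fun r => diff_quot (f (g t)) t r + diff_quot g t r * h r).
  exact: cvgD dq2 (cvgM dq1 hc).
apply/funext => r.
rewrite /= /diff_quot /h; case: eqVneq => [->|gne].
  by rewrite subrr mul0r mul0r addr0.
have : g r - g t != 0 by rewrite subr_eq0.
move: (g r - g t) => dgr dgr0.
by move: ((r - t)^-1) => k; field.
Qed.

End time_derivatives.

Section potential.
Context {R : realType}.
Notation mu := (@lebesgue_measure R).
Implicit Types (T K x t : R) (a b d : R -> R -> R).

Let continuous_integrable (f : R -> R) (u v : R) : {within `[u, v], continuous f} ->
  mu.-integrable `[u, v] (EFin \o f).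
Proof. by move=> cf; apply: continuous_compact_integrable => //; exact: segment_compact. Qed.

Let primitive_derive (f : R -> R) (u v x : R) : {within `[u, v], continuous f} ->
  u < x < v -> is_derive x 1 (fun x => \int[mu]_(y in `[u, x]) f y) (f x).
Proof.
move=> cf /andP[ux xv]; have cfx : {for x, continuous f}.
  by apply: (within_continuous_continuous _ cf); rewrite ?in_itv/= ?ux// (lt_trans ux).
have [dF F'] := continuous_FTC1_closed xv (continuous_integrable cf) ux cfx.
by split; [exact: dF|rewrite -derive1E; exact: F'].
Qed.

Let primitive_continuous (f : R -> R) (u v : R) : u <= v -> {within `[u, v], continuous f} ->
  {within `[u, v], continuous (fun x => \int[mu]_(y in `[u, x]) f y)}.
Proof. by move=> uv cf; exact: parameterized_integral_continuous (continuous_integrable cf). Qed.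

(** The form a dx + b dt is closed, as both cross derivatives equal [d]. It is integrated along x at
    time 0 and then along t at fixed x, not along x at time t: [d] is only locally bounded in
    [0 < x < 1], and differentiating under the time integral needs a bound on [d] near one [x] only.
    The decay of [b] at the ends makes [N] constant in time there. *)
Lemma exact_potential a b d T K : 0 < T -> 0 <= K ->
  {within `[0, 1], continuous (a ^~ 0)} ->
  (forall x, 0 < x < 1 -> {within `[0, T], continuous (a x)}) ->
  (forall x, 0 < x < 1 -> {within `[0, T], continuous (b x)}) ->
  (forall x t, 0 < x < 1 -> 0 <= t <= T -> `|b x t| <= K * (x * (1 - x))) ->
  (forall x t, 0 < x < 1 -> 0 <= t <= T -> is_derive x 1 (b ^~ t) (d x t)) ->
  (forall x t, 0 < x < 1 -> 0 < t < T -> is_derive t 1 (a x) (d x t)) ->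
  continuous_onD [set z | 0 < z.1 < 1 /\ 0 <= z.2 <= T] d ->
  exists N : R -> R -> R, [/\ continuous_onD (rect 0 1 T) N,
    forall t, 0 <= t <= T -> N 0 t = 0 /\ N 1 t = N 1 0,
    forall x t, 0 < x < 1 -> 0 <= t <= T -> is_derive x 1 (N ^~ t) (a x t) &
    forall x t, 0 < x < 1 -> 0 < t < T -> is_derive t 1 (N x) (b x t)].
Proof.
move=> T0 K0 ca0 ca cb bK dbx dat cd.
pose A x := \int[mu]_(y in `[0, x]) a y 0.
pose B0 x t := \int[mu]_(s in `[0, t]) b x s.
(* Nothing is known of [b] at x = 0 and x = 1. The value 0 is the limit from inside, by
   [B0bound]. *)
pose B x t := if 0 < x < 1 then B0 x t else 0.
have dB0t x t : 0 < x < 1 -> 0 < t < T -> is_derive t 1 (B0 x) (b x t).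
  by move=> x01 tT; exact: primitive_derive (cb _ x01) tT.
have B00 x : B0 x 0 = 0 by rewrite /B0 set_itv1 Rintegral_set1.
have B0bound x t : 0 < x < 1 -> 0 <= t <= T -> `|B0 x t| <= K * T * (x * (1 - x)).
  move=> x01 /andP[t0 tT]; have /andP[x0 x1] := x01.
  have xx : 0 <= x * (1 - x) by apply: mulr_ge0; rewrite ?subr_ge0 ltW.
  have [->|tn0] := eqVneq t 0; first by rewrite B00 normr0 mulr_ge0// mulr_ge0// ltW.
  have tgt0 : 0 < t by rewrite lt_neqAle eq_sym tn0.
  have [] := @MVT_oo R (B0 x) (b x) 0 t tgt0.
  - apply: continuous_subspaceW (primitive_continuous (ltW T0) (cb _ x01)).
    by apply: subset_itvl; rewrite bnd_simp.
  - by move=> s /andP[s0 st]; apply: dB0t => //; rewrite s0 (lt_le_trans st).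
  move=> s /andP[s0 st]; rewrite B00 !subr0 => ->; rewrite normrM (gtr0_norm tgt0).
  rewrite mulrAC; apply: ler_pM => //; apply: bK => //.
  by rewrite (ltW s0) (le_trans (ltW st)).
have B0lip x t s : 0 < x < 1 -> 0 <= t <= T -> 0 <= s <= T -> `|B0 x t - B0 x s| <= K * `|t - s|.
  move=> x01; have /andP[x0 x1] := x01; wlog ts : t s / s < t.
    move=> W tT sT; have [ts|st|->] := ltgtP t s; last by rewrite !subrr normr0 mulr0.
      by rewrite distrC (distrC t); exact: W.
    exact: W.
  move=> /andP[t0 tT] /andP[s0 sT]; have [] := @MVT_oo R (B0 x) (b x) s t ts.
  - apply: continuous_subspaceW (primitive_continuous (ltW T0) (cb _ x01)).
    by move=> r /=; rewrite !in_itv/= => /andP[? ?]; apply/andP; split; lra.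
  - by move=> r /andP[? ?]; apply: dB0t => //; apply/andP; split; lra.
  move=> r /andP[? ?] ->; rewrite normrM ler_wpM2r//.
  have rT : 0 <= r <= T by apply/andP; split; lra.
  apply: le_trans (bK _ _ x01 rT) _; rewrite ler_piMr//; nra.
have dB0x x t : 0 < x < 1 -> 0 <= t <= T -> is_derive x 1 (B0 ^~ t) (a x t - a x 0).
  move=> x01 /andP[t0 tT]; have /andP[x0 x1] := x01.
  have [->|tn0] := eqVneq t 0.
    rewrite subrr; have -> : B0^~ 0 = cst 0 by apply/funext => y; rewrite B00.
    exact: is_derive_cst.
  have tgt0 : 0 < t by rewrite lt_neqAle eq_sym tn0.
  (* A compact neighbourhood of [x] inside (0, 1), on which [d] is bounded by a constant that
     dominates the integrand's derivative. *)
  pose u := x / 2; pose v := (x + 1) / 2.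
  have uv y : u <= y <= v -> 0 < y < 1.
    by rewrite /u /v => /andP[? ?]; apply/andP; split; lra.
  have xuv : `]u, v[%classic x by rewrite /= in_itv/= /u /v; apply/andP; split; lra.
  have [C HC] : exists C : R, forall y s, u <= y <= v -> 0 <= s <= T -> `|d y s| <= C.
    have cr : continuous_onD (rect u v T) d.
      by apply: continuous_onD_sub cd => -[y s] /= [/= /uv ? ?].
    have := continuous_compact cr (@compact_rect R u v T).
    move=> /compact_bounded [C [_ HC]]; exists (C + 1) => y s yuv sT.
    by apply: HC; [rewrite ltrDl|exists (y, s)].
  have E s : 0 <= s <= T -> partial1of2 b x s = d x s.
    by move=> sT; rewrite partial1of2E; have := dbx _ _ x01 sT => h; exact: derive_val.
  have cdx : {within `[0, t], continuous (d x)}.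
    move/continuous_onDP : cd => cd.
    apply/subspace_continuousP => s /=; rewrite in_itv/= => /andP[s0 st].
    have D : [set z : R * R | 0 < z.1 < 1 /\ 0 <= z.2 <= T] (x, s).
      by split => //=; rewrite s0 (le_trans st).
    apply: (@cvg_comp _ _ _ (fun s => (x, s)) (fun z => d z.1 z.2) _ _ _ _ (cd _ D)).
    move=> S; rewrite /within/= => HS.
    have ct : (x, y) @[y --> s] --> (x, s) by apply: cvg_to_pair; [exact: cvg_cst|exact: cvg_id].
    apply: (@filterS _ (nbhs s) _ _ _ _ (ct _ HS)) => y /= h yt; apply: h.
    by split => //=; move: yt; rewrite in_itv/= => /andP[-> yt]; rewrite (le_trans yt).
  have FTC : \int[mu]_(s in `[0, t]) d x s = a x t - a x 0.
    rewrite /Rintegral (@continuous_FTC2 _ (d x) (a x)) //.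
    - have cat := ca _ x01.
      have cat' : {within `[0, t], continuous (a x)}.
        by apply: continuous_subspaceW cat; apply: subset_itvl; rewrite bnd_simp.
      have [h1 h2 h3] := (continuous_within_itvP _ tgt0).1 cat'.
      split => // s; rewrite in_itv/= => /andP[s0 st].
      by apply: (@ex_derive _ _ _ _ _ _ _ (dat _ _ x01 _)); rewrite s0 (lt_le_trans st).
    - move=> s; rewrite in_itv/= => /andP[s0 st].
      have sT : 0 < s < T by rewrite s0 (lt_le_trans st).
      by rewrite derive1E; have h := dat _ _ x01 sT; exact: derive_val.
  have CC : 0 <= C.
    apply: le_trans (HC x 0 _ _) => //; last by rewrite lexx ltW.
    by rewrite /u /v; apply/andP; split; lra.
  have I : \int[mu]_(s in `[0, t]) partial1of2 b x s = a x t - a x 0.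
    rewrite -FTC; apply: eq_Rintegral => s; rewrite inE/= in_itv/= => /andP[s0 st].
    by apply: E; rewrite s0 (le_trans st).
  have H1 : forall y, `]u, v[%classic y -> mu.-integrable `[0, t] (EFin \o b y).
    move=> y; rewrite /= in_itv/= => /andP[/ltW uy /ltW yv].
    have y01 : 0 < y < 1 by apply: uv; rewrite uy.
    apply: continuous_integrable; apply: continuous_subspaceW (cb y y01).
    by apply: subset_itvl; rewrite bnd_simp.
  have H2 : forall y s, `]u, v[%classic y -> `[0, t]%classic s -> derivable (b ^~ s) y 1.
    move=> y s; rewrite /= !in_itv/= => /andP[/ltW uy /ltW yv] /andP[s0 st].
    apply: (@ex_derive _ _ _ _ _ _ _ (dbx y s _ _)); last by rewrite s0 (le_trans st).
    by apply: uv; rewrite uy.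
  have H3 : mu.-integrable `[0, t] (EFin \o cst C).
    by apply: continuous_integrable; apply: continuous_subspaceT; exact: cst_continuous.
  have H4 : forall y s, `]u, v[%classic y -> `[0, t]%classic s -> `|partial1of2 b y s| <= cst C s.
    move=> y s; rewrite /= !in_itv/= => /andP[/ltW uy /ltW yv] /andP[s0 st].
    have sT : 0 <= s <= T by rewrite s0 (le_trans st).
    have y01 : 0 < y < 1 by apply: uv; rewrite uy.
    rewrite partial1of2E; have h := dbx _ _ y01 sT; rewrite (@derive_val _ _ _ _ _ _ _ h).
    by apply: HC => //; rewrite uy.
  split.
    exact: (@derivable_under_integral _ _ _ mu b `[0, t] (measurable_itv _) x u v xuv H1 H2
      (cst C) (fun=> CC) H3 H4).
  rewrite -derive1E -I.
  exact: (@differentiation_under_integral _ _ _ mu b `[0, t] (measurable_itv _) x u v xuv H1 H2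
    (cst C) (fun=> CC) H3 H4).
exists (fun x t => A x + B x t).
have near01 x : 0 < x < 1 -> \forall y \near x, 0 < y < 1.
  move=> x01; have := @near_in_itvoo R 0 1 x; rewrite in_itv/= x01 => /(_ isT).
  by apply: filterS => y; rewrite in_itv.
have dBx x t : 0 < x < 1 -> 0 <= t <= T -> is_derive x 1 (B ^~ t) (a x t - a x 0).
  move=> x01 tT; apply: near_eq_is_derive (dB0x _ _ x01 tT) => //.
  by apply: filterS (near01 _ x01) => y y01; rewrite /B y01.
have Bbound x t : 0 <= x <= 1 -> 0 <= t <= T -> `|B x t| <= K * T * (x * (1 - x)).
  move=> /andP[x0 x1] tT; rewrite /B; case: ifPn => [x01|_]; first exact: B0bound.
  by rewrite normr0; apply: mulr_ge0; [apply: mulr_ge0 => //; exact: ltW|apply: mulr_ge0;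
    rewrite ?subr_ge0].
have B0t t : B 0 t = 0 by rewrite /B ltxx.
have B1t t : B 1 t = 0 by rewrite /B ltxx andbF.
split.
- apply: continuous_onDD.
    by apply: continuous_onD_space; exact: primitive_continuous.
  apply/continuous_onDP => -[x t] [/= /andP[x0 x1] tT].
  have cBx : B y t @[y --> within `[0, 1] (nbhs x)] --> B x t.
    have [x01|nx01] := boolP (0 < x < 1).
      apply: cvg_within_filter; exact: (is_derive_continuous (dBx _ _ x01 tT)).
    have xx : x * (1 - x) = 0.
      have : x * (1 - x) <= 0.
        by rewrite leNgt; apply: contra nx01 => ?; apply/andP; split; nra.
      by nra.
    have Bx0 : B x t = 0 by rewrite /B (negbTE nx01).
    rewrite Bx0; apply/cvgr0Pnorm_lt => e e0.
    have cb' : K * T * (y * (1 - y)) @[y --> within `[0, 1] (nbhs x)] --> K * T * (x * (1 - x)).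
      apply: cvg_within_filter; apply: cvgM; first exact: cvg_cst.
      by apply: cvgM; [exact: cvg_id|apply: cvgB; [exact: cvg_cst|exact: cvg_id]].
    rewrite xx mulr0 in cb'.
    have W : \forall y \near within `[0, 1] (nbhs x), `[0, 1]%classic y by exact: withinT.
    apply: filterS2 W (cvgr_lt _ cb' _ e0) => y yI.
    by apply: le_lt_trans; apply: Bbound => //; move: yI; rewrite /= in_itv.
  (* Joint continuity follows from continuity in space at the fixed time [t] and a Lipschitz bound
     in time that is uniform in space. *)
  have Blip y s : 0 <= s <= T -> `|B y t - B y s| <= K * `|t - s|.
    move=> sT; rewrite /B; case: ifPn => [y01|_]; first exact: B0lip.
    by rewrite subrr normr0 mulr_ge0.
  apply/cvgrPdist_lt => e e0; have e20 : 0 < e / 2 by rewrite divr_gt0.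
  have K1 : 0 < K + 1 by rewrite ltr_wpDl.
  have h1 : nbhs x [set y | `[0, 1]%classic y -> `|B x t - B y t| < e / 2].
    by have /cvgrPdist_lt /(_ _ e20) := cBx.
  exists ([set y | `[0, 1]%classic y -> `|B x t - B y t| < e / 2], ball t (e / 2 / (K + 1))).
    by split => //=; apply: nbhsx_ballx; rewrite divr_gt0.
  move=> -[y s] [/= Py Qs] [/= yI sT].
  have h2 : `|B x t - B y t| < e / 2 by apply: Py; rewrite /= in_itv.
  have h3 : K * `|t - s| < e / 2.
    have : `|t - s| * (K + 1) < e / 2 by rewrite -ltr_pdivlMr.
    by apply: le_lt_trans; rewrite mulrC ler_wpM2l// lerDl.
  have -> : B x t - B y s = (B x t - B y t) + (B y t - B y s) by ring.
  have h4 := Blip y s sT; have h5 := ler_normD (B x t - B y t) (B y t - B y s).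
  by clear - h2 h3 h4 h5; lra.
- move=> t tT; rewrite !B0t !B1t !addr0; split => //.
  by rewrite /A set_itv1 Rintegral_set1.
- move=> x t x01 tT.
  apply: is_derive_eq (is_deriveD (primitive_derive ca0 x01) (dBx _ _ x01 tT)) _.
  by rewrite addrC subrK.
- move=> x t x01 tT; have -> : (fun t => A x + B x t) = (fun t => cst (A x) t + B0 x t).
    by apply/funext => s; rewrite /B x01.
  by apply: is_derive_eq (is_deriveD (is_derive_cst _ _ _) (dB0t _ _ x01 tT)) _; rewrite add0r.
Qed.

End potential.

(** * From the free boundary problem to the normalized flow *)

Definition open_rect {R : realType} (T : R) : set (R * R) :=
  [set z | 0 < z.1 < 1 /\ 0 <= z.2 <= T].

Section moving_domain.
Context {R : realType} (T : R) (w1 w2 v1 v2 : R -> R).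
Implicit Types (f : R -> R -> R) (x t y : R).
Hypothesis w12 : forall t, 0 <= t <= T -> w1 t < w2 t.
Hypothesis dw1 : forall t, 0 <= t <= T ->
  diff_quot w1 t @ within `[0, T] t^' --> v1 t.
Hypothesis dw2 : forall t, 0 <= t <= T ->
  diff_quot w2 t @ within `[0, T] t^' --> v2 t.

Definition width t := w2 t - w1 t.
Definition position x t := w1 t + x * width t.
Definition grid_velocity x t := v1 t + x * (v2 t - v1 t).

Lemma width_gt0 t : 0 <= t <= T -> 0 < width t.
Proof. by move=> tT; rewrite subr_gt0 w12. Qed.

Lemma position_tube x t : 0 < x < 1 -> 0 <= t <= T -> tube T w1 w2 (position x t, t).
Proof.
move=> /andP[x0 x1] tT; split => //=; have := width_gt0 tT.
by rewrite /position /width => h; apply/andP; split; nra.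
Qed.

Lemma position_closed_tube x t : 0 <= x <= 1 -> 0 <= t <= T ->
  closed_tube T w1 w2 (position x t, t).
Proof.
move=> /andP[x0 x1] tT; split => //=; have := width_gt0 tT.
by rewrite /position /width => h; apply/andP; split; nra.
Qed.

Lemma position0 t : position 0 t = w1 t.
Proof. by rewrite /position mul0r addr0. Qed.

Lemma position1 t : position 1 t = w2 t.
Proof. by rewrite /position mul1r /width addrC subrK. Qed.

Let cw1 t : 0 <= t <= T -> w1 r @[r --> within `[0, T] (nbhs t)] --> w1 t.
Proof. by move=> tT; exact: diff_quot_continuous (dw1 tT). Qed.

Let cw2 t : 0 <= t <= T -> w2 r @[r --> within `[0, T] (nbhs t)] --> w2 t.
Proof. by move=> tT; exact: diff_quot_continuous (dw2 tT). Qed.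

Lemma continuous_onD_of_time (D : set (R * R)) (g : R -> R) :
  (forall z, D z -> 0 <= z.2 <= T) ->
  (forall t, 0 <= t <= T -> g r @[r --> within `[0, T] (nbhs t)] --> g t) ->
  continuous_onD D (fun _ => g).
Proof.
move=> DT cg; apply: (@continuous_onD_comp _ _ (fun _ t => t) g `[0, T]%classic).
- by move=> x t /DT /=; rewrite in_itv.
- by apply/subspace_continuousP => t; rewrite /= in_itv/=; exact: cg.
- by apply: continuous_subspaceT => z; exact: cvg_snd.
Qed.

Lemma continuous_onD_width (D : set (R * R)) : (forall z, D z -> 0 <= z.2 <= T) ->
  continuous_onD D (fun _ => width).
Proof. by move=> DT; apply: continuous_onD_of_time => // t tT; apply: cvgB; [exact: cw2|exact:
  cw1]. Qed.

Lemma continuous_onD_position (D E : set (R * R)) f :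
  (forall z, D z -> 0 <= z.2 <= T) ->
  (forall x t, D (x, t) -> E (position x t, t)) ->
  continuous_onD E f -> continuous_onD D (fun x t => f (position x t) t).
Proof.
move=> DT DE /continuous_onDP cf; apply/continuous_onDP => -[x t] Dxt /=.
have cp : continuous_onD D position.
  apply: continuous_onDD.
    by apply: continuous_onD_of_time => // s sT; exact: cw1.
  apply: continuous_onDM; last exact: continuous_onD_width.
  by apply: continuous_subspaceT => z; exact: cvg_fst.
apply: (@cvg_comp _ _ _ (fun z : R * R => (position z.1 z.2, z.2)) (fun z => f z.1 z.2) _
  (within E (nbhs (position x t, t)))); last by apply: (cf (_, _)); exact: DE.
move/continuous_onDP : cp => cp.
have FD : Filter (within D (nbhs (x, t))) by exact: within_filter.
have cp2 : (position z.1 z.2, z.2) @[z --> within D (nbhs (x, t))] --> (position x t, t).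
  apply: cvg_to_pair; first exact: (cp (x, t)).
  by apply: cvg_within_filter; exact: cvg_snd.
move=> A HA; have := cp2 _ HA.
have W : \forall z \near within D (nbhs (x, t)), D z by exact: withinT.
move=> H; apply: (@filterS2 _ (within D (nbhs (x, t))) _ _ _ _ _ W H) => -[y s] Dys /= h.
exact: h (DE _ _ Dys).
Qed.

Lemma continuous_onD_open f : continuous_onD (tube T w1 w2) f ->
  continuous_onD (open_rect T) (fun x t => f (position x t) t).
Proof.
apply: continuous_onD_position => [z []//|x t [x01 tT]]; exact: position_tube.
Qed.

Lemma continuous_onD_closed f : continuous_onD (closed_tube T w1 w2) f ->
  continuous_onD (rect 0 1 T) (fun x t => f (position x t) t).
Proof.
apply: continuous_onD_position => [z []//|x t [x01 tT]]; exact: position_closed_tube.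
Qed.

Lemma is_derive_position_x x t : is_derive x 1 (position ^~ t) (width t).
Proof.
have h := is_deriveM (is_derive_id x 1) (is_derive_cst (width t) x 1).
apply: is_derive_eq (is_deriveD (is_derive_cst (w1 t) x 1) h) _.
by rewrite /GRing.scale/= add0r mulr0 add0r mulr1.
Qed.

Lemma is_derive_width t : 0 < t < T -> is_derive t 1 width (v2 t - v1 t).
Proof.
move=> tT; have tT' : 0 <= t <= T by case/andP: tT => /ltW -> /ltW ->.
by apply: is_deriveB; [exact: diff_quot_is_derive (dw2 tT')|exact: diff_quot_is_derive (dw1 tT')].
Qed.

Lemma is_derive_position_t x t : 0 < t < T ->
  is_derive t 1 (position x) (grid_velocity x t).
Proof.
move=> tT; have tT' : 0 <= t <= T by case/andP: tT => /ltW -> /ltW ->.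
apply: is_deriveD (diff_quot_is_derive tT (dw1 tT')) (is_deriveZ x (is_derive_width tT)).
Qed.

Lemma dy1E f y t : dy 1 f y t = 'D_1 (f ^~ t) y.
Proof. by rewrite /dy derive1n1 derive1E. Qed.

Lemma is_derive_space f x t : derivable (f ^~ t) (position x t) 1 ->
  is_derive x 1 (fun x => f (position x t) t) (width t * dy 1 f (position x t) t).
Proof.
move=> df; rewrite mulrC dy1E.
exact: (@is_derive1_comp R (f ^~ t) (position ^~ t) x _ _ (derivableP df)
  (is_derive_position_x x t)).
Qed.

Lemma near_tube y t : 0 < t < T -> tube T w1 w2 (y, t) ->
  \forall z \near nbhs (y, t), tube T w1 w2 z.
Proof.
move=> tT [/= tT' /andP[wy yw]].
have c1 := is_derive_continuous (diff_quot_is_derive tT (dw1 tT')).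
have c2 := is_derive_continuous (diff_quot_is_derive tT (dw2 tT')).
pose e := (y - w1 t) / 2; pose e' := (w2 t - y) / 2.
have e0 : 0 < e by rewrite divr_gt0// subr_gt0.
have e'0 : 0 < e' by rewrite divr_gt0// subr_gt0.
have h1 : \forall r \near t, w1 r < y - e by apply: (cvgr_lt _ c1); rewrite /e; lra.
have h2 : \forall r \near t, y + e' < w2 r by apply: (cvgr_gt _ c2); rewrite /e'; lra.
have h3 : \forall r \near t, 0 < r < T.
  have := @near_in_itvoo R 0 T t; rewrite in_itv/= tT => /(_ isT).
  by apply: filterS => r; rewrite in_itv.
exists (ball y (Num.min e e'), [set r | [/\ w1 r < y - e, y + e' < w2 r & 0 < r < T]]).
  split => /=; first by apply: nbhsx_ballx; rewrite lt_min e0.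
  by apply: filterS3 h1 h2 h3 => r ? ? ?; split.
move=> -[x r] [/= xb [r1 r2 /andP[r0 rT]]]; split => /=; first by rewrite !ltW.
move: xb; rewrite /ball/= lt_min !ltr_norml => /andP[/andP[? ?] /andP[? ?]].
by apply/andP; split; lra.
Qed.

Lemma within_tube_cvg f y t : 0 < t < T -> tube T w1 w2 (y, t) ->
  continuous_onD (tube T w1 w2) f -> f z.1 z.2 @[z --> nbhs (y, t)] --> f y t.
Proof.
move=> tT D /continuous_onDP cf A HA.
have h : \forall z \near nbhs (y, t), tube T w1 w2 z -> A (f z.1 z.2) := cf _ D A HA.
by apply: filterS2 h (near_tube tT D) => z; apply.
Qed.

Lemma is_derive_time m f x t : (0 < m)%N -> space_time_C m T (tube T w1 w2) f ->
  0 < x < 1 -> 0 < t < T ->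
  is_derive t 1 (fun t => f (position x t) t)
    (dt T f (position x t) t + grid_velocity x t * dy 1 f (position x t) t).
Proof.
move=> m0 [df cf dft cft] x01 tT.
have tT' : 0 <= t <= T by case/andP: tT => /ltW -> /ltW ->.
have D := position_tube x01 tT'.
have dfx : is_derive t 1 (f (position x t)) (dt T f (position x t) t).
  exact: time_derivable_is_derive (dft _ _ D).
have near_df : \forall z \near nbhs ((position x t, t) : R * R),
    is_derive (z.1 : R) 1 (f ^~ z.2) (dy 1 f z.1 z.2).
  apply: filterS (near_tube tT D) => -[y s] Dys.
  by rewrite -[dy 1 f _ _]/(dy 1 f y s) dy1E; apply: derivableP; exact: (df 0%N).
have cdf : dy 1 f z.1 z.2 @[z --> nbhs ((position x t, t) : R * R)] --> dy 1 f (position x t) t.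
  exact: (within_tube_cvg tT D (cf 1%N m0)).
exact: (is_derive_along (is_derive_position_t x tT) dfx near_df cdf).
Qed.

End moving_domain.

Section continuity_extra.
Context {R : realType}.

Lemma continuous_onD_ext (D : set (R * R)) (f g : R -> R -> R) :
  (forall x t, D (x, t) -> f x t = g x t) -> continuous_onD D f -> continuous_onD D g.
Proof.
move=> fg /continuous_onDP cf; apply/continuous_onDP => -[x t] Dz /=.
rewrite -fg//; apply: cvg_trans (cf _ Dz); apply: near_eq_cvg.
have W : \forall z \near within D (nbhs (x, t)), D z by exact: withinT.
by apply: filterS W => -[y s] Dys /=; rewrite fg.
Qed.

Lemma continuous_on_pos (h dh : R -> R) : (forall x : R, 0 < x -> is_derive x 1 h (dh x)) ->
  {within `]0, +oo[%classic, continuous h}.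
Proof.
move=> dhx; apply: continuous_in_subspaceT => x; rewrite inE/= in_itv/= andbT => x0.
exact: is_derive_continuous (dhx _ x0).
Qed.

Lemma continuous_onD_ln (D : set (R * R)) (f : R -> R -> R) :
  (forall x t, D (x, t) -> 0 < f x t) -> continuous_onD D f ->
  continuous_onD D (fun x t => ln (f x t)).
Proof.
move=> f0; apply: (@continuous_onD_comp _ _ f _ `]0, +oo[%classic).
  by move=> x t /f0; rewrite /= in_itv/= andbT.
by apply: (@continuous_on_pos _ (fun x => x^-1)) => x; exact: is_derive1_ln.
Qed.

Lemma continuous_onD_powR (D : set (R * R)) (f : R -> R -> R) (a : R) :
  (forall x t, D (x, t) -> 0 < f x t) -> continuous_onD D f ->
  continuous_onD D (fun x t => f x t `^ a).
Proof.
move=> f0; apply: (@continuous_onD_comp _ _ f (fun x => x `^ a) `]0, +oo[%classic).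
  by move=> x t /f0; rewrite /= in_itv/= andbT.
by apply: (@continuous_on_pos _ (fun x => a * x `^ (a - 1))) => x; exact: is_derive1_powR.
Qed.

Lemma continuous_onD_bounded (a b T : R) (f : R -> R -> R) : continuous_onD (rect a b T) f ->
  exists2 K, 0 < K & forall x t, a <= x <= b -> 0 <= t <= T -> `|f x t| <= K.
Proof.
move=> cf; have := continuous_compact cf (@compact_rect R a b T).
move=> /compact_bounded [C [_ HC]]; exists (`|C| + 1); first by rewrite ltr_wpDl.
move=> x t xI tI; apply: HC; last by exists (x, t).
by have := ler_norm C; lra.
Qed.

(** Only a trace from inside is given, and [g a] may differ from it. The mean value theorem is
    therefore used on [[z, y]] with [|g z| < e], and [e] is arbitrary. *)
Lemma vanishing_left_bound (g dg : R -> R) (a b C y : R) :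
  (forall y : R, a < y < b -> is_derive y 1 g (dg y)) ->
  (forall y, a < y < b -> `|dg y| <= C) ->
  g y @[y --> a^'+] --> 0 -> a < y < b -> `|g y| <= C * (y - a).
Proof.
move=> dgy gC g0 /andP[ay yb].
have C0 : 0 <= C by apply: le_trans (gC y _); rewrite ?normr_ge0 ?ay.
apply/ler_addgt0Pr => e e0.
have /cvgr0Pnorm_lt /(_ _ e0) [d /= d0 Hd] := g0.
pose z := a + Num.min (d / 2) ((y - a) / 2).
have m0 : 0 < Num.min (d / 2) ((y - a) / 2) by rewrite lt_min !divr_gt0// subr_gt0.
have [m1 m2] : Num.min (d / 2) ((y - a) / 2) <= d / 2 /\ Num.min (d / 2) ((y - a) / 2) <=
  (y - a) / 2.
  by rewrite !ge_min !lexx orbT.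
have gz : `|g z| < e.
  by apply: Hd; rewrite /z; [rewrite /= opprD addNKr normrN gtr0_norm//; lra|lra].
have zy : z < y by rewrite /z; lra.
have az : a < z by rewrite /z; lra.
have [] := @MVT_oo R g dg z y zy.
- apply: derivable_within_continuous => x; rewrite in_itv/= => /andP[zx xy].
  by apply: (@ex_derive _ _ _ _ _ _ _ (dgy x _)); apply/andP; split; lra.
- by move=> x /andP[zx xy]; apply: dgy; apply/andP; split; lra.
move=> x /andP[zx xy] E.
have xab : a < x < b by apply/andP; split; lra.
have h1 : `|g y - g z| <= C * (y - z).
  by rewrite E normrM (gtr0_norm (x := y - z)) ?subr_gt0// ler_wpM2r ?gC// subr_ge0 ltW.
have h2 : C * (y - z) <= C * (y - a) by rewrite ler_wpM2l//; lra.
have := ler_normD (g y - g z) (g z); rewrite subrK; lra.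
Qed.

Lemma vanishing_right_bound (g dg : R -> R) (a b C y : R) :
  (forall y : R, a < y < b -> is_derive y 1 g (dg y)) ->
  (forall y, a < y < b -> `|dg y| <= C) ->
  g y @[y --> b^'-] --> 0 -> a < y < b -> `|g y| <= C * (b - y).
Proof.
move=> dgy gC g0 /andP[ay yb].
have C0 : 0 <= C by apply: le_trans (gC y _); rewrite ?normr_ge0 ?ay.
apply/ler_addgt0Pr => e e0.
have /cvgr0Pnorm_lt /(_ _ e0) [d /= d0 Hd] := g0.
pose z := b - Num.min (d / 2) ((b - y) / 2).
have m0 : 0 < Num.min (d / 2) ((b - y) / 2) by rewrite lt_min !divr_gt0// subr_gt0.
have [m1 m2] : Num.min (d / 2) ((b - y) / 2) <= d / 2 /\ Num.min (d / 2) ((b - y) / 2) <=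
  (b - y) / 2.
  by rewrite !ge_min !lexx orbT.
have gz : `|g z| < e.
  by apply: Hd; rewrite /z; [rewrite /= subKr gtr0_norm//; lra|lra].
have yz : y < z by rewrite /z; lra.
have zb : z < b by rewrite /z; lra.
have [] := @MVT_oo R g dg y z yz.
- apply: derivable_within_continuous => x; rewrite in_itv/= => /andP[zx xy].
  by apply: (@ex_derive _ _ _ _ _ _ _ (dgy x _)); apply/andP; split; lra.
- by move=> x /andP[zx xy]; apply: dgy; apply/andP; split; lra.
move=> x /andP[zx xy] E.
have xab : a < x < b by apply/andP; split; lra.
have h1 : `|g z - g y| <= C * (z - y).
  by rewrite E normrM (gtr0_norm (x := z - y)) ?subr_gt0// ler_wpM2r ?gC// subr_ge0 ltW.
have h2 : C * (z - y) <= C * (b - y) by rewrite ler_wpM2l//; lra.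
have := ler_normB (g z) (g z - g y); rewrite opprB addrC subrK; lra.
Qed.

Lemma min_le_bump (x : R) : 0 < x < 1 -> Num.min x (1 - x) <= 2 * (x * (1 - x)).
Proof.
move=> /andP[x0 x1]; rewrite minEle; case: ifPn => [xx|]; first nra.
by rewrite -ltNge => xx; nra.
Qed.

Lemma transport_derive_ln (c : R) (f : R -> R -> R) (x t d : R) : 0 < f x t ->
  transport_derive c f x t d -> transport_derive c (fun x t => ln (f x t)) x t (d / f x t).
Proof.
move=> f0 [fx [ft [dx dt <-]]]; exists ((f x t)^-1 * fx), ((f x t)^-1 * ft); split.
- exact: (@is_derive1_comp R (@ln R) (f ^~ t) x _ _ (is_derive1_ln f0) dx).
- exact: (@is_derive1_comp R (@ln R) (f x) t _ _ (is_derive1_ln f0) dt).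
- by ring.
Qed.

End continuity_extra.

(** * Consequences of the equations in Eulerian coordinates *)

Section flow.
Context {R : realType}.
Variables (mubar lambdabar alpha gamma Rg Abar T : R) (rho0 u0 theta0 w1 w2 : R -> R)
  (rho u theta s : R -> R -> R).
Hypotheses (T0 : 0 < T) (nubar0 : 0 < nubar mubar lambdabar) (gamma1 : 1 < gamma)
  (Rg0 : 0 < Rg) (Abar0 : 0 < Abar)
  (F : FBP mubar lambdabar alpha gamma Rg T rho0 u0 theta0 w1 w2 rho u theta)
  (E : is_entropy gamma Rg Abar T w1 w2 rho theta s)
  (C : regular_class T w1 w2 rho u theta s).
Implicit Types (y t x : R).

Local Notation tubeT := (tube T w1 w2).
Local Notation nu := (viscosity mubar lambdabar alpha theta).
Local Notation p := (pressure Rg rho theta).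

Lemma boundary_velocity1 t : 0 <= t <= T ->
  diff_quot w1 t @ within `[0, T] t^' --> u (w1 t) t.
Proof. by move=> /(FBP_kinematic F)[]. Qed.

Lemma boundary_velocity2 t : 0 <= t <= T ->
  diff_quot w2 t @ within `[0, T] t^' --> u (w2 t) t.
Proof. by move=> /(FBP_kinematic F)[]. Qed.

Lemma rho_gt0 y t : tubeT (y, t) -> 0 < rho y t.
Proof. by move=> /(FBP_positive F)[]. Qed.

Lemma theta_gt0 y t : tubeT (y, t) -> 0 < theta y t.
Proof. by move=> /(FBP_positive F)[]. Qed.

Lemma space_derive f m k y t : space_time_C m T tubeT f -> (k < m)%N -> tubeT (y, t) ->
  is_derive y 1 (dy k f ^~ t) (dy k.+1 f y t).
Proof.
move=> [df _ _ _] km D; have -> : dy k.+1 f y t = 'D_1 (dy k f ^~ t) y.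
  by rewrite /dy derive1nS -derive1E.
exact: derivableP (df _ _ _ km D).
Qed.

Lemma mass_balance y t : tubeT (y, t) ->
  dt T rho y t + u y t * dy 1 rho y t = - (rho y t * dy 1 u y t).
Proof.
move=> D; have := FBP_mass F D; rewrite dy1E.
have dr := space_derive (rho_C11 C) (ltn0Sn 0) D.
have du := space_derive (u_C21 C) (ltn0Sn 1) D.
have -> : (fun x => rho x t * u x t) = (rho ^~ t) * (u ^~ t) by [].
have := @derive_val _ _ _ _ _ _ _ (is_deriveM dr du).
rewrite /GRing.scale/= => -> h.
by apply/eqP; rewrite -subr_eq0 -h; apply/eqP; rewrite /dy/=; ring.
Qed.

Lemma pressure_gt0 y t : tubeT (y, t) -> 0 < p y t.
Proof. by move=> D; rewrite /pressure !mulr_gt0// ?rho_gt0// theta_gt0. Qed.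

(** The one-dimensional Cauchy stress. By the momentum equation its space derivative is [rho] times
    the material acceleration, which is bounded although p_y and (nu u_y)_y need not be
    separately. *)
Definition effective_stress y t := nu y t * dy 1 u y t - p y t.

Lemma is_derive_effective_stress y t : tubeT (y, t) ->
  is_derive y 1 (effective_stress ^~ t) (rho y t * (dt T u y t + u y t * dy 1 u y t)).
Proof.
move=> D.
have dr := space_derive (rho_C11 C) (ltn0Sn 0) D.
have dth := space_derive (theta_C11 C) (ltn0Sn 0) D.
have du := space_derive (u_C21 C) (ltnSn 1) D.
(* [dy 1] of the flux in the momentum equation is a genuine derivative only if the flux is
   derivable. This holds since [u] is C^2 in space and [theta] is C^1 and positive inside the
   tube. *)
have dnu : derivable (fun y => nu y t * dy 1 u y t) y 1.
  apply: derivableM; last exact: ex_derive.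
  apply: derivableM; first exact: derivable_cst.
  have h := @is_derive1_comp R (fun x => x `^ alpha) (theta ^~ t) y _ _
    (is_derive1_powR alpha (theta_gt0 D)) dth.
  exact: (@ex_derive _ _ _ _ _ _ _ h).
have dp : derivable (p ^~ t) y 1.
  apply: derivableM; last exact: (@ex_derive _ _ _ _ _ _ _ dth).
  by apply: derivableM; [exact: derivable_cst|exact: (@ex_derive _ _ _ _ _ _ _ dr)].
have := is_deriveB (derivableP dnu) (derivableP dp).
move=> h; apply: is_derive_eq h _.
by have := FBP_momentum F D; rewrite !dy1E => <-; ring.
Qed.

Lemma effective_stress_boundary t : 0 <= t <= T ->
  effective_stress y t @[y --> (w1 t)^'+] --> (0 : R) /\
  effective_stress y t @[y --> (w2 t)^'-] --> (0 : R).
Proof.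
move=> tT; have w12 := FBP_domain F tT.
have [f1 f2] := FBP_stress_free F tT; have [r1 r2 h1 h2] := FBP_vacuum F tT.
have slice f : continuous_onD (closed_tube T w1 w2) f -> {within `[w1 t, w2 t], continuous
  (f ^~ t)}.
  move=> /continuous_onDP cf; apply/subspace_continuousP => x /= xab.
  have h : closed_tube T w1 w2 (x, t) by split => //=; move: xab; rewrite in_itv.
  apply: (@cvg_comp _ _ _ (fun x => (x, t)) (fun z => f z.1 z.2) _ _ _ _ (cf _ h)).
  move=> A; rewrite /within/= => HA.
  have ct : (y, t) @[y --> x] --> (x, t) by apply: cvg_to_pair; [exact: cvg_id|exact: cvg_cst].
  apply: (@filterS _ (nbhs x) _ _ _ _ (ct _ HA)) => y /= h' yab; apply: h'.
  by split => //=; move: yab; rewrite in_itv.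
have [_ rl rr] := (continuous_within_itvP _ w12).1 (slice _ (rho_closure C)).
have [_ tl tr] := (continuous_within_itvP _ w12).1 (slice _ (theta_closure C)).
have e0 : 0 = 0 - Rg * 0 * 0 :> R by rewrite !mulr0 subr0.
split.
- rewrite [X in _ --> X]e0 -{2}r1 -{2}h1; apply: cvgB; first exact: f1.
  by apply: cvgM => //; apply: cvgM => //; exact: cvg_cst.
- rewrite [X in _ --> X]e0 -{2}r2 -{2}h2; apply: cvgB; first exact: f2.
  by apply: cvgM => //; apply: cvgM => //; exact: cvg_cst.
Qed.

(** The logarithm of the two expressions of the pressure: the combination used in the estimates is
    an affine function of the physical entropy [s], hence inherits its bound. *)
Lemma entropyE y t : tubeT (y, t) ->
  ln (theta y t) - (gamma - 1) * ln (rho y t) = ln (Abar / Rg) + s y t * (gamma - 1) / Rg.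
Proof.
move=> D; have r0 := rho_gt0 D; have t0 := theta_gt0 D.
have := congr1 (@ln R) (E D); rewrite /pressure.
rewrite !lnM ?posrE ?mulr_gt0 ?powR_gt0 ?expR_gt0 ?invr_gt0//.
by rewrite expRK ln_powR lnV ?posrE//; lra.
Qed.

Lemma state_bounded : exists2 K : R, 0 < K & forall y t, tubeT (y, t) ->
  [/\ `|u y t| <= K, `|dy 1 u y t| <= K, `|dt T u y t| <= K &
      `|ln (theta y t) - (gamma - 1) * ln (rho y t)| <= K].
Proof.
have c1 t : 0 <= t <= T -> w1 r @[r --> within `[0, T] (nbhs t)] --> w1 t.
  by move=> tT; exact: diff_quot_continuous (boundary_velocity1 tT).
have c2 t : 0 <= t <= T -> w2 r @[r --> within `[0, T] (nbhs t)] --> w2 t.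
  by move=> tT; exact: diff_quot_continuous (boundary_velocity2 tT).
have [_ cu _ cut] := u_C21 C.
have [_ cr _ _] := rho_C11 C; have [_ ct _ _] := theta_C11 C.
(* The class gives [s] only an essential bound. Its continuity, needed to make the bound pointwise,
   is read off from [rho] and [theta] through [entropyE]. *)
have cs : continuous_onD tubeT s.
  apply: (@continuous_onD_ext _ _ (fun y t => (ln (theta y t) + - ((gamma - 1) * ln
    (rho y t)) + - ln (Abar / Rg)) * (Rg / (gamma - 1)))).
    move=> y t D; rewrite (entropyE D); field.
    by rewrite gt_eqF ?subr_gt0// gt_eqF.
  apply: continuous_onDM; last exact: continuous_onD_cst.
  apply: continuous_onDD; last exact: continuous_onD_cst.
  apply: continuous_onDD; first by apply: continuous_onD_ln (ct 0%N _) => // y t; exact: theta_gt0.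
  apply: continuous_onDN; apply: continuous_onDM; first exact: continuous_onD_cst.
  by apply: continuous_onD_ln (cr 0%N _) => // y t; exact: rho_gt0.
have [K1 H1] := in_Linfty_bounded T0 c1 c2 (cu 0%N isT) (u_W2infty C (leq0n 2)).
have [K2 H2] := in_Linfty_bounded T0 c1 c2 (cu 1%N isT) (@u_W2infty _ _ _ _ _ _ _ _ C 1%N isT).
have [K3 H3] := in_Linfty_bounded T0 c1 c2 cut (ut_Linfty C).
have [K4 H4] := in_Linfty_bounded T0 c1 c2 cs (s_Linfty C).
pose K5 := `|ln (Abar / Rg)| + K4 * ((gamma - 1) / Rg).
have := (ler_norm K1, ler_norm K2, ler_norm K3, ler_norm K5).
have := (normr_ge0 K1, normr_ge0 K2, normr_ge0 K3, normr_ge0 K5).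
move=> [[[? ?] ?] ?] [[[? ?] ?] ?].
exists (1 + `|K1| + `|K2| + `|K3| + `|K5|); first lra.
move=> y t D; split.
- by apply: le_trans (H1 _ _ D) _; lra.
- by apply: le_trans (H2 _ _ D) _; lra.
- by apply: le_trans (H3 _ _ D) _; lra.
- rewrite (entropyE D); apply: (@le_trans _ _ K5); last by lra.
  apply: le_trans (ler_normD _ _) _; rewrite lerD2l -mulrA normrM.
  have gR : 0 < (gamma - 1) / Rg by rewrite divr_gt0// subr_gt0.
  by rewrite (gtr0_norm gR) ler_wpM2r ?H4// ltW.
Qed.

End flow.

(** * Constitutive laws, the initial density and the exponents *)

Section constitutive.
Context {R : realType}.

(** Bounded entropy means that th is comparable to r^(gamma - 1). So nu is comparable to r^a with a
    = alpha (gamma - 1) <= 1, hence at least a multiple of r for bounded r. The product nu p is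
    comparable to r^(gamma + a), whose half exponent is [m]. Finally p, comparable to r^gamma, is at
    most a multiple of r^m because m <= gamma. *)
Lemma constitutive_bounds (nb Rg alpha gamma S Kr : R) : 0 < nb -> 0 < Rg ->
  1 < gamma -> 0 <= alpha -> alpha * (gamma - 1) <= 1 -> 0 < Kr ->
  let m := (gamma + alpha * (gamma - 1)) / 2 in
  exists2 k, 0 < k & exists2 K, 0 < K & forall r th : R, 0 < r -> r <= Kr -> 0 < th ->
    `|ln th - (gamma - 1) * ln r| <= S ->
    [/\ k * r <= nb * th `^ alpha, (nb * th `^ alpha) * (Rg * r * th) <= K * (r `^ m) ^+ 2 &
        Rg * r * th <= K * r `^ m].
Proof.
move=> nb0 Rg0 g1 al0; set a := alpha * (gamma - 1) => a1 Kr0 m.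
have a0 : 0 <= a by rewrite mulr_ge0// subr_ge0 ltW.
have gm : 0 <= gamma - m by rewrite /m; lra.
pose k := nb * expR (- (alpha * S)) / Kr `^ (1 - a).
pose K1 := nb * Rg * expR ((1 + alpha) * S).
pose K2 := Rg * expR S * Kr `^ (gamma - m).
have k0 : 0 < k by apply: divr_gt0; [rewrite mulr_gt0// expR_gt0|rewrite powR_gt0].
have K10 : 0 < K1 by apply: mulr_gt0; [exact: mulr_gt0|exact: expR_gt0].
have K20 : 0 < K2 by apply: mulr_gt0; [rewrite mulr_gt0// expR_gt0|rewrite powR_gt0].
exists k => //; exists (K1 + K2); first exact: addr_gt0.
move=> r th r0 rK th0; set sg := ln th - _ => sgS.
have rn0 : r != 0 by rewrite gt_eqF.
have thE : th = expR sg * r `^ (gamma - 1).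
  by rewrite /powR (negbTE rn0) -expRD /sg subrK lnK// posrE.
have thaE : th `^ alpha = expR (alpha * sg) * r `^ a.
  rewrite [LHS]/powR gt_eqF// /powR (negbTE rn0) -expRD; congr expR.
  by rewrite /sg /a; ring.
have [sg1 sg2] : - S <= sg /\ sg <= S by move: sgS; rewrite ler_norml => /andP.
have rpow (b e : R) : r `^ b * r `^ e = r `^ (b + e) by rewrite powRD// rn0 implybT.
have rr : r * r `^ (gamma - 1) = r `^ gamma.
  by rewrite -{1}(powRr1 (ltW r0)) rpow; congr (r `^ _); ring.
have mono (x y e : R) : 0 <= e -> 0 <= x -> x <= y -> x `^ e <= y `^ e.
  by move=> e0 x0 xy; apply: ge0_ler_powR; rewrite ?nnegrE// (le_trans x0).
have hp : Rg * r * th = Rg * expR sg * r `^ gamma by rewrite {1}thE -rr; ring.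
split.
- have h1 : r <= r `^ a * Kr `^ (1 - a).
    have e1 : r = r `^ a * r `^ (1 - a) by rewrite rpow addrC subrK powRr1// ltW.
    by rewrite {1}e1 ler_pM2l ?powR_gt0// mono// ?subr_ge0// ltW.
  rewrite /k mulrAC ler_pdivrMr ?powR_gt0// thaE.
  have -> : nb * (expR (alpha * sg) * r `^ a) * Kr `^ (1 - a) =
     nb * expR (alpha * sg) * (r `^ a * Kr `^ (1 - a)) by ring.
  apply: ler_pM => //; [by rewrite mulr_ge0 ?expR_ge0// ltW|exact: ltW|].
  rewrite ler_pM2l// ler_expR -mulrN; exact: ler_wpM2l.
- have -> : nb * th `^ alpha * (Rg * r * th) = nb * Rg * expR ((1 + alpha) * sg) * (r `^ m) ^+ 2.
    rewrite hp thaE expr2 rpow (_ : m + m = a + gamma); last by rewrite /m; field.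
    have e3 : expR ((1 + alpha) * sg) = expR sg * expR (alpha * sg) by rewrite mulrDl mul1r expRD.
    by rewrite -rpow e3; ring.
  rewrite ler_wpM2r ?sqr_ge0//; apply: (@le_trans _ _ K1); last by rewrite lerDl ltW.
  by rewrite ler_pM2l ?mulr_gt0// ler_expR ler_wpM2l// addr_ge0.
- have e2 : r `^ gamma = r `^ (gamma - m) * r `^ m by rewrite rpow subrK.
  rewrite hp e2 mulrA ler_wpM2r ?powR_ge0//.
  apply: (@le_trans _ _ K2); last by rewrite lerDr ltW.
  apply: ler_pM; rewrite ?powR_ge0//.
  + by rewrite mulr_ge0 ?expR_ge0// ltW.
  + by rewrite ler_pM2l// ler_expR.
  + by rewrite mono// ltW.
Qed.

(** Near the ends [bdist x] is comparable to [x * (1 - x)] and the profile applies. Elsewhere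
    compactness provides a positive minimum and an upper bound, through a continuous [g] that agrees
    with [r] inside. *)
Lemma density_profile_bounds (C1 C2 delta : R) (r g : R -> R) : 0 < C1 -> 0 < delta ->
  density_profile C1 C2 delta r -> (forall x, 0 < x < 1 -> 0 < r x) ->
  {within `[0, 1], continuous g} -> (forall x, 0 < x < 1 -> g x = r x) ->
  exists2 k, 0 < k & exists2 K, 0 < K & forall x, 0 < x < 1 ->
    k * (x * (1 - x)) `^ delta <= r x <= K * (x * (1 - x)) `^ delta.
Proof.
move=> C10 d0 [e e0 prof] r0 cg gr.
have [Kr Kr0 rK] : exists2 Kr, 0 < Kr & forall x, 0 < x < 1 -> `|r x| <= Kr.
  have [K K0 HK] := @continuous_onD_bounded _ 0 1 0 (fun x _ => g x) (continuous_onD_space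
    (T := 0) cg).
  exists K => // x x01; rewrite -gr//; apply: (HK x 0); last by rewrite lexx.
  by case/andP: x01 => /ltW -> /ltW ->.
have [m m0 rm] : exists2 m, 0 < m & forall x, 0 < x < 1 -> e <= bdist x -> m <= r x.
  have [e2|e2] := leP e (1 / 2); last first.
    (* For [e > 1 / 2] no point has distance at least [e] to the ends, so any positive value
       serves. *)
    exists 1 => // x /andP[x0 x1]; rewrite /bdist le_min => /andP[? ?]; lra.
  have ee : e <= 1 - e by lra.
  have [|z zI Hz] := EVT_min ee (f := g).
    apply: continuous_subspaceW cg => x /=; rewrite !in_itv/= => /andP[? ?].
    by apply/andP; split; lra.
  have z01 : 0 < z < 1 by move: zI; rewrite in_itv/= => /andP[? ?]; apply/andP; split; lra.
  exists (g z); first by rewrite gr// r0.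
  move=> x x01; rewrite /bdist le_min => /andP[? ?]; rewrite -gr//; apply: Hz.
  by rewrite in_itv/=; apply/andP; split; lra.
pose E := (e / 2) `^ delta.
have E0 : 0 < E by rewrite powR_gt0// divr_gt0.
pose D := 2 `^ delta : R.
have D0 : 0 < D by rewrite powR_gt0.
have mono (x y : R) : 0 <= x -> x <= y -> x `^ delta <= y `^ delta.
  by move=> x0 xy; apply: ge0_ler_powR; rewrite ?nnegrE ?(ltW d0)// (le_trans x0).
exists (Num.min C1^-1 m); first by rewrite lt_min invr_gt0 C10.
have KE : 0 < Kr / E by exact: divr_gt0.
have CD : 0 < C1 * D by exact: mulr_gt0.
exists (C1 * D + Kr / E); first exact: addr_gt0.
move=> x x01; have /andP[x0 x1] := x01.
have b0 : 0 < x * (1 - x) by rewrite mulr_gt0// subr_gt0.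
have bx : x * (1 - x) <= bdist x by rewrite /bdist le_min; apply/andP; split; nra.
have bx2 : bdist x <= 2 * (x * (1 - x)) by exact: min_le_bump.
have P0 : 0 < (x * (1 - x)) `^ delta by exact: powR_gt0.
have [xe|xe] := ltP (bdist x) e.
- have [/andP[p1 p2] _ _] := prof _ x01 xe.
  have q1 := mono _ _ (ltW b0) bx.
  have q2 : bdist x `^ delta <= D * (x * (1 - x)) `^ delta.
    rewrite /D -powRM ?(ltW b0)//; apply: mono bx2; exact: le_trans (ltW b0) bx.
  apply/andP; split.
  + apply: le_trans (ltW p1); apply: ler_pM => //; rewrite ?(ltW P0)//.
      by rewrite le_min invr_ge0 !ltW.
    by rewrite ge_min lexx.
  + apply: (le_trans (ltW p2)); apply: (@le_trans _ _ (C1 * (D * (x * (1 - x)) `^ delta))).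
      by rewrite ler_pM2l.
    by rewrite mulrA ler_pM2r// lerDl ltW.
- apply/andP; split.
  + apply: le_trans (rm _ x01 xe); apply: (@le_trans _ _ (m * 1)); last by rewrite mulr1.
    apply: ler_pM; rewrite ?(ltW P0)//.
    * by rewrite le_min invr_ge0 !ltW.
    * by rewrite ge_min lexx orbT.
    * have := mono _ 1 (ltW b0); rewrite powR1; apply; nra.
  + have h : E <= (x * (1 - x)) `^ delta by apply: mono; [rewrite divr_ge0// ltW|lra].
    apply: (@le_trans _ _ Kr); first by exact: le_trans (ler_norm _) (rK _ x01).
    apply: (@le_trans _ _ (Kr / E * (x * (1 - x)) `^ delta)).
      by rewrite mulrAC ler_pdivlMr// ler_pM2l.
    by rewrite ler_pM2r// lerDr ltW.
Qed.

End constitutive.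

Section parameters.
Context {R : realType}.

Lemma sum_upper_bounds (a b c d : R) : 0 <= a -> 0 <= b -> 0 <= c -> 0 <= d ->
  let M := 4 * a + b + c + d in
  [/\ a <= M, 4 * a <= M, b <= M, c <= M & d <= M].
Proof. by move=> ? ? ? ? M; split; rewrite /M; lra. Qed.

(** Multiplied by [2 * delta * (gamma - 1)], the hypothesis reads 2 < delta (gamma - 2 + alpha
    (gamma - 1)), which is the conclusion rearranged. *)
Lemma exponent_condition (alpha gamma delta : R) : 1 < gamma -> 0 < delta ->
  1 / (delta * (gamma - 1)) < 1 / 2 * ((gamma - 2) / (gamma - 1) + alpha) ->
  delta + 1 < delta * ((gamma + alpha * (gamma - 1)) / 2).
Proof.
move=> gamma1 delta0 cond; have g0 : 0 < gamma - 1 by rewrite subr_gt0.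
have : 1 / (delta * (gamma - 1)) * (2 * delta * (gamma - 1)) <
   1 / 2 * ((gamma - 2) / (gamma - 1) + alpha) * (2 * delta * (gamma - 1)).
  by rewrite ltr_pM2r// !mulr_gt0.
have -> : 1 / (delta * (gamma - 1)) * (2 * delta * (gamma - 1)) = 2.
  by field; rewrite !gt_eqF.
have -> : 1 / 2 * ((gamma - 2) / (gamma - 1) + alpha) * (2 * delta * (gamma - 1)) =
   delta * (gamma - 2 + alpha * (gamma - 1)) by field; rewrite gt_eqF.
by lra.
Qed.

End parameters.

(** * Pull-back of a solution to the fixed interval *)

Section normalization.
Context {R : realType}.
Variables (mubar lambdabar alpha gamma Rg Abar delta T C1 C2 : R)
  (rho0 u0 theta0 w1 w2 : R -> R) (rho u theta s : R -> R -> R).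
Hypotheses (T0 : 0 < T) (nubar0 : 0 < nubar mubar lambdabar) (gamma1 : 1 < gamma)
  (Rg0 : 0 < Rg) (Abar0 : 0 < Abar)
  (F : FBP mubar lambdabar alpha gamma Rg T rho0 u0 theta0 w1 w2 rho u theta)
  (E : is_entropy gamma Rg Abar T w1 w2 rho theta s)
  (C : regular_class T w1 w2 rho u theta s).
Implicit Types (y t x : R) (f : R -> R -> R).

Let tubeT := tube T w1 w2.
Let nu := viscosity mubar lambdabar alpha theta.
Let p := pressure Rg rho theta.
Let G := effective_stress mubar lambdabar alpha Rg rho u theta.
Let dw1 := boundary_velocity1 F.
Let dw2 := boundary_velocity2 F.
Let w12 := FBP_domain F.
Let L := width w1 w2.
Let X := position w1 w2.
Let V := grid_velocity (fun t => u (w1 t) t) (fun t => u (w2 t) t).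
Let L' t := u (w2 t) t - u (w1 t) t.
Let pb f x t := f (X x t) t.

Lemma position_initial x : X x 0 = x.
Proof. by have [h1 h2] := FBP_domain0 F; rewrite /X /position /width h1 h2 add0r subr0 mulr1. Qed.

Let c0 f : continuous_onD (closed_tube T w1 w2) f -> continuous_onD (rect 0 1 T) (pb f).
Proof. exact: (continuous_onD_closed w12 dw1 dw2). Qed.

Let co f : continuous_onD tubeT f -> continuous_onD (open_rect T) (pb f).
Proof. exact: (continuous_onD_open w12 dw1 dw2). Qed.

Let tubeX x t : 0 < x < 1 -> 0 <= t <= T -> tubeT (X x t, t).
Proof. exact: (position_tube w12). Qed.

Let c_rho := c0 (rho_closure C).
Let c_theta := c0 (theta_closure C).
Let c_u := c0 (u_closure C).

Let open_rect_time z : open_rect T z -> 0 <= z.2 <= T. Proof. by case. Qed.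
Let rect_time a b z : rect a b T z -> 0 <= z.2 <= T. Proof. by case. Qed.

Let open_rect_sub : open_rect T `<=` rect 0 1 T.
Proof. by move=> [x t] [/= /andP[/ltW x0 /ltW x1] tT]; split => //=; rewrite x0. Qed.

Let cL (D : set (R * R)) : (forall z, D z -> 0 <= z.2 <= T) -> continuous_onD D (fun _ => L).
Proof. exact: (continuous_onD_width dw1 dw2). Qed.

Let cv1 t : 0 <= t <= T -> u (w1 r) r @[r --> within `[0, T] (nbhs t)] --> u (w1 t) t.
Proof.
have x01 : 0 <= (0 : R) <= 1 by rewrite lexx ler01.
move=> tT; have /subspace_continuousP := continuous_onD_slice_t c_u x01.
move=> /(_ t); rewrite /= in_itv/= => /(_ tT).
by have -> : pb u 0 = (fun r => u (w1 r) r) by apply/funext => r; rewrite /pb /X position0.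
Qed.

Let cv2 t : 0 <= t <= T -> u (w2 r) r @[r --> within `[0, T] (nbhs t)] --> u (w2 t) t.
Proof.
have x01 : 0 <= (1 : R) <= 1 by rewrite lexx ler01.
move=> tT; have /subspace_continuousP := continuous_onD_slice_t c_u x01.
move=> /(_ t); rewrite /= in_itv/= => /(_ tT).
by have -> : pb u 1 = (fun r => u (w2 r) r) by apply/funext => r; rewrite /pb /X position1.
Qed.

Let cL' (D : set (R * R)) : (forall z, D z -> 0 <= z.2 <= T) -> continuous_onD D (fun _ => L').
Proof. by move=> DT; apply: continuous_onD_of_time DT _ => t tT; apply: cvgB; [exact: cv2|exact:
  cv1]. Qed.

Let cV (D : set (R * R)) : (forall z, D z -> 0 <= z.2 <= T) -> continuous_onD D V.
Proof.
move=> DT; apply: continuous_onDD; first exact: continuous_onD_of_time DT cv1.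
apply: continuous_onDM; last exact: cL'.
by apply: continuous_subspaceT => z; exact: cvg_fst.
Qed.

Let L_gt0 t : 0 <= t <= T -> 0 < L t. Proof. exact: (width_gt0 w12). Qed.

Let dxf m k f x t : space_time_C m T tubeT f -> (k < m)%N -> 0 < x < 1 -> 0 <= t <= T ->
  is_derive x 1 (pb (dy k f) ^~ t) (L t * pb (dy k.+1 f) x t).
Proof.
move=> sf km x01 tT; have D := tubeX x01 tT.
have := @is_derive_space R w1 w2 (dy k f) x t (@ex_derive _ _ _ _ _ _ _ (space_derive sf km D)).
rewrite dy1E (@derive_val _ _ _ _ _ _ _ (space_derive sf km D)); exact.
Qed.

Let dtf m f x t : (0 < m)%N -> space_time_C m T tubeT f -> 0 < x < 1 -> 0 < t < T ->
  is_derive t 1 (pb f x) (pb (dt T f) x t + V x t * pb (dy 1 f) x t).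
Proof. exact: (is_derive_time w12 dw1 dw2). Qed.

Let dVx x t : is_derive x 1 (V ^~ t) (L' t).
Proof.
have h := is_deriveM (is_derive_id x 1) (is_derive_cst (L' t) x 1).
apply: is_derive_eq (is_deriveD (is_derive_cst (u (w1 t) t) x 1) h) _.
by rewrite /GRing.scale/= add0r mulr0 add0r mulr1.
Qed.

Let timeW t : 0 < t < T -> 0 <= t <= T.
Proof. by move=> /andP[/ltW -> /ltW ->]. Qed.

Let c x t := (pb u x t - V x t) / L t.

Let cLE x t : 0 <= t <= T -> c x t * L t = pb u x t - V x t.
Proof. by move=> tT; rewrite /c divfK// gt_eqF// L_gt0. Qed.

(** The grid velocity [V] enters once through the moving point and once, with the opposite sign,
    through [c]. The two cancel and leave the material derivative f_t + u f_y. *)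
Let transport_pb m f x t : (0 < m)%N -> space_time_C m T tubeT f -> 0 < x < 1 -> 0 < t < T ->
  transport_derive (c x t) (pb f) x t (pb (dt T f) x t + pb u x t * pb (dy 1 f) x t).
Proof.
move=> m0 sf x01 tT.
exists (L t * pb (dy 1 f) x t), (pb (dt T f) x t + V x t * pb (dy 1 f) x t); split.
- exact: (@dxf m 0 f x t sf m0 x01 (timeW tT)).
- exact: dtf m0 sf x01 tT.
- by rewrite mulrA cLE ?timeW//; ring.
Qed.

Lemma transport_density x t : 0 < x < 1 -> 0 < t < T ->
  transport_derive (c x t) (pb rho) x t (- (pb rho x t * pb (dy 1 u) x t)).
Proof.
move=> x01 tT; apply: transport_derive_eq (transport_pb (ltn0Sn 0) (rho_C11 C) x01 tT) _.
exact: (mass_balance F C (tubeX x01 (timeW tT))).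
Qed.

Let sg x t := ln (pb theta x t) - (gamma - 1) * ln (pb rho x t).

(** The energy equation divided by p is combined with the mass equation divided by rho. The pressure
    work then cancels against the compression term, and only viscous heating remains. *)
Lemma transport_entropy x t : 0 < x < 1 -> 0 < t < T ->
  transport_derive (c x t) sg x t
    ((gamma - 1) * (pb nu x t * pb (dy 1 u) x t ^+ 2 / pb p x t)).
Proof.
move=> x01 tT; have D := tubeX x01 (timeW tT).
have r0 := rho_gt0 F D; have th0 := theta_gt0 F D.
have dr := transport_derive_ln r0 (transport_density x01 tT).
have dth := transport_derive_ln th0 (transport_pb (ltn0Sn 0) (theta_C11 C) x01 tT).
have dc : transport_derive (c x t) (fun _ _ => gamma - 1) x t 0.
  by apply: transport_derive_time; exact: is_derive_cst.
apply: transport_derive_eq (transport_deriveD dth (transport_deriveN (transport_deriveM dc dr))) _.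
have en := FBP_energy F D; rewrite /c_v in en.
have g0 : gamma - 1 != 0 by rewrite gt_eqF// subr_gt0.
have p0 := pressure_gt0 Rg0 F D.
rewrite /pb -/X -/nu -/p in en p0 *.
have e : dt T theta (X x t) t + u (X x t) t * dy 1 theta (X x t) t =
  (nu (X x t) t * dy 1 u (X x t) t ^+ 2 - p (X x t) t * dy 1 u (X x t) t) *
  (gamma - 1) / (Rg * rho (X x t) t).
  rewrite -en; field.
  by rewrite g0 !gt_eqF.
rewrite e /p /pressure; field.
by rewrite !gt_eqF.
Qed.

Let r2 (D : set (R * R)) f : D `<=` rect 0 1 T -> continuous_onD
  (rect 0 1 T) f -> continuous_onD D f.
Proof. by move=> DE; exact: continuous_onD_sub. Qed.

Let slice_open f x : 0 < x < 1 -> continuous_onD (open_rect T) f ->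
  {within `[0, T], continuous (f x)}.
Proof.
move=> x01 cf; have xx : x <= x <= x by rewrite lexx.
apply: continuous_onD_slice_t xx; apply: continuous_onD_sub cf.
move=> [y t] [/= yx tT]; split => //=.
by have -> : y = x by apply/eqP; rewrite eq_le andbC.
Qed.

Let c_rho_o := r2 open_rect_sub c_rho.
Let c_u_o := r2 open_rect_sub c_u.
Let cL_o := cL open_rect_time.
Let cL'_o := cL' open_rect_time.
Let cV_o := cV open_rect_time.

(** [V] interpolates linearly between the velocities of the end points, so [u - V] vanishes at both
    ends, and |u - V| <= 2 L K min(x, 1 - x). A second factor 2 comes from [min_le_bump], and the
    width cancels on division by [L]. *)
Lemma relative_velocity_bound (K : R) : (forall y t, tubeT (y, t) -> `|dy 1 u y t| <= K) ->
  forall x t, 0 < x < 1 -> 0 <= t <= T -> `|c x t| <= 4 * K * (x * (1 - x)).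
Proof.
move=> uK x t x01 tT; have L0 := L_gt0 tT; have /andP[x0 x1] := x01.
have K0 : 0 <= K by apply: le_trans (uK _ _ (tubeX x01 tT)).
have diff a b : 0 <= a -> a < b -> b <= 1 -> `|pb u b t - pb u a t| <= L t * K * (b - a).
  move=> a0 ab b1; have [] := @MVT_oo R (pb u ^~ t) (fun x => L t * pb (dy 1 u) x t) a b ab.
  - apply: continuous_subspaceW (continuous_onD_slice_x c_u tT) => z.
    by rewrite /= !in_itv/= => /andP[? ?]; apply/andP; split; lra.
  - move=> z /andP[za zb]; apply: (dxf (u_C21 C) (ltn0Sn 1)) => //.
    by apply/andP; split; lra.
  move=> z /andP[za zb] ->; rewrite normrM (gtr0_norm (x := b - a)) ?subr_gt0//.
  rewrite ler_pM2r ?subr_gt0// normrM (gtr0_norm L0) ler_pM2l// uK//.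
  by apply: tubeX => //; apply/andP; split; lra.
have d1 := diff 0 1 (lexx _) ltr01 (lexx _).
have d2 := diff 0 x (lexx _) x0 (ltW x1).
have d3 := diff x 1 (ltW x0) x1 (lexx _).
have u0E : pb u 0 t = u (w1 t) t by rewrite /pb /X position0.
have u1E : pb u 1 t = u (w2 t) t by rewrite /pb /X position1.
rewrite subr0 mulr1 in d1; rewrite subr0 in d2.
have VE : V x t = pb u 0 t + x * (pb u 1 t - pb u 0 t) by rewrite u0E u1E.
suff h : `|pb u x t - V x t| <= 2 * (L t * K) * Num.min x (1 - x).
  rewrite /c normrM normfV (gtr0_norm L0) ler_pdivrMr//; apply: (le_trans h).
  have LK : 0 <= 2 * (L t * K) by rewrite !mulr_ge0// ltW.
  by have := ler_wpM2l LK (min_le_bump x01); lra.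
have LK0 : 0 <= L t * K by rewrite mulr_ge0// ltW.
move: d1 d2 d3; rewrite VE; move: (pb u x t) (pb u 0 t) (pb u 1 t) (L t * K) LK0 => ux ua ub D D0.
rewrite !ler_norml => /andP[? ?] /andP[? ?] /andP[? ?].
by rewrite minEle; case: ifPn => _; apply/andP; split; nra.
Qed.

Let cr k := let: And4 _ h _ _ := rho_C11 C in h k.
Let cu k := let: And4 _ h _ _ := u_C21 C in h k.
Let crt := let: And4 _ _ _ h := rho_C11 C in h.
Let cut := let: And4 _ _ _ h := u_C21 C in h.

(** The closedness required by [exact_potential] is the mass equation in conservative form on the
    fixed interval: the time derivative of L rho plus the space derivative of c L rho is zero. *)
Lemma mass_potential : exists N : R -> R -> R,
  [/\ continuous_onD (rect 0 1 T) N,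
    forall t, 0 <= t <= T -> N 0 t = 0 /\ N 1 t = N 1 0,
    forall x t, 0 < x < 1 -> 0 <= t <= T -> is_derive x 1 (N ^~ t) (L t * pb rho x t) &
    forall x t, 0 < x < 1 -> 0 < t < T ->
      is_derive t 1 (N x) (- (c x t * (L t * pb rho x t)))].
Proof.
have [K K0 HK] := state_bounded T0 gamma1 Rg0 Abar0 F E C.
have [Kr Kr0 rK] := continuous_onD_bounded c_rho.
have [KL KL0 LK] := continuous_onD_bounded (cL (@rect_time 0 1)).
have cK := relative_velocity_bound (fun y t D => let: And4 _ h _ _ := HK y t D in h).
have bE x t : 0 <= t <= T -> - (c x t * (L t * pb rho x t)) = - ((pb u x t - V x t) * pb rho x t).
  by move=> tT; rewrite mulrA cLE.
have z0 : (0 : R) <= 0 <= T by rewrite lexx ltW.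
have x00 : 0 <= (0 : R) <= 1 by rewrite lexx ler01.
(* The time derivative of [L t * pb rho x t], expanded so that its continuity on the open rectangle
   is visible. *)
pose d x t := L' t * pb rho x t + L t * (pb (dt T rho) x t + V x t * pb (dy 1 rho) x t).
have ca : continuous_onD (rect 0 1 T) (fun x t => L t * pb rho x t).
  by apply: continuous_onDM => //; apply: cL => z; exact: rect_time.
apply: (@exact_potential R _ _ d T (4 * K * (KL * Kr))) => //.
- by rewrite !mulr_ge0// ltW.
- exact: (continuous_onD_slice_x ca).
- by move=> x x01; apply: (@slice_open (fun x t => L t * pb rho x t)) => //; exact: r2 ca.
- move=> x x01; apply: (@slice_open (fun x t => - (c x t * (L t * pb rho x t)))) => //.
  apply: (@continuous_onD_ext _ _ (fun x t => - ((pb u x t + - V x t) * pb rho x t))).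
    by move=> y t [/= _ tT]; rewrite bE.
  apply: continuous_onDN; apply: continuous_onDM => //.
  by apply: continuous_onDD => //; exact: continuous_onDN.
- move=> x t x01 tT; rewrite normrN normrM mulrAC.
  have [r0 x01'] : 0 < pb rho x t /\ 0 <= x <= 1.
    by split; [exact: (rho_gt0 F (tubeX x01 tT))|case/andP: x01 => /ltW -> /ltW ->].
  apply: ler_pM => //; first exact: cK.
  by rewrite normrM; apply: ler_pM => //; [exact: (LK x)|exact: rK].
- move=> x t x01 tT.
  have -> : (fun x => - (c x t * (L t * pb rho x t))) = (fun x => -
    ((pb u x t - V x t) * pb rho x t)).
    by apply/funext => y; rewrite bE.
  have h := is_deriveN (is_deriveM (is_deriveB (dxf (u_C21 C) (ltn0Sn 1) x01 tT) (dVx x t))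
    (dxf (rho_C11 C) (ltn0Sn 0) x01 tT)).
  apply: is_derive_eq h _.
  have mb := mass_balance F C (tubeX x01 tT).
  have mb' : pb (dt T rho) x t = - (pb rho x t * pb (dy 1 u) x t) - pb u x t * pb (dy 1 rho) x t.
    by rewrite /pb -mb; ring.
  by rewrite /GRing.scale/= /d mb' -[(_ - _) x]/(pb u x t - V x t) -[pb
    (dy 0 rho) x t]/(pb rho x t); ring.
- move=> x t x01 tT.
  have h := is_deriveM (is_derive_width dw1 dw2 tT) (dtf (ltn0Sn 0) (rho_C11 C) x01 tT).
  by apply: is_derive_eq h _; rewrite /GRing.scale/= /d /L' -/L; ring.
- apply: continuous_onDD; first exact: continuous_onDM.
  apply: continuous_onDM => //; apply: continuous_onDD; first exact: (co crt).
  exact: (continuous_onDM cV_o (co (cr (leqnn 1)))).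
Qed.

Let tube_position y t : tubeT (y, t) -> exists2 x, 0 < x < 1 & y = X x t.
Proof.
move=> [/= tT /andP[wy yw]]; have L0 := L_gt0 tT; exists ((y - w1 t) / L t).
  apply/andP; split; first by apply: divr_gt0 => //; rewrite subr_gt0.
  by rewrite ltr_pdivrMr// mul1r /L /width ltrD2r.
by rewrite /X /position -/L divfK ?gt_eqF// addrC subrK.
Qed.

(** The stress has a bounded space derivative and zero trace at both ends, so it vanishes linearly
    there. This makes the momentum flux vanish at the ends, as [exact_potential] demands. *)
Lemma effective_stress_bound : exists2 K, 0 <= K & forall x t, 0 < x < 1 -> 0 <= t <= T ->
  `|pb G x t| <= K * (x * (1 - x)).
Proof.
have [K K0 HK] := state_bounded T0 gamma1 Rg0 Abar0 F E C.
have [Kr Kr0 rK] := continuous_onD_bounded c_rho.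
have [KL KL0 LK] := continuous_onD_bounded (cL (@rect_time 0 1)).
pose Cg := Kr * (K + K * K).
have Cg0 : 0 <= Cg by rewrite mulr_ge0 ?addr_ge0 ?mulr_ge0// ltW.
exists (Cg * KL * 2); first by rewrite mulr_ge0// mulr_ge0// ltW.
move=> x t x01 tT; have D := tubeX x01 tT.
have dG y : w1 t < y < w2 t ->
    is_derive y 1 (G ^~ t) (rho y t * (dt T u y t + u y t * dy 1 u y t)).
  by move=> yI; exact: (is_derive_effective_stress F C (y := y) (t := t) (conj tT yI)).
have GK y : w1 t < y < w2 t -> `|rho y t * (dt T u y t + u y t * dy 1 u y t)| <= Cg.
  move=> yI; have Dy : tubeT (y, t) by [].
  have [h1 h2 h3 _] := HK _ _ Dy; have [z z01 yE] := tube_position Dy.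
  rewrite normrM; apply: ler_pM => //.
    by rewrite yE; apply: rK => //; case/andP: z01 => /ltW -> /ltW ->.
  by apply: le_trans (ler_normD _ _) _; apply: lerD => //; rewrite normrM ler_pM.
have [g1 g2] := effective_stress_boundary F C tT.
have xI : w1 t < X x t < w2 t by case: D.
have b1 := vanishing_left_bound dG GK g1 xI.
have b2 := vanishing_right_bound dG GK g2 xI.
have e1 : X x t - w1 t = x * L t by rewrite /X /position -/L; ring.
have e2 : w2 t - X x t = (1 - x) * L t by rewrite /X /position /L /width; ring.
rewrite e1 in b1; rewrite e2 in b2.
have L0 := L_gt0 tT.
have LKt : L t <= KL by apply: le_trans (ler_norm _) (LK x t _ tT); case/andP:
  x01 => /ltW -> /ltW ->.
have h : `|pb G x t| <= Cg * L t * Num.min x (1 - x).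
  rewrite minEle; case: ifPn => _.
    by rewrite (_ : Cg * L t * x = Cg * (x * L t)) //; ring.
  by rewrite (_ : Cg * L t * (1 - x) = Cg * ((1 - x) * L t)) //; ring.
apply: (le_trans h).
have m0 : 0 <= Num.min x (1 - x) by case/andP: x01 => ? ?; rewrite le_min subr_ge0 !ltW.
apply: (@le_trans _ _ (Cg * KL * Num.min x (1 - x))).
  by rewrite ler_wpM2r// ler_wpM2l.
rewrite -(mulrA (Cg * KL)); apply: ler_wpM2l; first by rewrite mulr_ge0// ltW.
exact: min_le_bump.
Qed.

Let cG : continuous_onD tubeT G.
Proof.
have [_ cth _ _] := theta_C11 C.
apply: continuous_onDD.
  apply: continuous_onDM; last exact: cu.
  apply: continuous_onDM; first exact: continuous_onD_cst.
  by apply: continuous_onD_powR (cth 0%N _) => // y t; exact: (theta_gt0 F).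
apply: continuous_onDN; apply: continuous_onDM; last exact: (cth 0%N).
by apply: continuous_onDM; [exact: continuous_onD_cst|exact: (cr (leq0n 1))].
Qed.

(** Closedness is here the momentum equation in conservative form: the time derivative of L rho u is
    the space derivative of the stress minus c L rho u. The sign-indefinite gradient p_y is thereby
    integrated away. *)
Lemma momentum_potential : exists q : R -> R -> R,
  [/\ continuous_onD (rect 0 1 T) q,
    forall t, 0 <= t <= T -> q 0 t = 0 /\ q 1 t = q 1 0,
    forall x t, 0 < x < 1 -> 0 <= t <= T ->
      is_derive x 1 (q ^~ t) (L t * pb rho x t * pb u x t) &
    forall x t, 0 < x < 1 -> 0 < t < T ->
      is_derive t 1 (q x) (pb G x t - c x t * (L t * pb rho x t * pb u x t))].
Proof.
have [K K0 HK] := state_bounded T0 gamma1 Rg0 Abar0 F E C.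
have [Kr Kr0 rK] := continuous_onD_bounded c_rho.
have [Ku Ku0 uK] := continuous_onD_bounded c_u.
have [KL KL0 LK] := continuous_onD_bounded (cL (@rect_time 0 1)).
have [KG KG0 GK] := effective_stress_bound.
have cK := relative_velocity_bound (fun y t D => let: And4 _ h _ _ := HK y t D in h).
have bE x t : 0 <= t <= T -> pb G x t - c x t * (L t * pb rho x t * pb u x t) =
    pb G x t - (pb u x t - V x t) * pb rho x t * pb u x t.
  by move=> tT; rewrite -cLE//; ring.
have z0 : (0 : R) <= 0 <= T by rewrite lexx ltW.
pose d x t := L' t * (pb rho x t * pb u x t) + L t *
  ((pb (dt T rho) x t + V x t * pb (dy 1 rho) x t) * pb u x t +
   pb rho x t * (pb (dt T u) x t + V x t * pb (dy 1 u) x t)).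
have ca : continuous_onD (rect 0 1 T) (fun x t => L t * pb rho x t * pb u x t).
  by apply: continuous_onDM => //; apply: continuous_onDM => //; apply: cL => z; exact: rect_time.
have B0 : 0 <= KG + 4 * K * (KL * Kr * Ku).
  by rewrite addr_ge0// mulr_ge0 ?mulr_ge0// ltW.
apply: (@exact_potential R _ _ d T _ T0 B0).
- exact: (continuous_onD_slice_x ca).
- by move=> x x01; apply: (@slice_open (fun x t => L t * pb rho x t * pb u x t)) => //; exact:
  r2 ca.
- move=> x x01; apply: (@slice_open (fun x t => pb G x t - c x t *
  (L t * pb rho x t * pb u x t))) => //.
  apply: (@continuous_onD_ext _ _ (fun x t => pb G x t + -
    ((pb u x t + - V x t) * pb rho x t * pb u x t))).
    by move=> y t [/= _ tT]; rewrite bE.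
  apply: continuous_onDD; first exact: (co cG).
  apply: continuous_onDN; apply: continuous_onDM => //; apply: continuous_onDM => //.
  by apply: continuous_onDD => //; exact: continuous_onDN.
- move=> x t x01 tT; apply: (le_trans (ler_normB _ _)); rewrite [leRHS]mulrDl; apply: lerD;
  first exact: GK.
  have x01' : 0 <= x <= 1 by case/andP: x01 => /ltW -> /ltW ->.
  rewrite normrM [leRHS]mulrAC; apply: ler_pM => //; first exact: cK.
  rewrite !normrM; apply: ler_pM => //; last exact: uK.
  by apply: ler_pM => //; [exact: (LK x)|exact: rK].
- move=> x t x01 tT.
  have -> : (fun x => pb G x t - c x t * (L t * pb rho x t * pb u x t)) =
      (fun x => pb G x t - (pb u x t - V x t) * pb rho x t * pb u x t).
    by apply/funext => y; rewrite bE.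
  have du := dxf (u_C21 C) (ltn0Sn 1) x01 tT.
  have dr := dxf (rho_C11 C) (ltn0Sn 0) x01 tT.
  have Dx := tubeX x01 tT.
  have dGx : is_derive x 1 (pb G ^~ t)
      (pb rho x t * (pb (dt T u) x t + pb u x t * pb (dy 1 u) x t) * L t).
    exact: (@is_derive1_comp R (G ^~ t) (X ^~ t) x _ _ (is_derive_effective_stress F C Dx)
      (is_derive_position_x w1 w2 x t)).
  have h1 : is_derive x 1 (fun x => (pb u x t - V x t) * pb rho x t)
      ((pb u x t - V x t) * (L t * pb (dy 1 rho) x t) + pb rho x t * (L t * pb
        (dy 1 u) x t - L' t)).
    exact: is_deriveM (is_deriveB du (dVx x t)) dr.
  have h2 : is_derive x 1 (fun x => (pb u x t - V x t) * pb rho x t * pb u x t)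
      ((pb u x t - V x t) * pb rho x t * (L t * pb (dy 1 u) x t) +
       pb u x t * ((pb u x t - V x t) * (L t * pb (dy 1 rho) x t) + pb rho x t * (L t * pb
         (dy 1 u) x t - L' t))).
    exact: is_deriveM h1 du.
  apply: is_derive_eq (is_deriveB dGx h2) _.
  have mb := mass_balance F C Dx.
  have mb' : pb (dt T rho) x t = - (pb rho x t * pb (dy 1 u) x t) - pb u x t * pb (dy 1 rho) x t.
    by rewrite /pb -mb; ring.
  rewrite /d mb'.
  move: (pb u x t) (pb rho x t) (pb (dy 1 u) x t) (pb (dy 1 rho) x t) (pb (dt T u) x t).
  by move: (V x t) (L t) (L' t) => *; ring.
- move=> x t x01 tT.
  have du := dtf (ltn0Sn 1) (u_C21 C) x01 tT.
  have dr := dtf (ltn0Sn 0) (rho_C11 C) x01 tT.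
  have h := is_deriveM (is_deriveM (is_derive_width dw1 dw2 tT) dr) du.
  apply: is_derive_eq h _; rewrite /GRing.scale/= /d /L' -/L.
  rewrite -[(_ * _) t]/(L t * pb rho x t).
  move: (pb u x t) (pb rho x t) (pb (dy 1 u) x t) (pb (dy 1 rho) x t) (pb (dt T u) x t).
  by move: (pb (dt T rho) x t) (V x t) (L t) (u (w1 t) t) (u (w2 t) t) => *; ring.
- apply: continuous_onDD; first by apply: continuous_onDM => //; exact: continuous_onDM.
  apply: continuous_onDM => //; apply: continuous_onDD.
    apply: continuous_onDM => //; apply: continuous_onDD; first exact: (co crt).
    exact: (continuous_onDM cV_o (co (cr (leqnn 1)))).
  apply: continuous_onDM => //; apply: continuous_onDD; first exact: (co cut).
  exact: (continuous_onDM cV_o (co (cu (isT : (1 <= 2)%N)))).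
Qed.

Lemma normalized_flow_of_FBP : 0 < C1 -> 0 < delta -> 0 <= alpha <= 1 / (gamma - 1) ->
  0 < 1 / (delta * (gamma - 1)) < Num.min (1 / 2 * ((gamma - 2) / (gamma - 1) + alpha)) 1 ->
  density_profile C1 C2 delta rho0 ->
  exists (k K : R) (N q : R -> R -> R),
    normalized_flow T delta ((gamma + alpha * (gamma - 1)) / 2) k K (gamma - 1) L
      (pb rho) (pb u) (pb (dy 1 u)) c sg (pb nu) (pb p) N q.
Proof.
move=> C10 delta0 /andP[al0 al1] /andP[_]; rewrite lt_min => /andP[cond _] prof.
have g0 : 0 < gamma - 1 by rewrite subr_gt0.
have a1 : alpha * (gamma - 1) <= 1 by rewrite -ler_pdivlMr.
have [K K0 HK] := state_bounded T0 gamma1 Rg0 Abar0 F E C.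
have [Kr Kr0 rK] := continuous_onD_bounded c_rho.
have cLr := cL (@rect_time 0 1).
have [KL KL0 LK] := continuous_onD_bounded cLr.
have [kc kc0 [Kc Kc0 Hc]] := constitutive_bounds K nubar0 Rg0 gamma1 al0 a1 Kr0.
have z0 : 0 <= (0 : R) <= T by rewrite lexx ltW.
have x00 : 0 <= (0 : R) <= 1 by rewrite lexx ler01.
have rho0E x : 0 < x < 1 -> pb rho x 0 = rho0 x.
  by move=> x01; rewrite /pb position_initial; case: (FBP_initial F x01).
have rho0_gt0 x : 0 < x < 1 -> 0 < rho0 x.
  by move=> x01; rewrite -rho0E//; exact: (rho_gt0 F (tubeX x01 z0)).
have [kd kd0 [Kd Kd0 Hd]] := density_profile_bounds C10 delta0 prof rho0_gt0
  (continuous_onD_slice_x c_rho z0) rho0E.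
(* The width is positive and continuous on the compact interval [[0, T]], so it cannot collapse. *)
have [kL kL0 HL] : exists2 kL, 0 < kL & forall t, 0 <= t <= T -> kL <= L t.
  have [z zI Hz] := EVT_min (ltW T0) (continuous_onD_slice_t cLr x00).
  exists (L z); first by apply: L_gt0; move: zI; rewrite in_itv.
  by move=> t tT; apply: Hz; rewrite in_itv.
have cK := relative_velocity_bound (fun y t D => let: And4 _ h _ _ := HK y t D in h).
have [N [cN Nb Nx Nt]] := mass_potential.
have [q [cq qb qx qt]] := momentum_potential.
have rho_gt x t : 0 < x < 1 -> 0 <= t <= T -> 0 < pb rho x t.
  by move=> x01 tT; exact: (rho_gt0 F (tubeX x01 tT)).
have theta_gt x t : 0 < x < 1 -> 0 <= t <= T -> 0 < pb theta x t.
  by move=> x01 tT; exact: (theta_gt0 F (tubeX x01 tT)).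
pose k := Num.min (Num.min kc kd) kL; pose M := 4 * K + Kc + Kd + KL.
have [kkc kkd kkL] : [/\ k <= kc, k <= kd & k <= kL] by rewrite /k !ge_min !lexx !orbT.
have [KM K4M KcM KdM KLM] : [/\ K <= M, 4 * K <= M, Kc <= M, Kd <= M & KL <= M].
  exact: sum_upper_bounds (ltW K0) (ltW Kc0) (ltW Kd0) (ltW KL0).
have ltT t : 0 <= t < T -> 0 <= t <= T by move=> /andP[-> /ltW].
exists k, M, N, q; split => //.
- exact: exponent_condition.
- by rewrite !lt_min kc0 kd0.
- by rewrite /M !addr_gt0// mulr_gt0.
- move=> t tT; rewrite (le_trans kkL) ?HL//=; apply: le_trans KLM.
  exact: le_trans (ler_norm _) (LK 0 t x00 tT).
- move=> x t x01 tT.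
  have cs : continuous_onD (open_rect T) sg.
    have [_ cth _ _] := theta_C11 C.
    apply: continuous_onDD.
      apply: continuous_onD_ln; last exact: (r2 open_rect_sub c_theta).
      by move=> y r [/= yI rI]; exact: theta_gt.
    apply: continuous_onDN; apply: continuous_onDM; first exact: continuous_onD_cst.
    by apply: continuous_onD_ln => // y r [/= yI rI]; exact: rho_gt.
  move/continuous_onDP : cs => /(_ (x, t) (conj x01 tT)) cs A HA.
  have h : \forall z \near nbhs (x, t), open_rect T z -> A (sg z.1 z.2) := cs A HA.
  (* Close to an interior [x], the open rectangle and the closed one have the same points, so
     continuity relative to the former suffices. *)
  have nI : \forall z \near nbhs ((x, t) : R * R), 0 < z.1 < 1.
    have := @near_in_itvoo R 0 1 x; rewrite in_itv/= => /(_ x01) n01.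
    have cfst : fst z @[z --> nbhs ((x, t) : R * R)] --> x by exact: cvg_fst.
    by apply: (@filterS _ (nbhs ((x, t) : R * R)) _ _ _ _ (cfst _ n01)) => z; rewrite /= in_itv.
  apply: (@filterS2 _ (nbhs ((x, t) : R * R)) _ _ _ _ _ h nI) => z hz zI [_ zT].
  by apply: hz; split.
- by move=> x x01; exact: is_derive_continuous (dxf (u_C21 C) (ltn0Sn 1) x01 z0).
- move=> x x01; rewrite rho0E//; have /andP[h1 h2] := Hd _ x01; apply/andP; split.
  + by apply: le_trans h1; rewrite ler_wpM2r ?powR_ge0.
  + by apply: (le_trans h2); rewrite ler_wpM2r ?powR_ge0.
- move=> t tT; have [r1 r2' _ _] := FBP_vacuum F tT.
  by rewrite /pb /X position0 position1.
- by move=> x t x01 tT; split; [exact: rho_gt|exact: (pressure_gt0 Rg0 F (tubeX x01 tT))].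
- move=> x t x01 tT; have r0 := rho_gt _ _ x01 tT; have D := tubeX x01 tT.
  have rKr : pb rho x t <= Kr.
    by apply: le_trans (ler_norm _) (rK _ _ _ tT); case/andP: x01 => /ltW -> /ltW ->.
  have [_ _ _ sK] := HK _ _ D.
  have [h1 h2 h3] := Hc _ _ r0 rKr (theta_gt _ _ x01 tT) sK; split.
  + by apply: le_trans h1; rewrite ler_pM2r.
  + by apply: (le_trans h2); rewrite ler_wpM2r ?sqr_ge0.
  + by apply: (le_trans h3); rewrite ler_wpM2r ?powR_ge0.
- by move=> x t x01 tT; have [_ h _ _] := HK _ _ (tubeX x01 tT); exact: le_trans KM.
- move=> x t x01 tT; apply: (le_trans (cK _ _ x01 tT)); rewrite ler_wpM2r//.
  by case/andP: x01 => ? ?; rewrite mulr_ge0 ?subr_ge0// ltW.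
- by move=> x t x01 tT; have [_ _ _ h] := HK _ _ (tubeX x01 tT); exact: le_trans KM.
- exact: transport_density.
- exact: transport_entropy.
- by move=> x t x01 tT; exact: (dxf (u_C21 C) (ltn0Sn 1) x01 (timeW tT)).
- by move=> x t x01 /ltT; exact: Nx.
- by move=> x t x01 /ltT; exact: qx.
Qed.

(** Continuity of [u] on the closed tube gives the initial velocity limits at both ends, and the
    weighted integrability forces them to be 0. The bound on u_y turns this into linear decay. *)
Lemma initial_velocity_bounds : weighted_L2 u0 -> exists2 Ku : R, 0 <= Ku &
  forall x, 0 < x < 1 ->
    [/\ pb u x 0 = u0 x, `|pb u x 0| <= Ku * x & `|pb u x 0| <= Ku * (1 - x)].
Proof.
move=> wu; have [K K0 HK] := state_bounded T0 gamma1 Rg0 Abar0 F E C.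
have z0 : 0 <= (0 : R) <= T by rewrite lexx ltW.
have uE x : 0 < x < 1 -> pb u x 0 = u0 x.
  by move=> x01; rewrite /pb position_initial; case: (FBP_initial F x01).
have cu0 := continuous_onD_slice_x c_u z0.
have [_ cl crr] := (continuous_within_itvP _ ltr01).1 cu0.
have ul : pb u 0 0 = 0.
  apply: weighted_L2_left_limit wu _; apply: cvg_trans cl; apply: near_eq_cvg.
  near=> y; apply: uE; apply/andP; split; first by near: y; exact: nbhs_right_gt.
  by near: y; apply: nbhs_right_lt.
have ur : pb u 1 0 = 0.
  apply: weighted_L2_right_limit wu _; apply: cvg_trans crr; apply: near_eq_cvg.
  near=> y; apply: uE; apply/andP; split; last by near: y; exact: nbhs_left_lt.
  by near: y; apply: nbhs_left_gt.
rewrite ul in cl; rewrite ur in crr.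
exists (L 0 * K); first by rewrite mulr_ge0 ?(ltW K0)// ltW// L_gt0.
have du x : 0 < x < 1 -> is_derive x 1 (pb u ^~ 0) (L 0 * pb (dy 1 u) x 0).
  by move=> x01; exact: (dxf (u_C21 C) (ltn0Sn 1) x01 z0).
have bd x : 0 < x < 1 -> `|L 0 * pb (dy 1 u) x 0| <= L 0 * K.
  move=> x01; rewrite normrM (gtr0_norm (L_gt0 z0)) ler_pM2l ?L_gt0//.
  by case: (HK _ _ (tubeX x01 z0)).
move=> x x01; split; first exact: uE.
- by have := vanishing_left_bound du bd cl x01; rewrite subr0.
- exact: vanishing_right_bound du bd crr x01.
Unshelve. all: by end_near. Qed.

End normalization.

Theorem theorem1p5 (R : realType) (C1 C2 : R) (hC1 : 0 < C1) (hC2 : 0 < C2) :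
  exists2 d0 : R, 0 < d0 < 1 &
  forall (mubar lambdabar alpha gamma Rg Abar delta : R)
         (rho0 u0 theta0 : R -> R),
    0 < mubar -> 0 < 2 * mubar + lambdabar ->
    1 < gamma -> 0 < Rg -> 0 < Abar ->
    0 <= alpha <= 1 / (gamma - 1) ->
    0 < delta ->
    vacuum_data rho0 theta0 ->
    density_profile C1 C2 delta rho0 ->
    0 < 1 / (delta * (gamma - 1))
      < Num.min (1 / 2 * ((gamma - 2) / (gamma - 1) + alpha)) 1 ->
    weighted_L2 u0 ->
    (exists Y0 : R, [/\ 0 < Y0 < d0, u0 Y0 < 0 &
        forall y, 0 < y < Y0 -> u0 y <= 0]) \/
    (exists Y0 : R, [/\ 1 - d0 < Y0 < 1, 0 < u0 Y0 &
        forall y, Y0 < y < 1 -> 0 <= u0 y]) ->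
    forall T : R, 0 < T ->
      ~ exists (w1 w2 : R -> R) (rho u theta s : R -> R -> R),
        [/\ FBP mubar lambdabar alpha gamma Rg T rho0 u0 theta0
              w1 w2 rho u theta,
            is_entropy gamma Rg Abar T w1 w2 rho theta s &
            regular_class T w1 w2 rho u theta s].
Proof.
exists (1 / 2); first by apply/andP; split; lra.
move=> mubar lambdabar alpha gamma Rg Abar delta rho0 u0 theta0 mubar0 nubar0 gamma1 Rg0
  Abar0 alphaI delta0 _ prof cond wu sgn T T0 [w1 [w2 [rho [u [theta [s [F E C]]]]]]].
have [k [K [N [q H]]]] :=
  normalized_flow_of_FBP T0 nubar0 gamma1 Rg0 Abar0 F E C hC1 delta0 alphaI cond prof.
have [Ku Ku0 uK] := initial_velocity_bounds T0 gamma1 Rg0 Abar0 F E C wu.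
case: sgn => -[Y0 [/andP[Y1 Y2] uY usgn]].
- have Y01 : 0 < Y0 < 1 by apply/andP; split; lra.
  apply: (no_left_inflow H Ku0 _ Y01).
  + by move=> x x01; case: (uK x x01).
  + by case: (uK _ Y01) => ->.
  + move=> x /andP[x0 xY]; have x01 : 0 < x < 1 by apply/andP; split; lra.
    by case: (uK _ x01) => -> _ _; apply: usgn; rewrite x0.
- have Y01 : 0 < Y0 < 1 by apply/andP; split; lra.
  apply: (no_right_outflow H Ku0 _ Y01).
  + by move=> x x01; case: (uK x x01).
  + by case: (uK _ Y01) => ->.
  + move=> x /andP[x0 xY]; have x01 : 0 < x < 1 by apply/andP; split; lra.
    by case: (uK _ x01) => -> _ _; apply: usgn; rewrite x0.
Qed.
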